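(* Let $j>0$ and $u\in L^\infty([0,1],\mathbb R_+)$ with $F(0;u)>0$. Then there exists a unique function $u(r,t)$, $r\in[0,1]$, $t>0$ (with $u(\cdot,0):=u$), which separates the barriers $\{S^{(\delta,\pm)}_{n\delta}(u)\}$, i.e. such that $$S^{(\delta,-)}_t(u)\le u(\cdot,t)\le S^{(\delta,+)}_t(u)$$ for all $\delta>0$ (for which the barriers are defined, i.e. $F(0;u)>j\delta$) and all $t=k\delta$, $k\in\mathbb N$. Moreover $u(r,t)$ is continuous on the compact subsets of $[0,1]\times(0,\infty)$ and $u(\cdot,t)$ converges weakly to $u$ as $t\to0$.
   Context: For a positive Borel measure $\mu$ on $[0,1]$ let $F(r;\mu)=\mu([r,1])$ (for a density $u$, $F(r;u)=\int_r^1u$); for two such measures $\mu\le\nu$ iff $F(r;\mu)\le F(r;\nu)$ for all $r\in[0,1]$. $\mathcal U$ is the set of measures $c D_0+\rho(r)dr$ with $c\ge0$, $\rho\in L^\infty([0,1],\mathbb R_+)$, $D_0$ the Dirac mass at $0$. For $\delta>0$, $\mathcal U_\delta=\{cD_0+\rho\in\mathcal U:\int_0^1\rho>j\delta\}$ and $K^{(\delta)}u=j\delta D_0+\mathbf 1_{[0,R_\delta(u)]}u$ on $\mathcal U_\delta$, with $R_\delta(u)=\inf\{r:F(r;u)=j\delta\}$. $G^{\rm neum}_t(r,r')$ is the heat kernel of $\partial_t=\frac12\partial_r^2$ on $[0,1]$ with Neumann boundary conditions, i.e. $\sum_kG_t(r,r'_k)$ with $G_t(r,r')=e^{-(r-r')^2/2t}/\sqrt{2\pi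 t}$ and $r'_k$ the images of $r'$ under repeated reflections of $[0,1]$; $G^{\rm neum}_t*\mu(r)=\int G^{\rm neum}_t(r,r')\mu(dr')$. Barriers: for $F(0;u)>j\delta$, $S^{(\delta,\pm)}_0(u)=u$, $S^{(\delta,-)}_{n\delta}(u)=K^{(\delta)}G^{\rm neum}_\delta*S^{(\delta,-)}_{(n-1)\delta}(u)$, $S^{(\delta,+)}_{n\delta}(u)=G^{\rm neum}_\delta*K^{(\delta)}S^{(\delta,+)}_{(n-1)\delta}(u)$. *)

(* Defs.v *)
From HB Require Import structures.
From mathcomp Require Import all_boot all_order all_algebra.
From mathcomp Require Import all_classical all_reals all_analysis.
Set Implicit Arguments. Unset Strict Implicit. Unset Printing Implicit Defensive.
Import Order.TTheory GRing.Theory Num.Theory.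
Import numFieldNormedType.Exports.
Local Open Scope classical_set_scope.
Local Open Scope ring_scope.

Section Defs.
Variable R : realType.

Definition I01 : set R := `[0, 1].

(* A measure  c D_0 + rho(r) dr  on [0,1] is represented by the pair (c, rho);
   only the values of rho on [0,1] matter. *)
Definition meas := (R * (R -> R))%type.

Definition Lint (A : set R) (f : R -> R) : R :=
  Rintegral (@lebesgue_measure R) A f.

Definition Linf_pos (f : R -> R) : Prop :=
  measurable_fun I01 f /\
  (forall r, r \in `[0, 1] -> 0 <= f r) /\
  (exists M : R, forall r, r \in `[0, 1] -> f r <= M).

Definition in_U (mu : meas) : Prop := 0 <= mu.1 /\ Linf_pos mu.2.

(* F(r; mu) = mu([r,1]) for r in [0,1]: the Dirac mass at 0 counts iff r = 0 *)
Definition Fm (mu : meas) (r : R) : R :=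
  (if r == 0 then mu.1 else 0) + Lint (`[r, 1] : set R) mu.2.

Definition Fd (u : R -> R) (r : R) : R := Lint (`[r, 1] : set R) u.

Definition meas_le (mu nu : meas) : Prop :=
  forall r, r \in `[0, 1] -> Fm mu r <= Fm nu r.

Definition gauss (t x : R) : R :=
  expR (- (x ^+ 2) / (2 * t)) / Num.sqrt (2 * pi * t).

(* Neumann heat kernel on [0,1] by the method of images:
   sum over k in Z of G_t(r, r' + 2k) + G_t(r, -r' + 2k);
   k = n and k = -(n+1) for n : nat. *)
Definition Gneum (t r r' : R) : R :=
  limn (series (fun n : nat =>
    gauss t (r - r' - 2 * n%:R) + gauss t (r + r' - 2 * n%:R)
     + gauss t (r - r' + 2 * n.+1%:R) +  gauss t (r + r' + 2 * n.+1%:R))).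

Definition Gconv (t : R) (mu : meas) : meas :=
  (0, fun r => mu.1 * Gneum t r 0 + Lint I01 (fun r' => Gneum t r r' * mu.2 r')).

Definition Rdelta (j delta : R) (mu : meas) : R :=
  inf [set r | r \in `[0, 1] /\ Fm mu r = j * delta].

Definition Kdelta (j delta : R) (mu : meas) : meas :=
  (j * delta + mu.1,
   fun r => if r <= Rdelta j delta mu then mu.2 r else 0).

Definition Sminus (j delta : R) (u : R -> R) (n : nat) : meas :=
  iter n (fun mu => Kdelta j delta (Gconv delta mu)) (0, u).
Definition Splus (j delta : R) (u : R -> R) (n : nat) : meas :=
  iter n (fun mu => Gconv delta (Kdelta j delta mu)) (0, u).

(* U : r -> t -> U(r,t) separates the barriers: for every delta > 0 with
   F(0;u) > j delta and every t = k delta, k >= 1 (for k = 0 the condition is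
   trivial by the convention U(.,0) := u). *)
Definition separates (j : R) (u : R -> R) (U : R -> R -> R) : Prop :=
  forall delta : R, 0 < delta -> Fd u 0 > j * delta ->
  forall k : nat,
    meas_le (Sminus j delta u k.+1) (0, fun r => U r (k.+1%:R * delta)) /\
    meas_le (0, fun r => U r (k.+1%:R * delta)) (Splus j delta u k.+1).

End Defs.

(* Main.v *)
Require Import Defs.
From HB Require Import structures.
From mathcomp Require Import all_boot all_order all_algebra.
From mathcomp Require Import all_classical all_reals all_analysis.
From mathcomp Require Import measurable_realfun.
From mathcomp Require Import ring lra.
Import Order.TTheory GRing.Theory Num.Theory.
Import numFieldNormedType.Exports.
Local Open Scope classical_set_scope.
Local Open Scope ring_scope.

(** Everything is read off the tail functions F(r) = mu([r,1]).  On them the cut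
    K^(d) is F -> max (F - j d) 0 (away from r = 0), and the Neumann heat flow is
    monotone because the mass it sends from y into [r,1] is nondecreasing in y,
    which amounts to nonnegativity of the Dirichlet kernel.  Hence S^- <= S^+,
    refining the mesh raises S^- and lowers S^+, and the gap S^+ - S^- is at most
    j d since K^(d) intertwines the two iterations.

    The tail functions of S^+ along the meshes t / 2^n are therefore Cauchy.  On the
    last stretch of time h a barrier differs from the pure heat flow by
    O(sqrt h) in sup norm, so the densities are equicontinuous in r; closeness of the
    tails then upgrades to uniform closeness of the densities, which yields the limit
    U, its joint continuity and its initial value.  Any two separating functions have
    tails within j d of each other for arbitrarily small d, hence equal tails, and
    coincide almost everywhere by Lebesgue differentiation. *)

(** * The Gaussian kernel *)

Section Gauss.
Context {R : realType}.
Implicit Types (s t m x y : R).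
Local Notation mu := (@lebesgue_measure R).

(** The heat equation itself never appears: mass, positivity and the semigroup law are all extracted
    from the image series. Three obstacles shape the rest. Each cut creates an atom at 0, so the
    density of the datum does not control those of the barriers. But moving a mass [j * d] is
    visible only at height O([j * d / sqrt s]) after a time [s], and summed over the cuts of a last
    stretch this is a Riemann sum of the convergent integral of [1 / sqrt s], whatever the mesh.
    Separation is required for every mesh, whereas the limit runs along [t / 2^n]. Meshes are
    therefore compared only through a common refinement, [t / (k 2^n)] when [t = k d]. Two different
    times share no such grid. Continuity in time instead compares equal numbers of steps, of lengths
    [t / l] and [t' / l]: with [l] fixed, the iterate depends continuously on the step length, and
    [l] was chosen to make the barrier error small. *)

Lemma gauss_ge0 t x : 0 <= gauss t x.
Proof. by rewrite /gauss divr_ge0 ?expR_ge0 ?sqrtr_ge0. Qed.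

Lemma gaussN t x : gauss t (- x) = gauss t x.
Proof. by rewrite /gauss sqrrN. Qed.

Lemma gauss_norm t x : gauss t `|x| = gauss t x.
Proof. by rewrite /gauss real_normK ?num_real. Qed.

Lemma sqr_le_norm x y : `|y| <= `|x| -> y ^+ 2 <= x ^+ 2.
Proof.
by move=> yx; rewrite -(real_normK (num_real y)) -(real_normK (num_real x)) lerXn2r ?nnegrE.
Qed.

Lemma gauss_le t x y : 0 < t -> `|y| <= `|x| -> gauss t x <= gauss t y.
Proof.
move=> t0 yx; rewrite /gauss ler_wpM2r ?invr_ge0 ?sqrtr_ge0//.
rewrite ler_expR !mulNr lerN2 ler_wpM2r ?invr_ge0 ?mulr_ge0 ?(ltW t0)//.
exact: sqr_le_norm.
Qed.

Lemma gauss_normal_pdf t m x : 0 < t -> gauss t (x - m) = normal_pdf m (Num.sqrt t) x.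
Proof.
move=> t0; rewrite normal_pdfE ?gt_eqF ?sqrtr_gt0//.
rewrite /normal_peak /normal_fun /gauss mulrC sqr_sqrtr ?ltW//.
by congr (_ * _); [congr (_^-1); congr (Num.sqrt _); ring | congr expR; congr (_ / _); ring].
Qed.

Lemma continuous_gauss t : 0 < t -> continuous (gauss t).
Proof.
move=> t0; have -> : gauss t = normal_pdf 0 (Num.sqrt t).
  by apply/funext => x; rewrite -gauss_normal_pdf// subr0.
by apply: continuous_normal_pdf; rewrite gt_eqF ?sqrtr_gt0.
Qed.

Lemma measurable_gauss t : 0 < t -> measurable_fun setT (gauss t).
Proof. by move=> t0; apply: continuous_measurable_fun; exact: continuous_gauss. Qed.

Lemma integral_gauss t m : 0 < t -> (\int[mu]_x (gauss t (x - m))%:E = 1)%E.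
Proof.
by move=> t0; under eq_integral do rewrite gauss_normal_pdf//; rewrite integral_normal_pdf.
Qed.

(** Completing the square in [z]: the exponents combine into one square centred at the weighted
    mean, plus a term free of [z]. Integrating out [z] then leaves the semigroup law. *)
Lemma gauss_mul s t x y z : 0 < s -> 0 < t ->
  gauss s (x - z) * gauss t (z - y) =
  gauss (s + t) (x - y) * gauss (s * t / (s + t)) (z - (t * x + s * y) / (s + t)).
Proof.
move=> s0 t0; have st0 : 0 < s + t by rewrite addr_gt0.
rewrite /gauss mulrACA [RHS]mulrACA -!expRD -!invfM -!sqrtrM ?mulr_ge0 ?pi_ge0 ?ltW//.
congr (expR _ / Num.sqrt _); field; rewrite ?gt_eqF//.
Qed.

Lemma integral_gauss_mul s t x y : 0 < s -> 0 < t ->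
  (\int[mu]_z (gauss s (x - z) * gauss t (z - y))%:E = (gauss (s + t) (x - y))%:E)%E.
Proof.
move=> s0 t0; have st0 : 0 < s + t by rewrite addr_gt0.
have r0 : 0 < s * t / (s + t) by rewrite divr_gt0 ?mulr_gt0.
under eq_integral do rewrite gauss_mul// EFinM.
rewrite ge0_integralZl//= ?lee_fin ?gauss_ge0//.
- by rewrite integral_gauss// mule1.
- apply/measurable_EFinP; apply: measurableT_comp; first exact: measurable_gauss.
  exact: measurable_funB.
- by move=> z _; rewrite lee_fin gauss_ge0.
Qed.

(** From [1 + a / 3 <= expR (a / 3)], cubed. The third power suits the later estimates: of the
    [t ^+ 3] it yields, one factor pays for the prefactor of the Gaussian and [t ^+ 2] remains. *)
Lemma expR_cube_ge (a : R) : 0 <= a -> (a / 3) ^+ 3 <= expR a.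
Proof.
move=> a0; have -> : a = 3%:R * (a / 3) by field.
rewrite [leRHS]expRM_natl; have -> : 3%:R * (a / 3) / 3 = a / 3 by field.
by rewrite lerXn2r ?nnegrE ?expR_ge0 ?divr_ge0// (le_trans _ (expR_ge1Dx _))// lerDr.
Qed.

Lemma expRB_le (a b : R) : a <= b -> expR (- a) - expR (- b) <= (b - a) * expR (- a).
Proof.
move=> ab; have -> : - b = - a + (a - b) by ring.
rewrite expRD -{1}(mulr1 (expR (- a))) -mulrBr mulrC ler_wpM2r ?expR_ge0//.
by have := expR_ge1Dx (a - b); lra.
Qed.

(* The loss of half of the variance in the exponent pays for the factor [|x|] of the derivative. *)
Lemma gauss_lip t m x y : 0 < t -> 0 <= m -> m <= `|x| -> m <= `|y| -> `|x - y| <= 2 ->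
  `|gauss t x - gauss t y| <=
  `|x - y| * ((2 + 4 * t) / t / Num.sqrt (2 * pi * t) * expR (- (m ^+ 2 / (4 * t)))).
Proof.
move=> t0 m0; wlog xy : x y / `|x| <= `|y|.
  move=> W mx my xy2; have [xy|xy] := leP `|x| `|y|; first exact: W.
  by rewrite distrC (distrC x); apply: W => //; rewrite ?(ltW xy)// distrC.
move=> mx my xy2.
rewrite ger0_norm ?subr_ge0 ?gauss_le//.
rewrite /gauss -mulrBl.
have x2y2 : x ^+ 2 <= y ^+ 2 by exact: sqr_le_norm.
rewrite !mulNr.
have t2 : 0 <= (2 * t)^-1 by rewrite invr_ge0 mulr_ge0 ?ltW.
set P := Num.sqrt _; have P0 : 0 <= P^-1 by rewrite invr_ge0 sqrtr_ge0.
have -> : `|x - y| * ((2 + 4 * t) / t / P * expR (- (m ^+ 2 / (4 * t)))) =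
   (`|x - y| * ((2 + 4 * t) / t * expR (- (m ^+ 2 / (4 * t))))) / P by ring.
apply: ler_wpM2r => //; apply: le_trans (expRB_le _ _ _) _; first by rewrite ler_wpM2r.
have E : expR (- (x ^+ 2 / (2 * t))) <= expR (- (m ^+ 2 / (4 * t))) * expR (- (x ^+ 2 / (4 * t))).
  rewrite -expRD ler_expR.
  have : m ^+ 2 / (4 * t) <= x ^+ 2 / (4 * t).
    apply: ler_wpM2r; first by rewrite invr_ge0 mulr_ge0 ?ltW.
    by apply: sqr_le_norm; rewrite ger0_norm.
  have -> : x ^+ 2 / (2 * t) = x ^+ 2 / (4 * t) + x ^+ 2 / (4 * t) by field; rewrite gt_eqF.
  lra.
have D : y ^+ 2 / (2 * t) - x ^+ 2 / (2 * t) <= `|x - y| * ((2 * `|x| + 2) / (2 * t)).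
  rewrite -mulrBl mulrA ler_wpM2r//.
  have -> : y ^+ 2 - x ^+ 2 = (y - x) * (y + x) by ring.
  apply: le_trans (ler_norm _) _; rewrite normrM distrC ler_wpM2l//.
  have -> : y + x = 2 * x + (y - x) by ring.
  by apply: le_trans (ler_normD _ _) _; rewrite normrM ger0_norm// lerD2l distrC.
apply: le_trans (ler_pM _ (expR_ge0 _) D E) _; first by rewrite subr_ge0 ler_wpM2r.
rewrite -[leLHS]mulrA ler_wpM2l// mulrCA [leRHS]mulrC ler_wpM2l ?expR_ge0//.
have -> : (2 * `|x| + 2) / (2 * t) = (`|x| + 1) / t by field; rewrite gt_eqF.
rewrite mulrAC ler_wpM2r ?invr_ge0 ?(ltW t0)//.
rewrite expRN ler_pdivrMr ?expR_gt0//.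
have h1 := expR_ge1Dx (x ^+ 2 / (4 * t)).
have h2 : (2 + 4 * t) * (1 + x ^+ 2 / (4 * t)) <= (2 + 4 * t) * expR (x ^+ 2 / (4 * t)).
  by rewrite ler_wpM2l//; lra.
apply: le_trans h2; have -> : (2 + 4 * t) * (1 + x ^+ 2 / (4 * t)) =
   2 + 4 * t + x ^+ 2 / (2 * t) + x ^+ 2 by field; rewrite gt_eqF.
have : 0 <= x ^+ 2 / (2 * t) by rewrite mulr_ge0 ?sqr_ge0.
have := sqr_ge0 (`|x| - 1); have <- := real_normK (num_real x).
rewrite sqrrB1 => ? ?; nra.
Qed.

End Gauss.

(** Convergence and bound come together because the values of the image series and its increments
    are both controlled through a geometric majorant. *)
Lemma geometric_series_bound {R : realType} (f : R^nat) (A q : R) :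
  0 <= q < 1 -> (forall n, `|f n| <= A * q ^+ n) ->
  cvgn (series f) /\ `|limn (series f)| <= A / (1 - q).
Proof.
move=> /andP[q0 q1] fA.
have nq : `|q| < 1 by rewrite ger0_norm.
have cg := @cvg_geometric_series R A q nq.
have A0 : 0 <= A by have := fA 0%N; rewrite expr0 mulr1; apply: le_trans.
have cn : cvgn [normed series f].
  apply: (@series_le_cvg _ _ (geometric A q)) => //.
  - by move=> n /=.
  - by move=> n; apply: geometric_ge0.
  - exact: cvgP (cg : _ --> _).
split; first exact: (@normed_cvg _ R^o).
apply: le_trans (@lim_series_norm _ R^o _ cn) _.
rewrite -(cvg_lim _ cg)//; apply: lim_series_le => //; exact: cvgP cg.
Qed.

(** * The periodized Gaussian: bounds, symmetries, behaviour at small times *)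

Section Theta.
Context {R : realType}.
Implicit Types (s t T m x y c e : R).

(* The heat kernel of the circle of length 2; the Neumann kernel is its symmetrization. *)
Definition theta_term t x (n : nat) : R :=
  gauss t (x - 2 * n%:R) + gauss t (x + 2 * n.+1%:R).
Definition theta t x : R := limn (series (theta_term t x)).

(** The inequality [a ^+ 2 >= 2 * a - 1] turns Gaussian decay in the image number into geometric
    decay. For [a < 0] the left side is negative. *)
Lemma sqr_ge_image c w (n : nat) : 2 * n%:R - 2 * c <= w -> 4 * (2 * (n%:R - c) - 1) <= w ^+ 2.
Proof.
move=> h; set a := n%:R - c in h *.
have {}h : 2 * a <= w by rewrite /a; lra.
have [a0|a0] := leP 0 a.
  have : (2 * a) ^+ 2 <= w ^+ 2 by rewrite lerXn2r ?nnegrE//; lra.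
  have := sqr_ge0 (a - 1); rewrite !expr2; nra.
by have := sqr_ge0 w; nra.
Qed.

Lemma expR_image_le t T c w (n : nat) : 0 < t -> t <= T -> 2 * n%:R - 2 * c <= w ->
  expR (- (w ^+ 2 / (2 * t))) <= expR ((2 + `|c| * 4) / T) * expR (- (4 / T)) ^+ n.
Proof.
move=> t0 tT /sqr_ge_image h.
have T0 : 0 < T by exact: lt_le_trans tT.
rewrite -expRM_natl -expRD ler_expR.
have h1 : w ^+ 2 / (2 * T) <= w ^+ 2 / (2 * t).
  by rewrite ler_wpM2l ?sqr_ge0// lef_pV2 ?posrE ?mulr_gt0// ler_wpM2l.
have h2 : 4 * (2 * (n%:R - c) - 1) / (2 * T) <= w ^+ 2 / (2 * T).
  by rewrite ler_wpM2r// invr_ge0 mulr_ge0// ltW.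
have h3 : c / T <= `|c| / T by rewrite ler_wpM2r ?ler_norm// invr_ge0 ltW.
have E : 4 * (2 * (n%:R - c) - 1) / (2 * T) = 4 * (n%:R / T) - 4 * (c / T) - 2 / T.
  by field; rewrite gt_eqF.
have -> : (2 + `|c| * 4) / T = 2 / T + 4 * (`|c| / T) by field; rewrite gt_eqF.
have -> : n%:R * - (4 / T) = - (4 * (n%:R / T)) by field; rewrite gt_eqF.
move: h1 h2 h3; rewrite E; lra.
Qed.

Lemma image_dist x c (n : nat) : `|x| <= 2 * c ->
  2 * n%:R - 2 * c <= `|x - 2 * n%:R| /\ 2 * n%:R - 2 * c <= `|x + 2 * n.+1%:R|.
Proof.
move=> xc; split.
  have : 2 * n%:R = x - (x - 2 * n%:R) by ring.
  move=> /(congr1 (fun z => `|z|)); rewrite ger0_norm ?mulr_ge0// => E.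
  have := ler_normB x (x - 2 * n%:R); rewrite -E; lra.
have : 2 * n.+1%:R = (x + 2 * n.+1%:R) - x by ring.
move=> /(congr1 (fun z => `|z|)); rewrite ger0_norm ?mulr_ge0// => E.
have := ler_normB (x + 2 * n.+1%:R) x; rewrite -E -natr1; lra.
Qed.

Lemma geo_ratio T : 0 < T -> 0 <= expR (- (4 / T)) < 1.
Proof. by move=> T0; rewrite expR_ge0/= expR_lt1 oppr_lt0 divr_gt0. Qed.

Lemma theta_term_ge0 t x n : 0 <= theta_term t x n.
Proof. by rewrite addr_ge0 ?gauss_ge0. Qed.

Lemma theta_term_le t T c x n : 0 < t -> t <= T -> `|x| <= 2 * c ->
  `|theta_term t x n| <=
  2 / Num.sqrt (2 * pi * t) * expR ((2 + `|c| * 4) / T) * expR (- (4 / T)) ^+ n.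
Proof.
move=> t0 tT /(image_dist _ _ n)[h1 h2]; rewrite ger0_norm ?theta_term_ge0//.
have P0 : 0 <= (Num.sqrt (2 * pi * t))^-1 by rewrite invr_ge0 sqrtr_ge0.
rewrite [leRHS](_ : _ = (expR ((2 + `|c| * 4) / T) * expR (- (4 / T)) ^+ n) / Num.sqrt (2 * pi * t)
  + (expR ((2 + `|c| * 4) / T) * expR (- (4 / T)) ^+ n) / Num.sqrt (2 * pi * t)); last by ring.
rewrite /theta_term -(gauss_norm t (x - _)) -(gauss_norm t (x + _)).
apply: lerD; rewrite /gauss mulNr; apply: ler_wpM2r => //; exact: expR_image_le.
Qed.

(** The sum of the geometric majorant: it depends on the time horizon [T] and on the range [2 * c]
    of the space variable, not on [t]. *)
Definition theta_cst T c : R := expR ((2 + `|c| * 4) / T) / (1 - expR (- (4 / T))).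

Lemma theta_cvg t x : 0 < t -> cvgn (series (theta_term t x)).
Proof.
move=> t0; have xc : `|x| <= 2 * (`|x| / 2) by rewrite mulrC divfK.
have h n := theta_term_le t t _ x n t0 (lexx _) xc.
by have [] := geometric_series_bound _ _ _ (geo_ratio t t0) h.
Qed.

Lemma theta_lim t x : 0 < t -> series (theta_term t x) n @[n --> \oo] --> theta t x.
Proof. exact: theta_cvg. Qed.

Lemma theta_ge0 t x : 0 < t -> 0 <= theta t x.
Proof.
move=> t0; apply: limr_ge; first exact: theta_cvg.
by apply: nearW => n; apply: sumr_ge0 => i _; exact: theta_term_ge0.
Qed.

Lemma theta_le t T c x : 0 < t -> t <= T -> `|x| <= 2 * c ->
  theta t x <= 2 / Num.sqrt (2 * pi * t) * theta_cst T c.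
Proof.
move=> t0 tT xc; have T0 : 0 < T by exact: lt_le_trans tT.
have h n := theta_term_le t T c x n t0 tT xc.
have [_] := geometric_series_bound _ _ _ (geo_ratio T T0) h.
by rewrite -[_ / (1 - _)]mulrA; exact/le_trans/ler_norm.
Qed.

Lemma theta_lip t T c x y : 0 < t -> t <= T -> `|x| <= 2 * c -> `|y| <= 2 * c ->
  `|x - y| <= 2 ->
  `|theta t x - theta t y| <=
  `|x - y| * (2 * (2 + 4 * t) / t / Num.sqrt (2 * pi * t) * theta_cst (2 * T) c).
Proof.
move=> t0 tT xc yc xy2; have T0 : 0 < T by exact: lt_le_trans tT.
(* The Lipschitz bound for one Gaussian leaves the exponent [m ^+ 2 / (4 * t)], that of a Gaussian
   at time [2 * t]; hence the horizon [2 * T]. *)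
have TT0 : 0 < 2 * T by rewrite mulr_gt0.
have cx := theta_cvg t x t0; have cy := theta_cvg t y t0.
rewrite /theta -(lim_seriesB cx cy).
set P := Num.sqrt _; have P0 : 0 <= P^-1 by rewrite invr_ge0 sqrtr_ge0.
pose D := (2 + 4 * t) / t / P.
have D0 : 0 <= D by rewrite mulr_ge0// mulr_ge0 ?invr_ge0 ?(ltW t0)//; lra.
pose E := expR ((2 + `|c| * 4) / (2 * T)).
have lip n z w : 2 * n%:R - 2 * c <= `|z| -> 2 * n%:R - 2 * c <= `|w| -> `|z - w| <= 2 ->
  `|gauss t z - gauss t w| <= `|z - w| * (D * (E * expR (- (4 / (2 * T))) ^+ n)).
  move=> hz hw zw; pose m := Num.max 0 (2 * n%:R - 2 * c).
  apply: le_trans (gauss_lip t m z w t0 _ _ _ zw) _.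
  - by rewrite le_max lexx.
  - by rewrite ge_max normr_ge0.
  - by rewrite ge_max normr_ge0.
  rewrite ler_wpM2l// ler_wpM2l//.
  have -> : 4 * t = 2 * (2 * t) by ring.
  apply: expR_image_le; first by rewrite mulr_gt0.
    by rewrite ler_wpM2l.
  by rewrite le_max lexx orbT.
have b n : `|(theta_term t x - theta_term t y) n| <= (2 * `|x - y| * D * E) * expR (- (4 / (2 * T))) ^+ n.
  have [hx1 hx2] := image_dist x c n xc; have [hy1 hy2] := image_dist y c n yc.
  have := lip n _ _ hx1 hy1; have := lip n _ _ hx2 hy2.
  rewrite (_ : x + _ - _ = x - y); last by ring.
  rewrite (_ : x - _ - _ = x - y); last by ring.
  move=> /(_ xy2) l1 /(_ xy2) l2.
  rewrite (_ : (theta_term t x - theta_term t y) n = (gauss t (x - 2 * n%:R) - gauss t (y - 2 * n%:R)) + (gauss t (x + 2 * n.+1%:R) - gauss t (y + 2 * n.+1%:R))); last first.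
    by rewrite /theta_term !fctE/=; ring.
  apply: le_trans (ler_normD _ _) _; apply: le_trans (lerD l2 l1) _.
  by rewrite le_eqVlt; apply/orP; left; apply/eqP; ring.
have [_ h] := geometric_series_bound _ _ _ (geo_ratio _ TT0) b.
apply: le_trans h _; rewrite le_eqVlt; apply/orP; left; apply/eqP.
by rewrite /theta_cst /D /E; ring.
Qed.

Lemma continuous_theta t : 0 < t -> continuous (theta t).
Proof.
move=> t0 x; pose c := (`|x| + 1) / 2.
pose L := 2 * (2 + 4 * t) / t / Num.sqrt (2 * pi * t) * theta_cst (2 * t) c.
have L0 : 0 < `|L| + 1 by rewrite ltr_wpDl.
apply/cvgrPdist_le => e e0; near=> y.
have xy1 : `|x - y| <= 1 by near: y; apply: cvgr_dist_le.
have xy : `|x - y| <= e / (`|L| + 1).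
  by near: y; apply: cvgr_dist_le => //; rewrite divr_gt0.
apply: le_trans (theta_lip t t c x y t0 (lexx _) _ _ _) _.
- by rewrite /c; lra.
- have := ler_normB x (x - y); rewrite (_ : x - (x - y) = y); last by ring.
  by rewrite /c; lra.
- lra.
rewrite -/L; apply: le_trans (ler_norm _) _; rewrite normrM normr_id.
apply: le_trans (ler_wpM2r (normr_ge0 _) xy) _.
rewrite mulrAC ler_pdivrMr// ler_wpM2l ?(ltW e0)//; lra.
Unshelve. all: by end_near. Qed.

Lemma measurable_theta t : 0 < t -> measurable_fun setT (theta t).
Proof. by move=> t0; apply: continuous_measurable_fun; exact: continuous_theta. Qed.

Lemma gauss_cvg0 t (u : R^nat) c : 0 < t -> (forall n, 2 * n%:R - 2 * c <= `|u n|) ->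
  gauss t (u n) @[n --> \oo] --> 0.
Proof.
move=> t0 h; have /andP[q0 q1] := geo_ratio t t0.
pose A := expR ((2 + `|c| * 4) / t) / Num.sqrt (2 * pi * t).
have g0 : geometric A (expR (- (4 / t))) n @[n --> \oo] --> 0.
  by apply: cvg_geometric; rewrite ger0_norm.
apply: squeeze_cvgr g0; last exact: cvg_cst.
apply: nearW => n; rewrite gauss_ge0/= -gauss_norm /gauss mulNr /A [leRHS]mulrAC.
apply: ler_wpM2r; first by rewrite invr_ge0 sqrtr_ge0.
exact: expR_image_le.
Qed.

(** Partial sums are not symmetric, since the image [x - 2n] is paired with [x + 2(n + 1)].
    Replacing [x] by [- x] leaves two boundary Gaussians in the difference of partial sums, and both
    tend to 0. *)
Lemma thetaN t x : 0 < t -> theta t (- x) = theta t x.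
Proof.
move=> t0; have cx := theta_cvg t x t0; have cy := theta_cvg t (- x) t0.
apply/eqP; rewrite -subr_eq0 /theta -(lim_seriesB cy cx); apply/eqP.
apply: cvg_lim => //.
pose a n : R := gauss t (x - 2 * n%:R) - gauss t (x + 2 * n%:R).
have -> : series (theta_term t (- x) - theta_term t x) = a.
  apply/funext => n; rewrite /a /series/= big_mkord; elim: n => [|n IH].
    by rewrite big_ord0 !mulr0 subr0 addr0 subrr.
  rewrite big_ord_recr/= IH !fctE /theta_term.
  have -> : gauss t (- x - 2 * n%:R) = gauss t (x + 2 * n%:R) by rewrite -gaussN; congr gauss; ring.
  have -> : gauss t (- x + 2 * n.+1%:R) = gauss t (x - 2 * n.+1%:R) by rewrite -gaussN; congr gauss; ring.
  by ring.
have xc : `|x| <= 2 * (`|x| / 2 + 1) by rewrite mulrDr [2 * (_ / _)]mulrC divfK// lerDl.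
rewrite -(subrr 0); apply: cvgB.
  apply: (gauss_cvg0 t (fun n => x - 2 * n%:R) (`|x| / 2 + 1)) => // n.
  by have [] := image_dist _ _ n xc.
apply: (gauss_cvg0 t (fun n => x + 2 * n%:R) (`|x| / 2 + 1)) => // n.
have [_ ] := image_dist _ _ n xc; have := ler_normB (x + 2 * n.+1%:R) 2.
rewrite (_ : x + 2 * n.+1%:R - 2 = x + 2 * n%:R); last by rewrite -natr1; ring.
rewrite (ger0_norm (_ : 0 <= 2)) // => h1 _.
have := ler_normB (x + 2 * n%:R) x; rewrite (_ : x + _ - x = 2 * n%:R); last by ring.
by rewrite (ger0_norm (_ : 0 <= 2 * n%:R)) ?mulr_ge0//; lra.
Qed.

(** A shift by 2 moves every image onto its neighbour, so the difference of partial sums telescopes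
    to two boundary terms. *)
Lemma theta_period t x : 0 < t -> theta t (x + 2) = theta t x.
Proof.
move=> t0; have cx := theta_cvg t x t0; have cy := theta_cvg t (x + 2) t0.
apply/eqP; rewrite -subr_eq0 /theta -(lim_seriesB cy cx); apply/eqP.
apply: cvg_lim => //.
pose a n : R := gauss t (x + 2 * n.+1%:R) - gauss t (x + 2 - 2 * n%:R).
have -> : series (theta_term t (x + 2) - theta_term t x) = a.
  apply/funext => n; rewrite /a /series/= big_mkord; elim: n => [|n IH].
    by rewrite big_ord0 mulr0 mulr1 subr0 subrr.
  rewrite big_ord_recr/= IH !fctE /theta_term.
  have -> : x + 2 - 2 * n.+1%:R = x - 2 * n%:R by rewrite -natr1; ring.
  have -> : x + 2 + 2 * n.+1%:R = x + 2 * n.+2%:R by rewrite -(natr1 n.+1); ring.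
  by ring.
have xc : `|x| <= 2 * (`|x| / 2) by rewrite mulrC divfK.
have xc2 : `|x + 2| <= 2 * ((`|x| + 2) / 2).
  by rewrite [leRHS]mulrC divfK//; apply: le_trans (ler_normD _ _) _; rewrite (ger0_norm (_ : 0 <= 2)).
rewrite -(subrr 0); apply: cvgB.
  by apply: (gauss_cvg0 t (fun n => x + 2 * n.+1%:R) (`|x| / 2)) => // n; have [] := image_dist _ _ n xc.
by apply: (gauss_cvg0 t (fun n => x + 2 - 2 * n%:R) ((`|x| + 2) / 2)) => // n; have [] := image_dist _ _ n xc2.
Qed.

Lemma theta_refl t x : 0 < t -> theta t (2 - x) = theta t x.
Proof. by move=> t0; rewrite addrC theta_period// thetaN. Qed.

Lemma theta_image t x n : 0 < t -> theta t (x + 2 * n%:R) = theta t x.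
Proof.
move=> t0; elim: n => [|n IH]; first by rewrite mulr0 addr0.
by rewrite -(natr1 n) mulrDr mulr1 addrA theta_period.
Qed.

Lemma Gneum_theta t r r' : 0 < t -> Gneum t r r' = theta t (r - r') + theta t (r + r').
Proof.
move=> t0; have cx := theta_cvg t (r - r') t0; have cy := theta_cvg t (r + r') t0.
rewrite /theta -(lim_seriesD cx cy) /Gneum; congr (limn (series _)); apply/funext => n.
by rewrite !fctE /theta_term; ring.
Qed.

Lemma gauss_le_theta t x : 0 < t -> gauss t x <= theta t x.
Proof.
move=> t0; have h := @nondecreasing_cvgn_le _ (series (theta_term t x)) _ (theta_cvg _ _ t0) 1%N.
apply: le_trans (h _); last first.
  by apply: nondecreasing_series => n _ _; exact: theta_term_ge0.
by rewrite /series/= big_nat1 /theta_term mulr0 subr0 lerDl gauss_ge0.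
Qed.

Lemma sqrt_2pi_ge t : 0 < t -> t <= 1 -> t <= Num.sqrt (2 * pi * t).
Proof.
move=> t0 t1; rewrite -[leLHS]ger0_norm ?(ltW t0)// -sqrtr_sqr ler_wsqrtr// expr2 ler_wpM2r ?(ltW t0)//.
by have := pi_ge2 R; lra.
Qed.

(** The cube bound gives [expR (- e ^+ 2 / (2 * t)) <= (6 * t / e ^+ 2) ^+ 3], whence
    [216 = 6 ^+ 3]; one factor [t] is absorbed by [t <= sqrt (2 * pi * t)]. *)
Lemma gauss_small t e : 0 < t -> t <= 1 -> 0 < e -> gauss t e <= 216 / e ^+ 6 * t ^+ 2.
Proof.
move=> t0 t1 e0; have tP := sqrt_2pi_ge t t0 t1.
have P0 : 0 < Num.sqrt (2 * pi * t) by exact: lt_le_trans tP.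
rewrite /gauss ler_pdivrMr//; apply: (@le_trans _ _ (216 / e ^+ 6 * t ^+ 2 * t)); last first.
  have c0 : 0 <= 216 / e ^+ 6 * t ^+ 2.
    by apply: mulr_ge0 (sqr_ge0 t); apply: divr_ge0 => //; apply: exprn_ge0; exact: ltW.
  exact: ler_wpM2l c0 _ _ tP.
have -> : 216 / e ^+ 6 * t ^+ 2 * t = ((e ^+ 2 / (2 * t) / 3) ^+ 3)^-1.
  by field; rewrite !gt_eqF.
rewrite mulNr expRN lef_pV2 ?posrE ?expR_gt0 ?exprn_gt0 ?divr_gt0 ?mulr_gt0 ?exprn_gt0//.
by apply: expR_cube_ge; rewrite divr_ge0 ?sqr_ge0// mulr_ge0// ltW.
Qed.

(** For [|x| <= 1] every image but the central one is at distance at least 1. Together they amount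
    to a multiple of [expR (- 1 / (4 * t))] over the prefactor, and the cube bound leaves [t ^+ 2].
    An order above 1 is essential later, where time is doubled repeatedly. *)
Lemma theta_tail : exists2 C : R, 0 <= C & forall t x, 0 < t -> t <= 1 -> `|x| <= 1 ->
  theta t x <= gauss t x + C * t ^+ 2.
Proof.
(* An image with [w ^+ 2 >= (n + 1) / 2] has weight at most [expR (- (n + 1) / (4 * t))]. For
   [t <= 1] the part [n / (4 * t)] of the exponent is at least [n / 4], which gives the ratio
   [q]. *)
pose q : R := expR (- 4^-1); have q0 : 0 <= q by exact: expR_ge0.
have q1 : q < 1 by rewrite expR_lt1 oppr_lt0 invr_gt0.
have q10 : 0 < 1 - q by rewrite subr_gt0.
exists (2 * 12 ^+ 3 / (1 - q)); first by rewrite divr_ge0 ?(ltW q10) ?mulr_ge0.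
move=> t x t0 t1 x1; set P := Num.sqrt (2 * pi * t).
have tP : t <= P by exact: sqrt_2pi_ge.
have P0 : 0 < P by exact: lt_le_trans tP.
pose A := 2 * expR (- (4 * t)^-1) / P.
have A0 : 0 <= A by rewrite !mulr_ge0 ?expR_ge0 ?invr_ge0 ?(ltW P0).
have G w (n : nat) : n.+1%:R / 2 <= w ^+ 2 -> gauss t w <= A / 2 * q ^+ n.
  move=> h; rewrite /gauss -/P (_ : A / 2 * q ^+ n = expR (- (4 * t)^-1) * q ^+ n / P); last first.
    by rewrite /A; field; rewrite gt_eqF.
  rewrite ler_wpM2r ?invr_ge0 ?(ltW P0)// -expRM_natl -expRD ler_expR mulNr.
  have t4 : 0 < (4 * t)^-1 by rewrite invr_gt0 mulr_gt0.
  have h1 : n.+1%:R * (4 * t)^-1 <= w ^+ 2 / (2 * t).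
    rewrite (_ : n.+1%:R * _ = n.+1%:R / 2 / (2 * t)); last by field; rewrite gt_eqF.
    by rewrite ler_wpM2r// invr_ge0 mulr_ge0 ?(ltW t0).
  have h2 : n%:R * 4^-1 <= n%:R * (4 * t)^-1.
    by rewrite ler_wpM2l// lef_pV2 ?posrE ?mulr_gt0// ler_piMr.
  by move: h1; rewrite -natr1 mulrDl mul1r; lra.
have x1' : -1 <= x <= 1 by rewrite -ler_norml.
have T n : theta_term t x n <= (if n is 0%N then gauss t x else 0) + A * q ^+ n.
  have hr : gauss t (x + 2 * n.+1%:R) <= A / 2 * q ^+ n.
    by apply: G; rewrite -natr1; have : 0 <= n%:R :> R by []; nra.
  case: n hr => [|n] hr.
    by rewrite /theta_term mulr0 subr0 lerD2l; apply: le_trans hr _; rewrite expr0 !mulr1; lra.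
  have hl : gauss t (x - 2 * n.+1%:R) <= A / 2 * q ^+ n.+1.
    by apply: G; rewrite -(natr1 n.+1) -natr1; have : 0 <= n%:R :> R by []; nra.
  by rewrite add0r /theta_term; lra.
have S n : series (theta_term t x) n <= gauss t x + A * (1 - q ^+ n) / (1 - q).
  rewrite /series/= big_mkord; elim: n => [|n IH].
    by rewrite big_ord0 expr0 subrr mulr0 mul0r addr0 gauss_ge0.
  case: n IH => [_|n IH].
    rewrite big_ord_recr big_ord0/= add0r; apply: le_trans (T 0%N) _.
    by rewrite expr0 expr1 mulr1 mulfK ?gt_eqF.
  rewrite big_ord_recr/=; apply: le_trans (lerD IH (T n.+1)) _.
  rewrite add0r -addrA lerD2l le_eqVlt; apply/orP; left; apply/eqP.
  by rewrite [q ^+ n.+2]exprS; field; rewrite gt_eqF.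
have h : theta t x <= gauss t x + A / (1 - q).
  apply: limr_le; first exact: theta_cvg.
  apply: nearW => n; apply: le_trans (S n) _; rewrite lerD2l ler_wpM2r ?invr_ge0 ?(ltW q10)//.
  by rewrite ler_piMr// lerBlDr lerDl exprn_ge0.
apply: le_trans h _; rewrite lerD2l [leRHS]mulrAC ler_wpM2r ?invr_ge0 ?(ltW q10)//.
rewrite /A -[leLHS]mulrA -[leRHS]mulrA ler_wpM2l// ler_pdivrMr//.
have e3 : expR (- (4 * t)^-1) <= 12 ^+ 3 * t ^+ 3.
  rewrite expRN -[leRHS]invrK lef_pV2 ?posrE ?expR_gt0 ?invr_gt0 ?mulr_gt0 ?exprn_gt0//.
  have := expR_cube_ge (4 * t)^-1; rewrite (_ : (_ / 3) ^+ 3 = (12 ^+ 3 * t ^+ 3)^-1).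
    by apply; rewrite invr_ge0 mulr_ge0 ?(ltW t0).
  by field; rewrite gt_eqF.
apply: le_trans e3 _; rewrite -[leRHS]mulrA ler_wpM2l ?exprn_ge0//.
by rewrite exprSr ler_wpM2l ?sqr_ge0.
Qed.

End Theta.

Global Opaque theta gauss Gneum.

(** * Translations and reflections in Lebesgue integrals *)

Section AffineSubstitution.
Context {R : realType}.
Local Notation mu := (@lebesgue_measure R).
Implicit Types (a b c s t x y z l : R) (D : set R).

(** Lebesgue measure is determined by its values on half-open intervals, and a translation only
    moves their endpoints. The map is packed as a measurable function so that its pushforward is a
    measure. *)
Lemma lebesgue_measure_addr a D : measurable D ->
  pushforward mu (fun x : measurableTypeR R => (x + a : measurableTypeR R)) D = mu D.
Proof.
move=> mD; have mphi : measurable_fun setT (fun x : measurableTypeR R => (x + a : measurableTypeR R)).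
  exact: measurable_funD.
pose phi : {mfun measurableTypeR R >-> measurableTypeR R} := HB.pack
  (fun x : measurableTypeR R => (x + a : measurableTypeR R)) (isMeasurableFun.Build _ _ _ _ _ mphi).
apply/esym; apply: (@lebesgue_measure_unique R (pushforward mu phi)) => // _ [[b c]] _ <-.
transitivity (mu `](b - a), (c - a)]%classic).
  by rewrite !lebesgue_measure_itv/= !lte_fin ltrD2r; case: ifP => // _; rewrite -!EFinB; congr EFin; ring.
by congr mu; apply/seteqP; split => x /=; rewrite !in_itv/= ltrBlDr lerBrDr.
Qed.

Lemma ge0_integral_addr (f : R -> \bar R) D a : measurable D ->
  measurable_fun setT f -> (forall x, (0 <= f x)%E) ->
  (\int[mu]_(x in D) f x = \int[mu]_(x in [set x | D (x + a)%R]) f (x + a)%R)%E.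
Proof.
move=> mD mf f0.
have mphi : measurable_fun setT (fun x : measurableTypeR R => (x + a : measurableTypeR R)).
  exact: measurable_funD.
rewrite -(@ge0_integral_pushforward _ _ _ _ _ _ mphi mu D f)//; last exact: measurable_funTS.
by apply: eq_measure_integral => //= A mA _; exact/esym/lebesgue_measure_addr.
Qed.

Lemma ge0_integral_oppr (f : R -> \bar R) D : measurable D ->
  measurable_fun setT f -> (forall x, (0 <= f x)%E) ->
  (\int[mu]_(x in D) f x = \int[mu]_(x in [set x | D (- x)%R]) f (- x)%R)%E.
Proof.
move=> mD mf f0.
rewrite -(@ge0_integral_pushforward _ _ _ _ _ (-%R : measurableTypeR R -> measurableTypeR R) _ mu D f)//.
  by apply: eq_measure_integral => //= A mA _; exact/esym/lebesgue_measureN.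
exact: measurable_funTS.
Qed.

Lemma ge0_integral_subl (f : R -> \bar R) D a : measurable D ->
  measurable_fun setT f -> (forall x, (0 <= f x)%E) ->
  (\int[mu]_(x in D) f x = \int[mu]_(x in [set x | D (a - x)%R]) f (a - x)%R)%E.
Proof.
move=> mD mf f0; rewrite (ge0_integral_addr _ _ a)//.
rewrite ge0_integral_oppr//=.
- by under [LHS]eq_integral do rewrite addrC; congr integral; apply/seteqP; split => x /=; rewrite addrC.
- rewrite -[X in measurable X]setTI.
  have : measurable_fun setT (fun x : measurableTypeR R => (x + a : measurableTypeR R)) by exact: measurable_funD.
  exact.
- by apply: measurableT_comp => //; exact: measurable_funD.
Qed.

Lemma ge0_integral_itv_addr (f : R -> \bar R) a b c :
  measurable_fun setT f -> (forall x, (0 <= f x)%E) ->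
  (\int[mu]_(x in `[a, b]) f x = \int[mu]_(x in `[(a - c)%R, (b - c)%R]) f (x + c)%R)%E.
Proof.
move=> mf f0; rewrite (ge0_integral_addr _ _ c)//.
by congr integral; apply/seteqP; split => x /=; rewrite !in_itv/= lerBlDr lerBrDr.
Qed.

Lemma ge0_integral_itv_subl (f : R -> \bar R) a b c :
  measurable_fun setT f -> (forall x, (0 <= f x)%E) ->
  (\int[mu]_(x in `[a, b]) f x = \int[mu]_(x in `[(c - b)%R, (c - a)%R]) f (c - x)%R)%E.
Proof.
move=> mf f0; rewrite (ge0_integral_subl _ _ c)//.
by congr integral; apply/seteqP; split => x /=; rewrite !in_itv/= lerBrDr lerBlDr andbC => /andP[h1 h2]; lra.
Qed.

Lemma ge0_integral_itv_split (f : R -> \bar R) a b c : a <= b -> b <= c ->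
  measurable_fun setT f -> (forall x, (0 <= f x)%E) ->
  (\int[mu]_(x in `[a, c[) f x = \int[mu]_(x in `[a, b[) f x + \int[mu]_(x in `[b, c[) f x)%E.
Proof.
move=> ab bc mf f0; rewrite -ge0_integral_setU//=.
- by rewrite -itv_bndbnd_setU ?bnd_simp.
- exact: measurable_funTS.
- rewrite disj_set2E; apply/eqP; rewrite -subset0 => x [] /=.
  by rewrite !in_itv/= => /andP[_ h1] /andP[h2 _]; lra.
Qed.

(** * Unfolding integrals over the line onto [0,1] *)

Lemma ge0_integralD4 (f1 f2 f3 f4 : R -> R) D : measurable D ->
  measurable_fun setT f1 -> measurable_fun setT f2 ->
  measurable_fun setT f3 -> measurable_fun setT f4 ->
  (forall x, 0 <= f1 x) -> (forall x, 0 <= f2 x) ->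
  (forall x, 0 <= f3 x) -> (forall x, 0 <= f4 x) ->
  (\int[mu]_(x in D) (f1 x + f2 x + f3 x + f4 x)%:E =
   \int[mu]_(x in D) (f1 x)%:E + \int[mu]_(x in D) (f2 x)%:E +
   \int[mu]_(x in D) (f3 x)%:E + \int[mu]_(x in D) (f4 x)%:E)%E.
Proof.
move=> mD m1 m2 m3 m4 p1 p2 p3 p4.
have M (g : R -> R) : measurable_fun setT g -> measurable_fun D (fun x => (g x)%:E).
  by move=> mg; apply/measurable_EFinP; exact: measurable_funTS.
under eq_integral do rewrite EFinD.
rewrite ge0_integralD//=; [|by move=> x _; rewrite lee_fin !addr_ge0
  |by apply: M; do 2 apply: measurable_funD => //|by move=> x _; rewrite lee_fin|exact: M].
congr (_ + _)%E; under eq_integral do rewrite EFinD.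
rewrite ge0_integralD//=; [|by move=> x _; rewrite lee_fin !addr_ge0
  |by apply: M; apply: measurable_funD => //|by move=> x _; rewrite lee_fin|exact: M].
congr (_ + _)%E; under eq_integral do rewrite EFinD.
by rewrite ge0_integralD//=; [move=> x _; rewrite lee_fin|exact: M|move=> x _; rewrite lee_fin|exact: M].
Qed.

(** The values of [f] at four points lying over [z], in the unit intervals that start at [2n],
    [2n - 1], [-2n - 2] and [-2n - 3]. Over all [n] these intervals tile the line. *)
Definition unfold_term (f : R -> R) (n : nat) (z : R) : R :=
  f (z + 2 * n%:R) + f (2 * n%:R - z) + f (z - 2 * n.+1%:R) + f (- z - 2 * n.+1%:R).

Lemma measurable_unfold_term (f : R -> R) n : measurable_fun setT f ->
  measurable_fun setT (unfold_term f n).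
Proof.
move=> mf; rewrite /unfold_term.
have ma c : measurable_fun setT (fun z : R => f (z + c)).
  by apply: measurableT_comp => //; exact: measurable_funD.
have ms c : measurable_fun setT (fun z : R => f (c - z)).
  by apply: measurableT_comp => //; exact: measurable_funB.
have ms' c : measurable_fun setT (fun z : R => f (- z - c)).
  by under eq_fun do rewrite addrC; exact: ms.
by do 3 (apply: measurable_funD => //).
Qed.

(* [0,1] is a fundamental domain of the reflections in the integers. *)
Lemma ge0_integral_unfold (f : R -> R) : measurable_fun setT f -> (forall x, 0 <= f x) ->
  (\int[mu]_x (f x)%:E = \int[mu]_(z in `[0%R, 1%R]) \sum_(n <oo) (unfold_term f n z)%:E)%E.
Proof.
move=> mf f0.
have mEf : measurable_fun setT (EFin \o f) by exact/measurable_EFinP.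
have f0E x : (0 <= (EFin \o f) x)%E by rewrite lee_fin.
have ma c : measurable_fun setT (fun z : R => f (z + c)).
  by apply: measurableT_comp => //; exact: measurable_funD.
have ms c : measurable_fun setT (fun z : R => f (c - z)).
  by apply: measurableT_comp => //; exact: measurable_funB.
have ms' c : measurable_fun setT (fun z : R => f (- z - c)).
  by under eq_fun do rewrite addrC; exact: ms.
(* The union of the first [N] blocks of four unit intervals: empty for [N = 0], and longer by 2 on
   each side at every step. *)
pose F N : set R := `[- (2 * N%:R + 1), 2 * N%:R - 1[%classic.
have step N : (\int[mu]_(x in F N) (f x)%:E =
    \sum_(0 <= n < N) \int[mu]_(z in `[0%R, 1%R]) (unfold_term f n z)%:E)%E.
  elim: N => [|N IH].
    rewrite big_nil /F mulr0 add0r sub0r.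
    have -> : `[-1, -1[%classic = set0 :> set R by apply/seteqP; split => x //=; rewrite in_itv/=; lra.
    by rewrite integral_set0.
  have N0 : 0 <= N%:R :> R by [].
  rewrite big_nat_recr//= -IH /F -(natr1 N).
  pose J a b : \bar R := (\int[mu]_(x in `[a, b[) (f x)%:E)%E.
  have split a b c : a <= b -> b <= c -> (J a c = J a b + J b c)%E.
    by move=> ab bc; exact: (ge0_integral_itv_split (EFin \o f)).
  have one b c : J b c = (\int[mu]_(x in `[b, c]) (f x)%:E)%E.
    by rewrite /J integral_itv_bndo_bndc//; exact: measurable_funTS.
  have oneA b c : c = b + 1 -> J b c = (\int[mu]_(x in `[0%R, 1%R]) (f (x + b))%:E)%E.
    by move=> ->; rewrite one (ge0_integral_itv_addr (EFin \o f) _ _ b)//= subrr addrAC subrr add0r.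
  have oneS b c : c = b + 1 -> J b c = (\int[mu]_(x in `[0%R, 1%R]) (f (c - x))%:E)%E.
    by move=> ->; rewrite one (ge0_integral_itv_subl (EFin \o f) _ _ (b + 1))//= subrr addrAC subrr add0r.
  rewrite -/(J _ _) -/(J _ _).
  rewrite (split _ (- (2 * (N%:R + 1))) _); [|lra|lra].
  rewrite (split (- (2 * (N%:R + 1))) (- (2 * N%:R + 1)) _); [|lra|lra].
  rewrite (split (- (2 * N%:R + 1)) (2 * N%:R - 1) _); [|lra|lra].
  rewrite (split (2 * N%:R - 1) (2 * N%:R) _); [|lra|lra].
  rewrite (oneS _ (- (2 * (N%:R + 1)))); last by ring.
  rewrite (oneA (- (2 * (N%:R + 1)))); last by ring.
  rewrite (oneS _ (2 * N%:R)); last by ring.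
  rewrite (oneA (2 * N%:R)); last by ring.
  rewrite -[RHS]/(J (- (2 * N%:R + 1))%R (2 * N%:R - 1)%R + \int[mu]_(z in `[0%R, 1%R]) (unfold_term f N z)%:E)%E.
  rewrite ge0_integralD4//.
  rewrite natr1.
  have -> : (fun x : R => (f (- (2 * N.+1%:R) - x))%:E) = fun x : R => (f (- x - 2 * N.+1%:R))%:E.
    by apply/funext => x; congr (f _)%:E; ring.
  have AC (a b c d j : \bar R) : (a + (b + (j + (c + d))) = j + (d + c + b + a))%E.
    by rewrite (addeCA b) (addeCA a) (addeC c) (addeC b) (addeC a).
  exact: AC.
have cv : (\int[mu]_(x in F N) (f x)%:E @[N --> \oo] --> \int[mu]_(x in \bigcup_N F N) (f x)%:E)%E.
  apply: ge0_nondecreasing_set_cvg_integral => //.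
  - apply/nondecreasing_seqP => n; rewrite subsetEset => x; rewrite /F /= !in_itv/= -(natr1 n) => /andP[h1 h2].
    by apply/andP; split; lra.
  - by move=> N; exact: measurable_itv.
  - by move=> N; exact: measurable_funTS.
  - by move=> N x _; rewrite lee_fin.
have FT : \bigcup_N F N = setT.
  apply/seteqP; split => // x _.
  have xN := archi_boundP (normr_ge0 x); set N := Num.bound _ in xN.
  have : - `|x| <= x <= `|x| by rewrite -ler_norml.
  move=> /andP[h1 h2]; exists N.+1 => //; rewrite /F/= in_itv/= -(natr1 N).
  by have := normr_ge0 x; move=> h3; apply/andP; split; lra.
rewrite FT in cv; rewrite -(cvg_lim _ cv)//.
under eq_fun do rewrite step.
rewrite integral_nneseries//= => n.
  apply/measurable_EFinP; apply: measurable_funTS; rewrite /unfold_term.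
  exact: measurable_unfold_term.
by move=> x _; rewrite lee_fin /unfold_term !addr_ge0.
Qed.

(** * Mass and Chapman-Kolmogorov identities for the circle kernel *)

Local Notation I := (`[0%R, 1%R]%classic : set R).

Lemma nneseries_EFin (u : R^nat) l : (forall n, 0 <= u n) -> series u n @[n --> \oo] --> l ->
  (\sum_(n <oo) (u n)%:E = l%:E)%E.
Proof.
move=> u0 ul; apply/cvg_lim => //.
under eq_fun do rewrite sumEFin.
by apply: cvg_EFin; [exact: nearW|exact: ul].
Qed.

Lemma nneseries_theta t x : 0 < t ->
  (\sum_(n <oo) (theta_term t x n)%:E = (theta t x)%:E)%E.
Proof.
by move=> t0; apply: nneseries_EFin; [move=> n; exact: theta_term_ge0 | exact: theta_lim].
Qed.

Lemma unfold_term_gauss t x (h : R -> R) z n :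
  (forall y m, h (y + 2 * m%:R) = h y) -> (forall y m, h (y - 2 * m%:R) = h y) ->
  unfold_term (fun w => gauss t (x - w) * h w) n z =
  theta_term t (x - z) n * h z + theta_term t (x + z) n * h (- z).
Proof.
move=> hp hm; rewrite /unfold_term hp !hm [2 * _ - z]addrC hp /theta_term.
rewrite (_ : x - (z + 2 * n%:R) = x - z - 2 * n%:R); last by ring.
rewrite (_ : x - (- z + 2 * n%:R) = x + z - 2 * n%:R); last by ring.
rewrite (_ : x - (z - 2 * n.+1%:R) = x - z + 2 * n.+1%:R); last by ring.
rewrite (_ : x - (- z - 2 * n.+1%:R) = x + z + 2 * n.+1%:R); last by ring.
by ring.
Qed.

(** Unfolding collects the images of the Gaussian into [theta], while the 2-periodic [h] sees only
    the fold: half of each block lands on [h z], the other half on [h (- z)]. *)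
Lemma integral_gauss_periodic t x (h : R -> R) : 0 < t -> measurable_fun setT h ->
  (forall y, 0 <= h y) -> (forall y m, h (y + 2 * m%:R) = h y) ->
  (forall y m, h (y - 2 * m%:R) = h y) ->
  (\int[mu]_w (gauss t (x - w) * h w)%:E =
   \int[mu]_(z in I) (theta t (x - z) * h z + theta t (x + z) * h (- z))%:E)%E.
Proof.
move=> t0 mh h0 hp hm; rewrite ge0_integral_unfold.
- apply: eq_integral => z _; under eq_eseriesr do rewrite unfold_term_gauss//.
  apply: nneseries_EFin.
    by move=> n; rewrite addr_ge0 ?mulr_ge0 ?theta_term_ge0.
  rewrite (_ : series _ = fun n => series (theta_term t (x - z)) n * h z + series (theta_term t (x + z)) n * h (- z)).
    by apply: cvgD; apply: cvgMl; exact: theta_lim.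
  by apply/funext => n; rewrite /series/= big_split/= -!mulr_suml.
- apply: measurable_funM => //; apply: measurableT_comp; first exact: measurable_gauss.
  exact: measurable_funB.
- by move=> w; rewrite mulr_ge0 ?gauss_ge0.
Qed.

Lemma theta_imageN t x n : 0 < t -> theta t (x - 2 * n%:R) = theta t x.
Proof. by move=> t0; rewrite -(theta_image t (x - _) n t0) subrK. Qed.

Lemma integral_theta t x : 0 < t ->
  (\int[mu]_(z in I) (theta t (x - z) + theta t (x + z))%:E = 1)%E.
Proof.
move=> t0; transitivity (\int[mu]_w (gauss t (x - w) * 1)%:E)%E.
  rewrite (integral_gauss_periodic t x (fun=> 1) t0)//.
  by apply: eq_integral => z _; rewrite !mulr1.
by under eq_integral do rewrite mulr1 -gaussN opprB; exact: integral_gauss.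
Qed.

(** Convolution on the circle: the two products are the contributions of [z] and [- z], together a
    full period. The integral is folded back to [gauss s] against [theta t] over the line; then
    [theta t] is expanded and the Gaussian semigroup law applied image by image. *)
Lemma integral_theta_theta s t x y : 0 < s -> 0 < t ->
  (\int[mu]_(z in I) (theta s (x - z) * theta t (z - y) + theta s (x + z) * theta t (z + y))%:E
   = (theta (s + t) (x - y))%:E)%E.
Proof.
move=> s0 t0; have st0 : 0 < s + t by exact: addr_gt0.
have mth c : measurable_fun setT (fun w : R => theta t (w - c)).
  by apply: measurableT_comp; [exact: measurable_theta|exact: measurable_funB].
transitivity (\int[mu]_w (gauss s (x - w) * theta t (w - y))%:E)%E.
  have p1 z m : theta t (z + 2 * m%:R - y) = theta t (z - y) by rewrite addrAC theta_image.
  have p2 z m : theta t (z - 2 * m%:R - y) = theta t (z - y) by rewrite addrAC theta_imageN.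
  rewrite (integral_gauss_periodic s x (fun w => theta t (w - y)) s0 (mth y) (fun z => theta_ge0 t _ t0) p1 p2).
  by apply: eq_integral => z _; rewrite -opprD thetaN.
transitivity (\int[mu]_w \sum_(n <oo) (gauss s (x - w) * theta_term t (w - y) n)%:E)%E.
  apply: eq_integral => w _; rewrite EFinM -nneseries_theta// -nneseriesZl//=.
  by move=> *; rewrite lee_fin theta_term_ge0.
rewrite integral_nneseries//=.
- transitivity (\sum_(n <oo) (theta_term (s + t) (x - y) n)%:E)%E; last exact: nneseries_theta.
  apply: eq_eseriesr => n _; rewrite /theta_term.
  under eq_integral do rewrite mulrDr EFinD.
  have mg c : measurable_fun setT (fun w : R => (gauss s (x - w) * gauss t (w - c))%:E).
    apply/measurable_EFinP; apply: measurable_funM; (apply: measurableT_comp; first exact: measurable_gauss); exact: measurable_funB.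
  have e1 w : gauss t (w - y - 2 * n%:R) = gauss t (w - (y + 2 * n%:R)) by congr gauss; ring.
  have e2 w : gauss t (w - y + 2 * n.+1%:R) = gauss t (w - (y - 2 * n.+1%:R)) by congr gauss; ring.
  under eq_integral do rewrite e1 e2.
  rewrite ge0_integralD//=; [|by move=> w _; rewrite lee_fin mulr_ge0 ?gauss_ge0|exact: mg
    |by move=> w _; rewrite lee_fin mulr_ge0 ?gauss_ge0|exact: mg].
  rewrite !integral_gauss_mul// -EFinD; congr (_ + _)%:E; congr gauss; ring.
- move=> n; apply/measurable_EFinP; apply: measurable_funM.
    by apply: measurableT_comp; [exact: measurable_gauss|exact: measurable_funB].
  apply: measurable_funD; (apply: measurableT_comp; first exact: measurable_gauss).
    by apply: measurable_funB => //; exact: measurable_funB.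
  by apply: measurable_funD => //; exact: measurable_funB.
- by move=> n w _; rewrite lee_fin mulr_ge0 ?gauss_ge0 ?theta_term_ge0.
Qed.

End AffineSubstitution.

(** * Bounded measurable functions on [0,1] *)

Section UnitInterval.
Context {R : realType}.
Local Notation mu := (@lebesgue_measure R).
Local Notation I := (@I01 R).
Implicit Types (f g h : R -> R) (a c r x M : R).

(** A class closed under the ring operations and free of sign conditions, since differences of
    densities and of kernels get integrated. As [0,1] has mass 1, its members are integrable and a
    pointwise bound is a bound on the integral. *)
Definition bmeas f := measurable_fun I f /\ exists M, forall x, x \in `[0, 1] -> `|f x| <= M.

Lemma measurable_I01 : measurable I. Proof. exact: measurable_itv. Qed.
Hint Resolve measurable_I01 : core.

Lemma mu_I01 : mu I = 1%E.
Proof. by rewrite lebesgue_measure_itv/= lte_fin ltr01 oppr0 adde0. Qed.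

Lemma bmeas_integrable f : bmeas f -> mu.-integrable I (EFin \o f).
Proof.
move=> [mf [M fM]]; apply: measurable_bounded_integrable => //.
  by rewrite -[X in (X < _)%E]/(mu I) mu_I01 ltry.
exists M; split; first exact: num_real.
by move=> B MB x /= Ix; apply: le_trans (ltW MB); exact: fM.
Qed.

Lemma bmeas_cst c : bmeas (fun=> c).
Proof. by split; [exact: measurable_cst|exists `|c|]. Qed.

Lemma bmeas_ext f g : (forall x, x \in `[0, 1] -> f x = g x) -> bmeas f -> bmeas g.
Proof.
move=> fg [mf [M fM]]; split.
  by apply: eq_measurable_fun mf => x; rewrite inE => /fg.
by exists M => x xI; rewrite -fg//; exact: fM.
Qed.

Lemma bmeasD f g : bmeas f -> bmeas g -> bmeas (fun x => f x + g x).
Proof.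
move=> [mf [M fM]] [mg [N gN]]; split; first exact: measurable_funD.
by exists (M + N) => x xI; apply: le_trans (ler_normD _ _) _; apply: lerD; [exact: fM|exact: gN].
Qed.

Lemma bmeasN f : bmeas f -> bmeas (fun x => - f x).
Proof.
move=> [mf [M fM]]; split; first exact: measurableT_comp.
by exists M => x xI; rewrite normrN fM.
Qed.

Lemma bmeasB f g : bmeas f -> bmeas g -> bmeas (fun x => f x - g x).
Proof. by move=> bf bg; apply: bmeasD => //; exact: bmeasN. Qed.

Lemma bmeasM f g : bmeas f -> bmeas g -> bmeas (fun x => f x * g x).
Proof.
move=> [mf [M fM]] [mg [N gN]]; split; first exact: measurable_funM.
by exists (M * N) => x xI; rewrite normrM ler_pM ?fM ?gN.
Qed.

Lemma bmeasZ c f : bmeas f -> bmeas (fun x => c * f x).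
Proof. by move=> bf; apply: bmeasM => //; exact: bmeas_cst. Qed.

Lemma bmeas_norm f : bmeas f -> bmeas (fun x => `|f x|).
Proof.
move=> [mf [M fM]]; split; first exact: measurableT_comp.
by exists M => x xI; rewrite normr_id fM.
Qed.

Lemma bmeas_within_continuous f : {within I, continuous f} -> bmeas f.
Proof.
move=> cf; split; first exact: subspace_continuous_measurable_fun.
have cI : compact I by exact: segment_compact.
have [M [_ hM]] := compact_bounded (continuous_compact cf cI).
exists (M + 1) => x xI; apply: (hM (M + 1)); first by rewrite ltrDl.
by exists x.
Qed.

Lemma bmeas_continuous f : continuous f -> bmeas f.
Proof. by move=> cf; apply: bmeas_within_continuous; exact: continuous_subspaceT. Qed.

(** Real-valued, so that a tail is the integral of an ordinary test function. At [x = 0] it equals 1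
    exactly when [r <= 0], which is how the atom at 0 is counted. *)
Definition tail_ind r x : R := (r <= x)%R%:R.

Lemma tail_ind_ge0 r x : 0 <= tail_ind r x. Proof. by rewrite /tail_ind ler0n. Qed.

Lemma tail_ind_le1 r x : tail_ind r x <= 1.
Proof. by rewrite /tail_ind; case: (r <= x). Qed.

Lemma bmeas_indic (A : set R) : measurable A -> bmeas (\1_A).
Proof.
move=> mA; split; first exact: measurable_indic.
by exists 1 => x _; rewrite indicE; case: (x \in A); rewrite ?normr1 ?normr0.
Qed.

Lemma tail_indE r : tail_ind r = \1_(`[r, +oo[%classic).
Proof.
by apply/funext => x; rewrite /tail_ind indicE mem_setE in_itv/= andbT.
Qed.

Lemma bmeas_tail r : bmeas (tail_ind r).
Proof. by rewrite tail_indE; apply: bmeas_indic; exact: measurable_itv. Qed.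

Lemma Lint_ext f g : (forall x, x \in `[0, 1] -> f x = g x) -> Lint I f = Lint I g.
Proof. by move=> fg; apply: eq_Rintegral => x; rewrite inE => /fg. Qed.

Lemma LintD f g : bmeas f -> bmeas g -> Lint I (fun x => f x + g x) = Lint I f + Lint I g.
Proof. by move=> bf bg; rewrite /Lint RintegralD//; exact: bmeas_integrable. Qed.

Lemma LintB f g : bmeas f -> bmeas g -> Lint I (fun x => f x - g x) = Lint I f - Lint I g.
Proof. by move=> bf bg; rewrite /Lint RintegralB//; exact: bmeas_integrable. Qed.

Lemma LintZ c f : bmeas f -> Lint I (fun x => c * f x) = c * Lint I f.
Proof. by move=> bf; rewrite /Lint RintegralZl//; exact: bmeas_integrable. Qed.

Lemma LintZr c f : bmeas f -> Lint I (fun x => f x * c) = Lint I f * c.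
Proof. by move=> bf; rewrite /Lint RintegralZr//; exact: bmeas_integrable. Qed.

Lemma Lint_cst c : Lint I (fun=> c) = c.
Proof. by rewrite /Lint Rintegral_cst// -[X in fine X]/(mu I) mu_I01 mulr1. Qed.

Lemma Lint_le f g : bmeas f -> bmeas g -> (forall x, x \in `[0, 1] -> f x <= g x) ->
  Lint I f <= Lint I g.
Proof. by move=> bf bg fg; apply: le_Rintegral => //; exact: bmeas_integrable. Qed.

Lemma Lint_ge0 f : (forall x, x \in `[0, 1] -> 0 <= f x) -> 0 <= Lint I f.
Proof. by move=> f0; apply: Rintegral_ge0. Qed.

Lemma Lint_norm f : bmeas f -> `|Lint I f| <= Lint I (fun x => `|f x|).
Proof. by move=> bf; apply: le_normr_Rintegral => //; exact: bmeas_integrable. Qed.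

Lemma Lint_norm_le f M : bmeas f -> (forall x, x \in `[0, 1] -> `|f x| <= M) -> `|Lint I f| <= M.
Proof.
move=> bf fM; apply: le_trans (Lint_norm _ bf) _; rewrite -[leRHS]Lint_cst.
by apply: Lint_le => //; [exact: bmeas_norm|exact: bmeas_cst].
Qed.

Lemma Lint_tail r f : 0 <= r -> Lint (`[r, 1] : set R) f = Lint I (fun x => tail_ind r x * f x).
Proof.
move=> r0; rewrite /Lint Rintegral_mkcond [RHS]Rintegral_mkcond; congr (Rintegral _ _ _).
apply/funext => x; rewrite /patch /tail_ind !mem_setE !in_itv/=.
case: (leP r x) => rx /=; last by rewrite mul0r; case: ifP.
by rewrite mul1r (le_trans r0 rx).
Qed.

Lemma Lint_fubini (k : R -> R -> R) f g M :
  measurable_fun setT (fun p : R * R => k p.1 p.2) ->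
  (forall x y, x \in `[0, 1] -> y \in `[0, 1] -> `|k x y| <= M) ->
  bmeas f -> bmeas g ->
  Lint I (fun x => f x * Lint I (fun y => k x y * g y)) =
  Lint I (fun y => g y * Lint I (fun x => f x * k x y)).
Proof.
move=> mk kM [mf [A fA]] [mg [B gB]].
have mf' : measurable_fun setT (f \_ I) by apply/(measurable_restrictT f).
have mg' : measurable_fun setT (g \_ I) by apply/(measurable_restrictT g).
pose F (p : R * R) : R := (f \_ I) p.1 * k p.1 p.2 * (g \_ I) p.2.
have mF : measurable_fun setT (EFin \o F).
  apply/measurable_EFinP; apply: measurable_funM.
    by apply: measurable_funM => //; exact: measurableT_comp.
  exact: measurableT_comp.
have F0 p : ~ (I p.1 /\ I p.2) -> F p = 0.
  rewrite /F /patch; case: ifP => [h1|]; last by rewrite !mul0r.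
  case: ifP => [h2|]; last by rewrite mulr0.
  by move: h1 h2; rewrite !inE => h1 h2 []; split.
have FM p : `|F p| <= (A * M * B).
  have A0 : 0 <= A by apply: le_trans (fA 0 _); rewrite ?in_itv/= ?lexx ?ler01.
  have B0 : 0 <= B by apply: le_trans (gB 0 _); rewrite ?in_itv/= ?lexx ?ler01.
  have M0 : 0 <= M by apply: le_trans (kM 0 0 _ _); rewrite ?in_itv/= ?lexx ?ler01.
  have [[h1 h2]|h] := pselect (I p.1 /\ I p.2).
    rewrite /F /patch !mem_set// !normrM ler_pM ?mulr_ge0//; first by rewrite ler_pM ?fA ?kM.
    exact: gB.
  by rewrite F0// normr0 !mulr_ge0.
have iF : (mu \x mu)%E.-integrable setT (EFin \o F).
  apply/integrable12ltyP => //.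
  (* A nonnegative function that vanishes off [0,1] and is bounded by the constant has integral at
     most that constant. This serves for the inner integral and again for the outer one. *)
  have restr (G : R -> \bar R) : measurable_fun setT G -> (forall x, ~ I x -> G x = 0%E) ->
      (forall x, (0 <= G x <= (A * M * B)%:E)%E) -> (\int[mu]_x G x <= (A * M * B)%:E)%E.
    move=> mG G0 GM; have -> : G = G \_ I.
      apply/funext => x; rewrite /patch; case: ifP => // h; apply: G0 => Ix.
      by rewrite mem_set in h.
    rewrite -integral_mkcond.
    have := @integral_le_bound _ _ _ mu I G (A * M * B)%:E measurable_I01.
    rewrite -[X in (_ * X)%E]/(mu I) mu_I01 mule1 => h; apply: le_trans (h _ _ _).
    - apply: ge0_le_integral => //.
      + by move=> x _; have /andP[] := GM x.
      + exact: measurable_funTS.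
      + by apply: measurableT_comp => //; exact: measurable_funTS.
      + by move=> x _; have /andP[h0 _] := GM x; rewrite gee0_abs.
    - exact: measurable_funTS.
    - by have /andP[h0 h1] := GM 0; exact: le_trans h1.
    - by apply: aeW => x _; have /andP[h0 h1] := GM x; rewrite gee0_abs.
  have mabs : measurable_fun setT (fun p => `|(EFin \o F) p|)%E by exact: measurableT_comp.
  have inner x : (0 <= \int[mu]_y `|(EFin \o F) (x, y)| <= (A * M * B)%:E)%E.
    rewrite integral_ge0//=; apply: restr.
    - exact: (@measurable_fun_pair2 _ _ _ _ _ _ (fun p : R * R => `|(EFin \o F) p|)%E x mabs).
    - by move=> y Iy; rewrite F0 ?normr0// => -[].
    - by move=> y; rewrite lee_fin normr_ge0/= lee_fin FM.
  apply: (@le_lt_trans _ _ (A * M * B)%:E); last exact: ltry.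
  apply: restr => //.
  - exact: (@measurable_fun_fubini_tonelli_F _ _ _ _ _ mu (fun p : R * R => `|(EFin \o F) p|)%E mabs (fun=> abse_ge0 _)).
  - by move=> x Ix; apply: integral0_eq => y _ /=; rewrite F0 ?normr0// => -[].
have EI (G : R -> R) : (\int[mu]_(x in I) (G x)%:E)%E = (\int[mu]_x ((G \_ I) x)%:E)%E.
  by rewrite [LHS]integral_mkcond; apply: eq_integral => x _; rewrite restrict_EFin.
have bk1 x : x \in `[0, 1] -> bmeas (k x).
  move=> xI; split; last by exists M => y yI; exact: kM.
  by apply: measurable_funTS; exact: (@measurable_fun_pair2 _ _ _ _ _ _ (fun p : R * R => k p.1 p.2) x mk).
have bk2 y : y \in `[0, 1] -> bmeas (k^~ y).
  move=> yI; split; last by exists M => x xI; exact: kM.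
  by apply: measurable_funTS; exact: (@measurable_fun_pair1 _ _ _ _ _ _ (fun p : R * R => k p.1 p.2) y mk).
have bf : bmeas f by split => //; exists A.
have bg : bmeas g by split => //; exists B.
have EL (h : R -> R) : bmeas h -> ((Lint I h)%:E = \int[mu]_(x in I) (h x)%:E)%E.
  by move=> bh; rewrite /Lint /Rintegral fineK//; apply: integrable_fin_num => //; exact: bmeas_integrable.
have E1 : (\int[mu]_x \int[mu]_y (F (x, y))%:E = \int[mu]_(x in I) (f x * Lint I (fun y => k x y * g y))%:E)%E.
  rewrite [RHS]integral_mkcond; apply: eq_integral => x _; rewrite /patch; case: ifPn => [|h]; last first.
    by apply: integral0_eq => y _; rewrite F0// => -[/mem_set Ix]; rewrite Ix in h.
  rewrite inE => Ix; rewrite -LintZ; last by apply: bmeasM => //; exact: bk1.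
  rewrite EL; last by apply: bmeasZ; apply: bmeasM => //; exact: bk1.
  rewrite EI; apply: eq_integral => y _; congr EFin.
  by rewrite /F /patch (mem_set Ix); case: ifP => h; rewrite ?mulr0// mulrA.
have E2 : (\int[mu]_y \int[mu]_x (F (x, y))%:E = \int[mu]_(y in I) (g y * Lint I (fun x => f x * k x y))%:E)%E.
  rewrite [RHS]integral_mkcond; apply: eq_integral => y _; rewrite /patch; case: ifPn => [|h]; last first.
    by apply: integral0_eq => x _; rewrite F0// => -[_ /mem_set Iy]; rewrite Iy in h.
  rewrite inE => Iy; rewrite -LintZ; last by apply: bmeasM => //; exact: bk2.
  rewrite EL; last by apply: bmeasZ; apply: bmeasM => //; exact: bk2.
  rewrite EI; apply: eq_integral => x _; congr EFin.
  by rewrite /F /patch (mem_set Iy); case: ifP => h; rewrite ?mul0r// mulrC.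
by rewrite /Lint /Rintegral; congr fine; rewrite -E1 -E2; exact: (Fubini iF).
Qed.

End UnitInterval.

(** * The Neumann and Dirichlet kernels *)

Section NeumannKernel.
Context {R : realType}.
Local Notation mu := (@lebesgue_measure R).
Local Notation I := (@I01 R).
Implicit Types (a s t T r x y z e : R).

Lemma in01 x : (x \in `[0, 1]) = (0 <= x <= 1). Proof. by rewrite in_itv. Qed.

Lemma Gneum_ge0 t r y : 0 < t -> 0 <= Gneum t r y.
Proof. by move=> t0; rewrite Gneum_theta// addr_ge0 ?theta_ge0. Qed.

Lemma Gneum_sym t r y : 0 < t -> Gneum t r y = Gneum t y r.
Proof.
by move=> t0; rewrite [LHS](Gneum_theta t r y t0) [RHS](Gneum_theta t y r t0) -(thetaN t (r - y) t0) opprB (addrC y r).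
Qed.

Lemma measurable_theta_comp t (d : measure_display) (T : measurableType d) (f : T -> R) : 0 < t ->
  measurable_fun setT f -> measurable_fun setT (fun p => theta t (f p)).
Proof. by move=> t0 mf; apply: measurableT_comp => //; exact: measurable_theta. Qed.

Lemma measurable_Gneum t : 0 < t -> measurable_fun setT (fun p : R * R => Gneum t p.1 p.2).
Proof.
move=> t0; under eq_fun do rewrite Gneum_theta//.
apply: measurable_funD; apply: measurable_theta_comp => //; first exact: measurable_funB.
exact: measurable_funD.
Qed.

(** The 4 comes from two [theta] terms with a factor 2 each, and [c = 1] from [|r - y|] and
    [|r + y|] being at most 2. The factor [1 / sqrt t] is kept outside because its integrability at
    0 is used later. *)
Definition kernel_sup T : R := 4 * theta_cst T 1 / Num.sqrt (2 * pi).

Lemma theta_cst_ge0 T (c : R) : 0 < T -> 0 <= theta_cst T c.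
Proof.
move=> T0; rewrite /theta_cst divr_ge0 ?expR_ge0// subr_ge0.
by have /andP[_ /ltW] := geo_ratio T T0.
Qed.

Lemma kernel_sup_ge0 T : 0 < T -> 0 <= kernel_sup T.
Proof. by move=> T0; rewrite divr_ge0 ?sqrtr_ge0// mulr_ge0 ?theta_cst_ge0. Qed.

Lemma norm_sub01 x y : x \in `[0, 1] -> y \in `[0, 1] -> `|x - y| <= 1.
Proof. by rewrite !in01 => /andP[? ?] /andP[? ?]; rewrite ler_norml; apply/andP; split; lra. Qed.

Lemma norm_add01 x y : x \in `[0, 1] -> y \in `[0, 1] -> `|x + y| <= 2.
Proof. by rewrite !in01 => /andP[? ?] /andP[? ?]; rewrite ler_norml; apply/andP; split; lra. Qed.

Lemma Gneum_le t T r y : 0 < t -> t <= T -> r \in `[0, 1] -> y \in `[0, 1] ->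
  Gneum t r y <= kernel_sup T / Num.sqrt t.
Proof.
move=> t0 tT rI yI; rewrite Gneum_theta//.
have h1 : `|r - y| <= 2 * 1 by have := norm_sub01 _ _ rI yI; lra.
have h2 : `|r + y| <= 2 * 1 by have := norm_add01 _ _ rI yI; lra.
apply: le_trans (lerD (theta_le t T 1 _ t0 tT h1) (theta_le t T 1 _ t0 tT h2)) _.
rewrite /kernel_sup sqrtrM ?mulr_ge0 ?pi_ge0// invfM le_eqVlt; apply/orP; left; apply/eqP; ring.
Qed.

Lemma Gneum_norm_le t r y : 0 < t -> r \in `[0, 1] -> y \in `[0, 1] ->
  `|Gneum t r y| <= kernel_sup t / Num.sqrt t.
Proof. by move=> t0 rI yI; rewrite ger0_norm ?Gneum_ge0// Gneum_le. Qed.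

Definition kernel_lip a T : R :=
  4 * (2 + 4 * T) / a / Num.sqrt (2 * pi * a) * theta_cst (2 * T) 1.

Lemma kernel_lip_ge0 a T : 0 < a -> 0 < T -> 0 <= kernel_lip a T.
Proof.
move=> a0 T0; rewrite /kernel_lip; apply: mulr_ge0; last by rewrite theta_cst_ge0// mulr_gt0.
by rewrite !mulr_ge0 ?invr_ge0 ?sqrtr_ge0 ?(ltW a0)// addr_ge0// mulr_ge0// ltW.
Qed.

Lemma Gneum_lip a t T r r' y : 0 < a -> a <= t -> t <= T ->
  r \in `[0, 1] -> r' \in `[0, 1] -> y \in `[0, 1] ->
  `|Gneum t r y - Gneum t r' y| <= kernel_lip a T * `|r - r'|.
Proof.
move=> a0 at' tT rI rI' yI; have t0 : 0 < t by exact: lt_le_trans at'.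
have T0 : 0 < T by exact: lt_le_trans tT.
have c0 : 0 <= theta_cst (2 * T) (1 : R) by rewrite theta_cst_ge0// mulr_gt0.
have h r0 : r0 \in `[0, 1] -> `|r0 - y| <= 2 * 1 /\ `|r0 + y| <= 2 * 1.
  by move=> r0I; have := norm_sub01 _ _ r0I yI; have := norm_add01 _ _ r0I yI; split; lra.
have [h1 h2] := h _ rI; have [h3 h4] := h _ rI'.
have rr := norm_sub01 _ _ rI rI'.
have e1 : r - y - (r' - y) = r - r' by ring.
have e2 : r + y - (r' + y) = r - r' by ring.
have l1 := theta_lip t T 1 _ _ t0 tT h1 h3; rewrite e1 in l1.
have l2 := theta_lip t T 1 _ _ t0 tT h2 h4; rewrite e2 in l2.
have {}l1 := l1 (le_trans rr (ler1n _ 2)); have {}l2 := l2 (le_trans rr (ler1n _ 2)).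
have K : 2 * (2 + 4 * t) / t / Num.sqrt (2 * pi * t) <= 2 * (2 + 4 * T) / a / Num.sqrt (2 * pi * a).
  have p0 : 0 < pi :> R by exact: pi_gt0.
  apply: ler_pM; rewrite ?invr_ge0 ?sqrtr_ge0//.
  - by rewrite !mulr_ge0 ?invr_ge0 ?(ltW t0)// addr_ge0// mulr_ge0// ltW.
  - have tT2 : 2 * (2 + 4 * t) <= 2 * (2 + 4 * T) by rewrite ler_wpM2l// lerD2l ler_wpM2l.
    have t20 : 0 <= 2 * (2 + 4 * t) by rewrite mulr_ge0// addr_ge0// mulr_ge0// ltW.
    by apply: ler_pM; rewrite ?invr_ge0 ?(ltW t0)// lef_pV2.
  - rewrite lef_pV2 ?posrE ?sqrtr_gt0 ?mulr_gt0// ler_wsqrtr// ler_wpM2l// mulr_ge0// ltW//.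
rewrite !Gneum_theta//.
rewrite opprD addrACA.
apply: le_trans (ler_normD _ _) _; apply: le_trans (lerD l1 l2) _.
rewrite /kernel_lip (_ : 4 * (2 + 4 * T) / a / _ * _ * _ = `|r - r'| *
  (2 * (2 + 4 * T) / a / Num.sqrt (2 * pi * a) * theta_cst (2 * T) 1) + `|r - r'| *
  (2 * (2 + 4 * T) / a / Num.sqrt (2 * pi * a) * theta_cst (2 * T) 1)); last by ring.
by apply: lerD; apply: ler_wpM2l => //; apply: ler_wpM2r.
Qed.

Lemma bmeas_theta_sub t x : 0 < t -> bmeas (fun z => theta t (x - z)).
Proof.
move=> t0; apply: bmeas_continuous => z; apply: (@continuous_comp _ _ _ (fun z : R => x - z) (theta t)).
  by apply: continuousB; [exact: cvg_cst|exact: cvg_id].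
exact: continuous_theta.
Qed.

Lemma bmeas_theta_add t x : 0 < t -> bmeas (fun z => theta t (x + z)).
Proof.
move=> t0; apply: bmeas_continuous => z; apply: (@continuous_comp _ _ _ (fun z : R => x + z) (theta t)).
  by apply: continuousD; [exact: cvg_cst|exact: cvg_id].
exact: continuous_theta.
Qed.

Lemma bmeas_theta_subr t x : 0 < t -> bmeas (fun z => theta t (z - x)).
Proof. by move=> t0; under eq_fun do rewrite addrC; exact: bmeas_theta_add. Qed.

Lemma bmeas_theta_addr t x : 0 < t -> bmeas (fun z => theta t (z + x)).
Proof. by move=> t0; under eq_fun do rewrite addrC; exact: bmeas_theta_add. Qed.

Lemma bmeas_Gneum t r : 0 < t -> bmeas (Gneum t r).
Proof.
move=> t0; apply: (bmeas_ext (fun y => theta t (r - y) + theta t (r + y))).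
  by move=> y _; rewrite Gneum_theta.
by apply: bmeasD; [exact: bmeas_theta_sub|exact: bmeas_theta_add].
Qed.

Lemma bmeas_Gneuml t y : 0 < t -> bmeas (fun r => Gneum t r y).
Proof. by move=> t0; under eq_fun do rewrite Gneum_sym//; exact: bmeas_Gneum. Qed.

Lemma Gneum_mass t r : 0 < t -> Lint I (Gneum t r) = 1.
Proof.
move=> t0; rewrite /Lint /Rintegral.
by under eq_integral do rewrite Gneum_theta//; rewrite integral_theta.
Qed.

Lemma theta_CK s t x y : 0 < s -> 0 < t ->
  Lint I (fun z => theta s (x - z) * theta t (z - y) + theta s (x + z) * theta t (z + y)) =
  theta (s + t) (x - y).
Proof. by move=> s0 t0; rewrite /Lint /Rintegral integral_theta_theta. Qed.

Lemma bmeas_CK s t x y : 0 < s -> 0 < t ->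
  bmeas (fun z => theta s (x - z) * theta t (z - y) + theta s (x + z) * theta t (z + y)).
Proof.
move=> s0 t0; apply: bmeasD; apply: bmeasM.
- exact: bmeas_theta_sub.
- exact: bmeas_theta_subr.
- exact: bmeas_theta_add.
- exact: bmeas_theta_addr.
Qed.

(** The product of two sums of two [theta] values has four terms, which regroup into the circle
    identity for [y] and the one for [- y]. The Dirichlet version is the same with signs. *)
Lemma Gneum_CK s t r y : 0 < s -> 0 < t ->
  Lint I (fun z => Gneum s r z * Gneum t z y) = Gneum (s + t) r y.
Proof.
move=> s0 t0; rewrite [RHS]Gneum_theta ?addr_gt0// -(theta_CK s t r y)//.
rewrite -[r + y]/(r + y) -[X in _ + theta _ (r + X)]opprK -(theta_CK s t r (- y))//.
rewrite -LintD; [|exact: bmeas_CK|exact: bmeas_CK].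
apply: Lint_ext => z _; rewrite !Gneum_theta// opprK.
by move: (theta s (r - z)) (theta s (r + z)) (theta t (z - y)) (theta t (z + y)) => a b c d; ring.
Qed.

(* The Dirichlet heat kernel of [0,1]. *)
Definition Gdir t r y : R := theta t (r - y) - theta t (r + y).

Lemma bmeas_Gdir t r : 0 < t -> bmeas (Gdir t r).
Proof. by move=> t0; apply: bmeasB; [exact: bmeas_theta_sub|exact: bmeas_theta_add]. Qed.

Lemma bmeas_Gdirl t y : 0 < t -> bmeas (fun r => Gdir t r y).
Proof. by move=> t0; apply: bmeasB; [exact: bmeas_theta_subr|exact: bmeas_theta_addr]. Qed.

Lemma Gdir_CK s t r y : 0 < s -> 0 < t ->
  Lint I (fun z => Gdir s r z * Gdir t z y) = Gdir (s + t) r y.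
Proof.
move=> s0 t0; rewrite /Gdir -(theta_CK s t r y)//.
rewrite -[X in _ - theta _ (r + X)]opprK -(theta_CK s t r (- y))//.
rewrite -LintB; [|exact: bmeas_CK|exact: bmeas_CK].
apply: Lint_ext => z _; rewrite opprK.
by move: (theta s (r - z)) (theta s (r + z)) (theta t (z - y)) (theta t (z + y)) => a b c d; ring.
Qed.

Lemma Gdir_norm_mass t y : 0 < t -> Lint I (fun z => `|Gdir t z y|) <= 1.
Proof.
move=> t0; rewrite -(Gneum_mass t y t0); apply: Lint_le.
- by apply: bmeas_norm; exact: bmeas_Gdirl.
- exact: bmeas_Gneum.
move=> z _; rewrite Gneum_sym// Gneum_theta//; apply: le_trans (ler_normB _ _) _.
by rewrite !ger0_norm ?theta_ge0.
Qed.

Lemma Gdir_sym t r y : 0 < t -> Gdir t r y = Gdir t y r.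
Proof. by move=> t0; rewrite /Gdir -(thetaN t (r - y) t0) opprB (addrC y r). Qed.

(** The product can be negative only when the signs differ, and then the negative factor has modulus
    at most [e]. *)
Lemma mul_ge_norm e (a b : R) : 0 <= e -> - e <= a -> - e <= b -> - e * (`|b| + `|a|) <= b * a.
Proof.
by move=> e0 ha hb; have [a0|a0] := leP 0 a; have [b0|b0] := leP 0 b;
  rewrite ?(ger0_norm a0) ?(ltr0_norm a0) ?(ger0_norm b0) ?(ltr0_norm b0); nra.
Qed.

(** In the Chapman-Kolmogorov integral, negativity of one factor costs at most [e] times the
    integral of the modulus of the other, itself at most 1; there are two factors. *)
Lemma Gdir_double t e : 0 < t -> 0 <= e ->
  (forall r y, r \in `[0, 1] -> y \in `[0, 1] -> - e <= Gdir t r y) ->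
  forall r y, r \in `[0, 1] -> y \in `[0, 1] -> - (2 * e) <= Gdir (2 * t) r y.
Proof.
move=> t0 e0 h r y rI yI; have -> : 2 * t = t + t by ring.
rewrite -Gdir_CK//.
have b1 : bmeas (fun z => `|Gdir t r z|) by apply: bmeas_norm; exact: bmeas_Gdir.
have b2 : bmeas (fun z => `|Gdir t z y|) by apply: bmeas_norm; exact: bmeas_Gdirl.
have m1 : Lint I (fun z => `|Gdir t r z|) <= 1.
  by under Lint_ext => z _ do rewrite Gdir_sym//; exact: Gdir_norm_mass.
have m2 := Gdir_norm_mass t y t0.
apply: (@le_trans _ _ (Lint I (fun z => (- e) * (`|Gdir t r z| + `|Gdir t z y|)))).
  rewrite LintZ; last exact: bmeasD.
  rewrite LintD// mulNr lerN2 [leRHS]mulrC ler_wpM2l//.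
  exact: lerD m1 m2.
apply: Lint_le.
- by apply: bmeasZ; exact: bmeasD.
- by apply: bmeasM; [exact: bmeas_Gdir|exact: bmeas_Gdirl].
move=> z zI; have := h _ _ rI zI; have := h _ _ zI yI.
by move=> ha hb; exact: mul_ge_norm.
Qed.

(** Up to the tail estimate, only the nearest image of the subtracted term competes with the central
    Gaussian, and it is never closer: its distance is [r + y] or [2 - (r + y)], both at least
    [|r - y|]. *)
Lemma Gdir_small : exists2 C : R, 0 <= C & forall t r y, 0 < t -> t <= 1 ->
  r \in `[0, 1] -> y \in `[0, 1] -> - (C * t ^+ 2) <= Gdir t r y.
Proof.
have [C C0 hC] := @theta_tail R; exists C => // t r y t0 t1 rI yI.
have ry := norm_sub01 _ _ rI yI; move: rI yI; rewrite !in01 => /andP[r0 r1] /andP[y0 y1].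
have h1 := gauss_le_theta t (r - y) t0.
rewrite /Gdir; have [ry1|ry1] := leP (r + y) 1.
  have h2 : theta t (r + y) <= gauss t (r + y) + C * t ^+ 2.
    by apply: hC => //; rewrite ger0_norm// addr_ge0.
  have h3 : gauss t (r + y) <= gauss t (r - y).
    apply: gauss_le => //; rewrite [leRHS]ger0_norm ?addr_ge0// ler_norml.
    by apply/andP; split; lra.
  lra.
have h2 : theta t (2 - (r + y)) <= gauss t (2 - (r + y)) + C * t ^+ 2.
  by apply: hC => //; rewrite ler_norml; apply/andP; split; lra.
rewrite theta_refl// in h2.
have h3 : gauss t (2 - (r + y)) <= gauss t (r - y).
  apply: gauss_le => //; rewrite [leRHS]ger0_norm; last lra.
  by rewrite ler_norml; apply/andP; split; lra.
lra.
Qed.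

(* The negative part at most doubles when the time doubles, and is [O(t ^+ 2)] as [t] tends to 0. *)
Lemma Gdir_ge0 t r y : 0 < t -> r \in `[0, 1] -> y \in `[0, 1] -> 0 <= Gdir t r y.
Proof.
move=> t0 rI yI; have [C C0 hC] := Gdir_small.
have it n : forall e s, 0 < s -> 0 <= e ->
    (forall r y, r \in `[0, 1] -> y \in `[0, 1] -> - e <= Gdir s r y) ->
    forall r y, r \in `[0, 1] -> y \in `[0, 1] -> - (2 ^+ n * e) <= Gdir (2 ^+ n * s) r y.
  elim: n => [|n IH] e s s0 e0 h; first by rewrite !expr0 !mul1r.
  rewrite !exprSr -!mulrA; apply: IH; rewrite ?mulr_gt0 ?mulr_ge0//.
  exact: Gdir_double.
rewrite leNgt; apply/negP => D0.
have p2 n : 0 < 2 ^+ n :> R by rewrite exprn_gt0.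
have n2 n : n%:R <= 2 ^+ n :> R by rewrite -natrX ler_nat ltnW// ltn_expl.
have d0 : 0 < - Gdir t r y by rewrite oppr_gt0.
have q0 : 0 <= C * t ^+ 2 / - Gdir t r y := divr_ge0 (mulr_ge0 C0 (sqr_ge0 t)) (ltW d0).
(* One power of two above [B] serves twice: it brings the starting time [t / 2 ^+ n] below 1, and it
   makes the final error [2 ^+ n * (C * (t / 2 ^+ n) ^+ 2) = C * t ^+ 2 / 2 ^+ n] smaller than
   [- Gdir t r y]. *)
pose B : R := `|t| + C * t ^+ 2 / - Gdir t r y.
have B0 : 0 <= B by rewrite addr_ge0.
have [n nB] : exists n : nat, B < 2 ^+ n.
  by exists (Num.bound B); apply: lt_le_trans (archi_boundP B0) _.
have s0 : 0 < t / 2 ^+ n by rewrite divr_gt0.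
have s1 : t / 2 ^+ n <= 1.
  by rewrite ler_pdivrMr// mul1r; apply: le_trans (ler_norm _) _; apply: le_trans (ltW nB); rewrite lerDl.
have := it n (C * (t / 2 ^+ n) ^+ 2) (t / 2 ^+ n) s0.
have n0 : 2 ^+ n != 0 :> R by rewrite gt_eqF.
rewrite [2 ^+ n * (t / _)]mulrC divfK//.
have e0 : 0 <= C * (t / 2 ^+ n) ^+ 2 by rewrite mulr_ge0 ?sqr_ge0.
move=> /(_ e0 (fun r y => hC _ r y s0 s1) _ _ rI yI).
have -> : 2 ^+ n * (C * (t / 2 ^+ n) ^+ 2) = C * t ^+ 2 / 2 ^+ n.
  by move: (2 ^+ n) n0 => P P0; field.
have : C * t ^+ 2 / 2 ^+ n < - Gdir t r y.
  rewrite ltr_pdivrMr// -ltr_pdivrMl//.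
  by rewrite mulrC; apply: le_lt_trans nB; rewrite /B lerDr.
move=> h1 h2; have := lt_le_trans h1 (le_refl _); rewrite ltrNr => h3.
by have := le_lt_trans h2 h3; rewrite ltxx.
Qed.

End NeumannKernel.

(** * The mass sent into a tail, its monotonicity and its limit at small times *)

Section TailKernel.
Context {R : realType}.
Local Notation mu := (@lebesgue_measure R).
Local Notation I := (@I01 R).
Implicit Types (a b s t T r x y z e : R).

Definition Gtail t r y : R := Lint I (fun x => tail_ind r x * Gneum t x y).

Lemma bmeas_tail_Gneum t r y : 0 < t -> bmeas (fun x => tail_ind r x * Gneum t x y).
Proof. by move=> t0; apply: bmeasM; [exact: bmeas_tail|exact: bmeas_Gneuml]. Qed.

Lemma Gneum_massl t y : 0 < t -> Lint I (fun x => Gneum t x y) = 1.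
Proof.
by move=> t0; rewrite -(Gneum_mass t y t0); apply: Lint_ext => x _; rewrite Gneum_sym.
Qed.

Lemma Gtail_ge0 t r y : 0 < t -> 0 <= Gtail t r y.
Proof. by move=> t0; apply: Lint_ge0 => x _; rewrite mulr_ge0 ?tail_ind_ge0 ?Gneum_ge0. Qed.

Lemma Gtail_le1 t r y : 0 < t -> Gtail t r y <= 1.
Proof.
move=> t0; rewrite -(Gneum_massl t y t0); apply: Lint_le.
- exact: bmeas_tail_Gneum.
- exact: bmeas_Gneuml.
- by move=> x _; rewrite ler_piMl ?Gneum_ge0 ?tail_ind_le1.
Qed.

Lemma Gtail_lip t r y y' : 0 < t -> y \in `[0, 1] -> y' \in `[0, 1] ->
  `|Gtail t r y - Gtail t r y'| <= kernel_lip t t * `|y - y'|.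
Proof.
move=> t0 yI yI'; rewrite /Gtail -LintB; [|exact: bmeas_tail_Gneum|exact: bmeas_tail_Gneum].
apply: Lint_norm_le; first by apply: bmeasB; exact: bmeas_tail_Gneum.
move=> x xI; rewrite -mulrBr normrM (Gneum_sym t x y t0) (Gneum_sym t x y' t0).
rewrite ger0_norm ?tail_ind_ge0//.
apply: le_trans (ler_wpM2r (normr_ge0 _) (tail_ind_le1 r x)) _; rewrite mul1r.
exact: Gneum_lip.
Qed.

Lemma lipschitz_within_continuous (f : R -> R) (L : R) : 0 <= L ->
  (forall x y, x \in `[0, 1] -> y \in `[0, 1] -> `|f x - f y| <= L * `|x - y|) ->
  {within I, continuous f}.
Proof.
move=> L0 fL; apply/subspace_continuousP => x Ix; apply/cvgrPdist_le => e e0.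
have L1 : 0 < L + 1 by rewrite ltr_wpDl.
rewrite near_withinE; near=> y => Iy; apply: le_trans (fL x y Ix Iy) _.
have xy : `|x - y| <= e / (L + 1).
  by near: y; apply: cvgr_dist_le => //; rewrite divr_gt0.
apply: le_trans (ler_wpM2l L0 xy) _.
by rewrite mulrCA ler_piMr ?(ltW e0)// ler_pdivrMr// mul1r lerDl.
Unshelve. all: by end_near. Qed.

Lemma Gtail_continuous t r : 0 < t -> {within I, continuous (Gtail t r)}.
Proof.
move=> t0; apply: (@lipschitz_within_continuous _ (kernel_lip t t)); first exact: kernel_lip_ge0.
by move=> x y xI yI; exact: Gtail_lip.
Qed.

Lemma bmeas_Gtail t r : 0 < t -> bmeas (Gtail t r).
Proof. by move=> t0; apply: bmeas_within_continuous; exact: Gtail_continuous. Qed.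

Lemma bmeas_fin_num (f : R -> R) a b : 0 <= a -> b <= 1 -> bmeas f ->
  (\int[mu]_(x in `[a, b]) (f x)%:E)%E \is a fin_num.
Proof.
move=> a0 b1 /bmeas_integrable fI.
have fab : mu.-integrable `[a, b] (EFin \o f).
  apply: integrableS fI; [exact: measurable_I01|exact: measurable_itv|].
  by move=> x; rewrite /I01/= !in_itv/= => /andP[h1 h2]; rewrite (le_trans a0 h1) (le_trans h2 b1).
by apply: integrable_fin_num fab; exact: measurable_itv.
Qed.

Lemma measurable_theta_itv t a b (f : R -> R) : 0 < t -> measurable_fun setT f ->
  measurable_fun (`[a, b]%classic : set R) (fun x : R => (theta t (f x))%:E).
Proof.
move=> t0 mf; apply/measurable_EFinP; apply: measurable_funTS.
exact: measurable_theta_comp.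
Qed.

(** After substitution [Gtail t r z] is the integral of [theta t] over the window from [r - z] to
    [2 - r - z]. Moving [z] from [y] to [y'] shifts the window left: it gains the integral of
    [theta t (r - x)] over [[y, y']] and loses that of [theta t (r + x)]. The balance is the
    integral of [Gdir t r x], which is nonnegative. *)
Lemma Gtail_mono t r y y' : 0 < t -> r \in `[0, 1] -> y \in `[0, 1] -> y' \in `[0, 1] ->
  y <= y' -> Gtail t r y <= Gtail t r y'.
Proof.
move=> t0 rI yI yI' yy'; pose th := EFin \o theta t.
have mth : measurable_fun setT th by apply/measurable_EFinP; exact: measurable_theta.
have mB c : measurable_fun setT (fun x : R => c - x) by exact: measurable_funB.
have mD c : measurable_fun setT (fun x : R => c + x) by exact: measurable_funD.
have mB' c : measurable_fun setT (fun x : R => x - c) by exact: measurable_funB.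
have mD' c : measurable_fun setT (fun x : R => x + c) by exact: measurable_funD.
have th0 x : (0 <= th x)%E by rewrite lee_fin theta_ge0.
pose J a b : \bar R := (\int[mu]_(x in `[a, b[) th x)%E.
have J1 a b : J a b = (\int[mu]_(x in `[a, b]) th x)%E.
  by rewrite /J integral_itv_bndo_bndc//; exact: measurable_funTS.
have split a b c : a <= b -> b <= c -> (J a c = J a b + J b c)%E.
  by move=> ab bc; exact: ge0_integral_itv_split.
clearbody J; move: (rI) (yI) (yI'); rewrite !in01 => /andP[r0 r1] /andP[y0 y1] /andP[y0' y1'].
have ex2 (z x : R) : theta t (2 - z - x) = theta t (x + z).
  by rewrite -(theta_refl t (x + z) t0) (addrC x) opprD addrA.
(* The point [1 - z] splits the window: to its left the direct term [theta t (x - z)], to its right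
   the reflected term [theta t (x + z)], read backwards through the symmetry of [theta] about 1. *)
have E z : z \in `[0, 1] -> (Gtail t r z)%:E = J (r - z) (2 - r - z).
  move=> zI; move: (zI); rewrite in01 => /andP[z0 z1].
  rewrite (split _ (1 - z)); [|lra|lra].
  rewrite /Gtail -Lint_tail// /Lint /Rintegral fineK; last first.
    by apply: bmeas_fin_num => //; exact: bmeas_Gneuml.
  under eq_integral do rewrite Gneum_theta// EFinD.
  have m1 : measurable_fun (`[r, 1]%classic : set R) (fun x : R => (theta t (x - z))%:E).
    exact: (measurable_theta_itv _ _ _ _ t0 (mB' _)).
  have m2 : measurable_fun (`[r, 1]%classic : set R) (fun x : R => (theta t (x + z))%:E).
    exact: (measurable_theta_itv _ _ _ _ t0 (mD' _)).
  have p1 (x : R) : (`[r, 1]%classic : set R) x -> (0 <= (theta t (x - z))%:E)%E by rewrite lee_fin theta_ge0.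
  have p2 (x : R) : (`[r, 1]%classic : set R) x -> (0 <= (theta t (x + z))%:E)%E by rewrite lee_fin theta_ge0.
  rewrite (@ge0_integralD _ _ _ mu _ (measurable_itv _) _ _ p1 m1 p2 m2).
  have e1 : J (r - z) (1 - z) = (\int[mu]_(x in `[r, 1%R]) (theta t (x - z))%:E)%E.
    rewrite J1 (ge0_integral_itv_addr th _ _ (- z) mth th0).
    by rewrite !opprK !subrK.
  have e2 : J (1 - z) (2 - r - z) = (\int[mu]_(x in `[r, 1%R]) (theta t (x + z))%:E)%E.
    rewrite J1 (ge0_integral_itv_subl th _ _ (2 - z) mth th0).
    rewrite (_ : 2 - z - (2 - r - z) = r); last by ring.
    rewrite (_ : 2 - z - (1 - z) = 1); last by ring.
    by apply: eq_integral => x _; exact: (congr1 EFin (ex2 z x)).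
  by rewrite e1 e2.
have EB : J (r - y') (r - y) = (\int[mu]_(x in `[y, y']) (theta t (r - x))%:E)%E.
  rewrite J1 (ge0_integral_itv_subl th _ _ r mth th0).
  by rewrite !subKr.
have EA : J (2 - r - y') (2 - r - y) = (\int[mu]_(x in `[y, y']) (theta t (r + x))%:E)%E.
  rewrite J1 (ge0_integral_itv_subl th _ _ (2 - r) mth th0).
  rewrite !subKr.
  by apply: eq_integral => x _; rewrite /= (addrC r); exact: (congr1 EFin (ex2 r x)).
have AB : (J (2 - r - y')%R (2 - r - y)%R <= J (r - y')%R (r - y)%R)%E.
  have pw (x : R) : (`[y, y']%classic : set R) x -> ((theta t (r + x))%:E <= (theta t (r - x))%:E)%E.
    rewrite /= in_itv/= => /andP[h1 h2]; rewrite lee_fin -subr_ge0.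
    by apply: (Gdir_ge0 t r x t0 rI); rewrite in01 (le_trans y0 h1) (le_trans h2 y1').
  rewrite EA EB; apply: ge0_le_integral.
  - exact: measurable_itv.
  - by move=> x _; rewrite lee_fin theta_ge0.
  - exact: (measurable_theta_itv _ _ _ _ t0 (mD _)).
  - exact: (measurable_theta_itv _ _ _ _ t0 (mB _)).
  - exact: pw.
have l1 : r - y' <= 2 - r - y' by lra.
have l2 : 2 - r - y' <= 2 - r - y by lra.
have l3 : r - y' <= r - y by lra.
have l4 : r - y <= 2 - r - y by lra.
have tot : (J (r - y')%R (2 - r - y')%R + J (2 - r - y')%R (2 - r - y)%R = J (r - y')%R (r - y)%R + J (r - y)%R (2 - r - y)%R)%E.
  by rewrite -(split _ _ _ l1 l2) -(split _ _ _ l3 l4).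
(* The gained mass is added to both sides and cancelled at the end; in the extended reals this
   requires it to be finite. *)
have finB : (\int[mu]_(x in `[y, y']) (theta t (r - x))%:E)%E \is a fin_num.
  by apply: bmeas_fin_num => //; exact: bmeas_theta_sub.
rewrite -EB in finB; have Ey := E y yI; have Ey' := E y' yI'.
move: (Gtail t r y) (Gtail t r y') Ey Ey' => g g' Ey Ey'; rewrite -lee_fin Ey Ey'.
have : (J (r - y)%R (2 - r - y)%R + J (r - y')%R (r - y)%R <= J (r - y')%R (2 - r - y')%R + J (r - y')%R (r - y)%R)%E.
  by rewrite [X in (X <= _)%E]addeC -tot leeD2l.
by rewrite leeD2rE.
Qed.

(** Since [x + y] and [2 - (x + y)] are both at least [|x - y|], the nearest reflected image is no
    closer than [e] either; the remaining images fall under the tail estimate. *)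
Lemma Gneum_offdiag e : 0 < e -> exists2 K : R, 0 <= K & forall t x y, 0 < t -> t <= 1 ->
  x \in `[0, 1] -> y \in `[0, 1] -> e <= `|x - y| -> Gneum t x y <= K * t ^+ 2.
Proof.
move=> e0; have [C C0 hC] := @theta_tail R.
pose A : R := 216 / e ^+ 6.
have A0 : 0 <= A by apply: divr_ge0; [exact: ler0n|apply: exprn_ge0; exact: ltW].
have G t z : 0 < t -> t <= 1 -> e <= `|z| -> gauss t z <= A * t ^+ 2.
  move=> t0 t1 ez; apply: (@le_trans _ _ (gauss t e)).
    by apply: gauss_le => //; rewrite (gtr0_norm e0).
  exact: gauss_small.
have Th t z : 0 < t -> t <= 1 -> e <= `|z| -> `|z| <= 1 -> theta t z <= (A + C) * t ^+ 2.
  by move=> t0 t1 ez z1; apply: le_trans (hC _ _ t0 t1 z1) _; rewrite mulrDl lerD2r G.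
exists (2 * (A + C)); first by rewrite mulr_ge0 ?addr_ge0.
move=> t x y t0 t1 xI yI exy; rewrite Gneum_theta// -mulrA [leRHS]mulr_natl mulr2n.
have := norm_sub01 _ _ xI yI => xy1.
move: xI yI; rewrite !in01 => /andP[x0 x1] /andP[y0 y1].
apply: lerD; first exact: Th.
have [xy|xy] := leP (x + y) 1.
  apply: Th => //; rewrite [`|x + y|]ger0_norm ?addr_ge0//.
  by apply: le_trans exy _; rewrite ler_norml; apply/andP; split; lra.
rewrite -theta_refl//; apply: Th => //; rewrite [`|2 - _|]ger0_norm; try lra.
by apply: le_trans exy _; rewrite ler_norml; apply/andP; split; lra.
Qed.

Lemma Lint_window r e : 0 <= e -> Lint I (\1_(`[(r - e), (r + e)]%classic)) <= 2 * e.
Proof.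
pose W : set R := `[(r - e), (r + e)]%classic.
have mW : measurable W by exact: measurable_itv.
move=> e0; rewrite -/W /Lint /Rintegral integral_indic//=; do ?exact: measurable_I01.
have h : (mu (W `&` I) <= (2 * e)%:E)%E.
  apply: (@le_trans _ _ (mu W)).
    by apply: le_measure; rewrite ?inE//; apply: measurableI => //; exact: measurable_I01.
  rewrite lebesgue_measure_itv/= lte_fin; case: ifP => _; last by rewrite lee_fin mulr_ge0.
  by rewrite -EFinB lee_fin; lra.
rewrite -lee_fin fineK// ge0_fin_numE ?measure_ge0//.
exact: le_lt_trans h (ltry _).
Qed.

(** The limit jumps at [r], so the convergence is measured in mean. A window of half-width [e / 4]
    around [r] costs its length [e / 2]; elsewhere the misplaced mass has travelled at least
    [e / 4], and there is O([t ^+ 2]) of it. *)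
Lemma Gtail_limit e : 0 < e -> exists2 d : R, 0 < d & forall t r, 0 < t -> t <= d ->
  r \in `[0, 1] -> Lint I (fun y => `|Gtail t r y - tail_ind r y|) <= e.
Proof.
move=> e0; have n0 : 0 < e / 4 by rewrite divr_gt0.
have [K K0 hK] := Gneum_offdiag _ n0.
exists (Num.min 1 (e / (2 * (K + 1)))).
  by rewrite lt_min ltr01 divr_gt0// mulr_gt0// ltr_wpDl.
move=> t r t0; rewrite le_min => /andP[t1 tK] rI.
have Kt : K * t ^+ 2 <= e / 2.
  have h1 : t ^+ 2 <= t by rewrite expr2 ler_piMl// ltW.
  apply: le_trans (ler_wpM2l K0 h1) _.
  apply: (@le_trans _ _ ((K + 1) * t)); first by rewrite ler_wpM2r ?(ltW t0)// lerDl.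
  apply: le_trans (ler_wpM2l _ tK) _; first by rewrite addr_ge0.
  have : K + 1 != 0 by rewrite gt_eqF// ltr_wpDl.
  by move=> h; rewrite le_eqVlt; apply/orP; left; apply/eqP; field.
pose W : set R := `[(r - e / 4), (r + e / 4)]%classic.
have bW : bmeas (\1_W) by apply: bmeas_indic; exact: measurable_itv.
apply: (@le_trans _ _ (Lint I (fun y => K * t ^+ 2 + \1_W y))); last first.
  rewrite LintD//; last exact: bmeas_cst.
  by rewrite Lint_cst; have := Lint_window r _ (ltW n0); rewrite -/W; lra.
apply: Lint_le.
- by apply: bmeas_norm; apply: bmeasB; [exact: bmeas_Gtail|exact: bmeas_tail].
- by apply: bmeasD => //; exact: bmeas_cst.
move=> y yI; rewrite indicE.
have Kt0 : 0 <= K * t ^+ 2 by rewrite mulr_ge0// sqr_ge0.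
have g0 := Gtail_ge0 t r y t0; have g1 := Gtail_le1 t r y t0.
have i0 := tail_ind_ge0 r y; have i1 := tail_ind_le1 r y.
have [yW|yW] := boolP (y \in W).
  rewrite mulr1n; move: (Gtail t r y) (tail_ind r y) g0 g1 i0 i1 Kt0 => g i g0 g1 i0 i1 Kt0.
  by rewrite ler_norml; apply/andP; split; lra.
rewrite addr0; have {yW} : e / 4 < `|y - r|.
  rewrite ltNge; apply/negP => h; move/negP: yW; apply.
  rewrite inE /W/= in_itv/=; move: h; rewrite ler_norml => /andP[h1 h2].
  by apply/andP; split; lra.
have bnd (f : R -> R) : bmeas f -> (forall x, x \in `[0, 1] -> 0 <= f x <= K * t ^+ 2) -> `|Lint I f| <= K * t ^+ 2.
  by move=> bf h; apply: Lint_norm_le => // x xI; have /andP[h1 h2] := h x xI; rewrite ger0_norm.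
have [ry|yr] := leP r y.
  rewrite ger0_norm ?subr_ge0// => yr.
  have -> : tail_ind r y = 1 by rewrite /tail_ind ry.
  rewrite distrC -(Gneum_massl t y t0) /Gtail -LintB; [|exact: bmeas_Gneuml|exact: bmeas_tail_Gneum].
  apply: bnd; first by apply: bmeasB; [exact: bmeas_Gneuml|exact: bmeas_tail_Gneum].
  move=> x xI; rewrite /tail_ind; case: (leP r x) => rx /=.
    by rewrite mul1r subrr lexx.
  rewrite mul0r subr0 Gneum_ge0//=; apply: hK => //.
  by rewrite distrC ger0_norm; lra.
rewrite [`|y - r|]distrC ger0_norm ?subr_ge0 ?(ltW yr)// => ry.
have -> : tail_ind r y = 0 by rewrite /tail_ind leNgt yr.
rewrite subr0; apply: bnd; first exact: bmeas_tail_Gneum.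
move=> x xI; rewrite /tail_ind; case: (leP r x) => rx /=; last by rewrite mul0r lexx.
rewrite mul1r Gneum_ge0//=; apply: hK => //.
by rewrite ger0_norm; lra.
Qed.

End TailKernel.

(** * Integration against the measures c D_0 + rho(r) dr *)

Section Pairing.
Context {R : realType}.
Local Notation I := (@I01 R).
Implicit Types (mu nu : meas R) (f h : R -> R) (a b e k t r x y M L : R).

Definition pairing mu h : R := mu.1 * h 0 + Lint I (fun x => h x * mu.2 x).

Lemma mem0I : (0 : R) \in `[0, 1]. Proof. by rewrite in01 lexx ler01. Qed.

Lemma mem1I : (1 : R) \in `[0, 1]. Proof. by rewrite in01 lexx ler01. Qed.

Lemma Linf_pos_bmeas f : Linf_pos f -> bmeas f.
Proof.
move=> [mf [f0 [M fM]]]; split => //; exists M => x xI.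
by rewrite ger0_norm ?f0// fM.
Qed.

Lemma in_U_bmeas mu : in_U mu -> bmeas mu.2.
Proof. by move=> [_ /Linf_pos_bmeas]. Qed.

Lemma in_U_ge0 mu x : in_U mu -> x \in `[0, 1] -> 0 <= mu.2 x.
Proof. by move=> [_ [_ [h _]]]; exact: h. Qed.

Lemma bmeas_Linf_pos f : bmeas f -> (forall x, x \in `[0, 1] -> 0 <= f x) -> Linf_pos f.
Proof.
move=> [mf [M fM]] f0; split => //; split => //; exists M => x xI.
exact: le_trans (ler_norm _) (fM x xI).
Qed.

Lemma Fm_pairing mu r : in_U mu -> r \in `[0, 1] -> Fm mu r = pairing mu (tail_ind r).
Proof.
move=> _; rewrite in01 => /andP[r0 _]; rewrite /Fm /pairing Lint_tail//; congr (_ + _).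
rewrite /tail_ind; have -> : (r <= 0) = (r == 0) by rewrite eq_le r0 andbT.
by case: (r == 0); rewrite ?mulr1 ?mulr0.
Qed.

Lemma pairing_ext mu f h : (forall x, x \in `[0, 1] -> f x = h x) -> pairing mu f = pairing mu h.
Proof.
by move=> fh; rewrite /pairing fh ?mem0I//; congr (_ + _); apply: Lint_ext => x xI; rewrite fh.
Qed.

Lemma pairingD mu f h : in_U mu -> bmeas f -> bmeas h ->
  pairing mu (fun x => f x + h x) = pairing mu f + pairing mu h.
Proof.
move=> /in_U_bmeas bm bf bh; rewrite /pairing mulrDr addrACA -LintD; [|exact: bmeasM|exact: bmeasM].
by congr (_ + _); apply: Lint_ext => x _; rewrite mulrDl.
Qed.

Lemma pairingZ mu k f : in_U mu -> bmeas f -> pairing mu (fun x => k * f x) = k * pairing mu f.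
Proof.
move=> /in_U_bmeas bm bf; rewrite /pairing mulrDr -LintZ; last exact: bmeasM.
by rewrite mulrCA; congr (_ + _); apply: Lint_ext => x _; rewrite mulrA.
Qed.

Lemma pairingB mu f h : in_U mu -> bmeas f -> bmeas h ->
  pairing mu (fun x => f x - h x) = pairing mu f - pairing mu h.
Proof.
move=> Um bf bh; rewrite -[- pairing mu h]mulN1r -pairingZ// -pairingD//; last exact: bmeasZ.
by apply: pairing_ext => x _; rewrite mulN1r.
Qed.

Lemma pairing_le mu f h : in_U mu -> bmeas f -> bmeas h ->
  (forall x, x \in `[0, 1] -> f x <= h x) -> pairing mu f <= pairing mu h.
Proof.
move=> Um bf bh fh; have bm := in_U_bmeas _ Um; apply: lerD.
  by apply: ler_wpM2l; [exact: Um.1|apply: fh; exact: mem0I].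
apply: Lint_le; [exact: bmeasM|exact: bmeasM|] => x xI.
by apply: ler_wpM2r; [exact: in_U_ge0|exact: fh].
Qed.

Lemma pairing_cst mu k : in_U mu -> pairing mu (fun=> k) = k * Fm mu 0.
Proof.
move=> Um; rewrite Fm_pairing ?mem0I// -pairingZ//; last exact: bmeas_tail.
by apply: pairing_ext => x; rewrite in01 /tail_ind => /andP[-> _]; rewrite mulr1.
Qed.

Lemma Fm_ge0 mu r : in_U mu -> r \in `[0, 1] -> 0 <= Fm mu r.
Proof.
move=> Um rI; rewrite Fm_pairing// addr_ge0//.
  by rewrite mulr_ge0 ?tail_ind_ge0//; exact: Um.1.
by apply: Lint_ge0 => x xI; rewrite mulr_ge0 ?tail_ind_ge0//; exact: in_U_ge0.
Qed.

Lemma pairing_norm_le mu f k : in_U mu -> bmeas f ->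
  (forall x, x \in `[0, 1] -> `|f x| <= k) -> `|pairing mu f| <= k * Fm mu 0.
Proof.
move=> Um bf fk; rewrite -pairing_cst// ler_norml; apply/andP; split.
  rewrite pairing_cst// -mulNr -pairing_cst//; apply: pairing_le => //; first exact: bmeas_cst.
  by move=> x xI; have := fk x xI; rewrite ler_norml => /andP[].
apply: pairing_le => //; first exact: bmeas_cst.
by move=> x xI; have := fk x xI; rewrite ler_norml => /andP[].
Qed.

(* The step function with value [f (i / N)] on [[(i - 1) / N, i / N)]. *)
Fixpoint step f (N n : nat) x : R :=
  if n is i.+1 then step f N i x + (f (i.+1%:R / N%:R) - f (i%:R / N%:R)) * tail_ind (i%:R / N%:R) x
  else f 0.

Lemma frac01 (N i : nat) : (0 < N)%N -> (i <= N)%N -> (i%:R / N%:R : R) \in `[0, 1].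
Proof.
move=> N0 iN; rewrite in01 divr_ge0//= ler_pdivrMr ?ltr0n// mul1r ler_nat//.
Qed.

Lemma bmeas_step f N n : bmeas (step f N n).
Proof.
elim: n => [|n IH] /=; first exact: bmeas_cst.
by apply: bmeasD => //; apply: bmeasZ; exact: bmeas_tail.
Qed.

Lemma step_approx f (N : nat) e : (0 < N)%N -> 0 <= e ->
  (forall x y, x \in `[0, 1] -> y \in `[0, 1] -> `|x - y| <= N%:R^-1 -> `|f x - f y| <= e) ->
  forall x, x \in `[0, 1] -> `|step f N N x - f x| <= e.
Proof.
move=> N0 e0 osc x xI; have N0' : 0 < N%:R :> R by rewrite ltr0n.
(* Invariant along the grid: as long as [n / N] has not passed [x], the partial step function takes
   the value of [f] at the last grid point; once it has passed, the later terms vanish at [x]. *)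
have inv n : (n <= N)%N -> (n%:R / N%:R <= x /\ step f N n x = f (n%:R / N%:R)) \/
    (x < n%:R / N%:R /\ `|step f N n x - f x| <= e).
  elim: n => [|n IH] nN; first by left; rewrite mul0r; move: xI; rewrite in01 => /andP[].
  have {IH} [[nx E]|[xn E]] := IH (ltnW nN).
    rewrite /= E /tail_ind nx mulr1 subrKC.
    have [xn|xn] := leP (n.+1%:R / N%:R) x; [by left|right; split => //].
    apply: osc => //; first exact: frac01.
    rewrite ger0_norm ?subr_ge0 ?(ltW xn)// -(natr1 n) mulrDl mul1r; lra.
  right; rewrite /= /tail_ind (leNgt (n%:R / N%:R)) xn mulr0 addr0; split => //.
  by apply: lt_trans xn _; rewrite ltr_pM2r ?invr_gt0// ltr_nat.
have [[Nx ->]|[_ //]] := inv N (leqnn N).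
have -> : x = N%:R / N%:R.
  apply/eqP; rewrite eq_le Nx andbT divff ?gt_eqF//.
  by move: xI; rewrite in01 => /andP[].
by rewrite subrr normr0.
Qed.

(** Summation by parts: against a step function a measure is seen only through its tails, weighted
    by the increments of [f]. This is how information on tails reaches other integrals. *)
Lemma pairing_step mu f N n : in_U mu -> (0 < N)%N -> (n <= N)%N ->
  pairing mu (step f N n) = f 0 * Fm mu 0 +
    \sum_(i < n) (f (i.+1%:R / N%:R) - f (i%:R / N%:R)) * Fm mu (i%:R / N%:R).
Proof.
move=> Um N0; elim: n => [|n IH] nN; first by rewrite big_ord0 addr0 pairing_cst.
rewrite big_ord_recr/= addrA -IH ?(ltnW nN)// pairingD//; last first.
- by apply: bmeasZ; exact: bmeas_tail.
- exact: bmeas_step.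
rewrite pairingZ//; last exact: bmeas_tail.
by rewrite -Fm_pairing//; apply: frac01 => //; exact: ltnW.
Qed.

Lemma pairing_step_approx mu f (N : nat) e : in_U mu -> bmeas f -> (0 < N)%N -> 0 <= e ->
  (forall x y, x \in `[0, 1] -> y \in `[0, 1] -> `|x - y| <= N%:R^-1 -> `|f x - f y| <= e) ->
  `|pairing mu (step f N N) - pairing mu f| <= e * Fm mu 0.
Proof.
move=> Um bf N0 e0 osc; rewrite -pairingB//; last exact: bmeas_step.
apply: pairing_norm_le => //; first by apply: bmeasB => //; exact: bmeas_step.
exact: step_approx.
Qed.

(** For nondecreasing [h] the weights of the tails are nonnegative, so the inequality between tails
    can be summed, and the slack gets multiplied by the total increase of [h], at most 1. Equal
    masses make the term in [h 0] cancel exactly; the Lipschitz bound pays for replacing [h] by a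
    step function. *)
Lemma pairing_mono mu nu h L k : in_U mu -> in_U nu -> 0 <= k -> 0 <= L ->
  Fm mu 0 = Fm nu 0 ->
  (forall r, r \in `[0, 1] -> Fm mu r <= Fm nu r + k) ->
  bmeas h -> (forall x, x \in `[0, 1] -> 0 <= h x <= 1) ->
  (forall x y, x \in `[0, 1] -> y \in `[0, 1] -> x <= y -> h x <= h y) ->
  (forall x y, x \in `[0, 1] -> y \in `[0, 1] -> `|h x - h y| <= L * `|x - y|) ->
  pairing mu h <= pairing nu h + k.
Proof.
move=> Um Un k0 L0 mass Fle bh h01 hmono hlip.
have M0 : 0 <= Fm nu 0 by apply: Fm_ge0 => //; exact: mem0I.
apply/ler_addgt0Pr => e e0.
(* Two step approximations, each with an error of [L / N] times the mass for [N] grid intervals,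
   have to fit into [e]. *)
pose B := 2 * L * Fm nu 0 / e.
have B0 : 0 <= B by rewrite /B divr_ge0 ?(ltW e0)// !mulr_ge0.
have [N NB] : exists N : nat, B < N.+1%:R.
  exists (Num.bound B); apply: lt_trans (archi_boundP B0) _; by rewrite ltr_nat.
have N0 : 0 < N.+1%:R :> R by rewrite ltr0n.
pose q := L / N.+1%:R; have q0 : 0 <= q by rewrite divr_ge0.
have osc x y : x \in `[0, 1] -> y \in `[0, 1] -> `|x - y| <= N.+1%:R^-1 -> `|h x - h y| <= q.
  by move=> xI yI xy; apply: le_trans (hlip _ _ xI yI) _; rewrite ler_wpM2l.
have qe : 2 * (q * Fm nu 0) <= e.
  move: NB; rewrite /B ltr_pdivrMr// => /ltW NB.
  have -> : 2 * (q * Fm nu 0) = 2 * L * Fm nu 0 / N.+1%:R by rewrite /q; move: (Fm nu 0) => F; field; rewrite gt_eqF.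
  by rewrite ler_pdivrMr// (mulrC e).
have a1 := pairing_step_approx mu h N.+1 q Um bh (ltn0Sn _) q0 osc.
have a2 := pairing_step_approx nu h N.+1 q Un bh (ltn0Sn _) q0 osc.
rewrite mass in a1.
have st : pairing mu (step h N.+1 N.+1) <= pairing nu (step h N.+1 N.+1) + k.
  rewrite !pairing_step// mass -addrA lerD2l.
  have tel : \sum_(i < N.+1) (h (i.+1%:R / N.+1%:R) - h (i%:R / N.+1%:R)) = h 1 - h 0.
    rewrite -(big_mkord xpredT (fun i => h (i.+1%:R / N.+1%:R) - h (i%:R / N.+1%:R))).
    by rewrite (telescope_sumr (fun i => h (i%:R / N.+1%:R)))// divff ?gt_eqF// mul0r.
  apply: (@le_trans _ _ (\sum_(i < N.+1) (h (i.+1%:R / N.+1%:R) - h (i%:R / N.+1%:R)) * (Fm nu (i%:R / N.+1%:R) + k))).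
    apply: ler_sum => i _; have iI : (i%:R / N.+1%:R : R) \in `[0, 1] by apply: frac01 => //; exact: ltnW.
    apply: ler_wpM2l; last exact: Fle.
    rewrite subr_ge0; apply: hmono => //; first by apply: frac01.
    by rewrite ler_wpM2r ?invr_ge0 ?(ltW N0)// ler_nat.
  under eq_bigr do rewrite mulrDr.
  rewrite big_split/= lerD2l -mulr_suml tel ler_piMl//.
  by have /andP[_ h1] := h01 1 mem1I; have /andP[h0 _] := h01 0 mem0I; lra.
move: a1 a2; rewrite !ler_norml => /andP[a1 _] /andP[_ a2]; lra.
Qed.

End Pairing.

(** * Monotonicity of the heat flow *)

Section Evolution.
Context {R : realType}.
Local Notation I := (@I01 R).
Implicit Types (mu nu : meas R) (f h : R -> R) (a b e k s t r x y M L j d : R).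

Lemma Gconv2E t mu r : (Gconv t mu).2 r = pairing mu (Gneum t r).
Proof. by []. Qed.

Lemma Gconv_lip t T a mu r r' : in_U mu -> 0 < a -> a <= t -> t <= T ->
  r \in `[0, 1] -> r' \in `[0, 1] ->
  `|(Gconv t mu).2 r - (Gconv t mu).2 r'| <= kernel_lip a T * Fm mu 0 * `|r - r'|.
Proof.
move=> Um a0 at' tT rI rI'; have t0 : 0 < t by exact: lt_le_trans at'.
have b1 := bmeas_Gneum t r t0; have b2 := bmeas_Gneum t r' t0.
rewrite !Gconv2E -pairingB// mulrAC; apply: pairing_norm_le => //; first exact: bmeasB.
by move=> y yI; exact: Gneum_lip.
Qed.

Lemma Gconv_bmeas t mu : in_U mu -> 0 < t -> bmeas (Gconv t mu).2.
Proof.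
move=> Um t0; apply: bmeas_within_continuous.
apply: (lipschitz_within_continuous _ (kernel_lip t t * Fm mu 0)).
  by apply: mulr_ge0; [exact: kernel_lip_ge0|apply: Fm_ge0 => //; exact: mem0I].
by move=> x y xI yI; exact: Gconv_lip.
Qed.

Lemma Gconv_ge0 t mu r : in_U mu -> 0 < t -> r \in `[0, 1] -> 0 <= (Gconv t mu).2 r.
Proof.
move=> Um t0 rI; rewrite Gconv2E addr_ge0//.
  by rewrite mulr_ge0 ?Gneum_ge0//; exact: Um.1.
by apply: Lint_ge0 => x xI; rewrite mulr_ge0 ?Gneum_ge0//; exact: in_U_ge0.
Qed.

Lemma Gconv_le t T mu r : in_U mu -> 0 < t -> t <= T -> r \in `[0, 1] ->
  `|(Gconv t mu).2 r| <= kernel_sup T / Num.sqrt t * Fm mu 0.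
Proof.
move=> Um t0 tT rI; rewrite Gconv2E; apply: pairing_norm_le => //; first exact: bmeas_Gneum.
by move=> y yI; rewrite ger0_norm ?Gneum_ge0//; exact: Gneum_le.
Qed.

Lemma in_U_Gconv t mu : in_U mu -> 0 < t -> in_U (Gconv t mu).
Proof.
move=> Um t0; split => //; apply: bmeas_Linf_pos; first exact: Gconv_bmeas.
by move=> x xI; exact: Gconv_ge0.
Qed.

(** Fubini moves the flow onto the test function. The atom is handled apart, [(0, mu.2)] being the
    density alone. *)
Lemma pairing_Gconv t mu h : in_U mu -> 0 < t -> bmeas h ->
  pairing (Gconv t mu) h = pairing mu (fun y => Lint I (fun x => h x * Gneum t x y)).
Proof.
move=> Um t0 bh; have bm := in_U_bmeas _ Um.
have bG y : bmeas (fun x => h x * Gneum t x y) by apply: bmeasM => //; exact: bmeas_Gneuml.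
rewrite [LHS]/pairing mul0r add0r.
have E : forall x, x \in `[0, 1] -> h x * (Gconv t mu).2 x =
    mu.1 * (h x * Gneum t x 0) + (h x * (Gconv t (0, mu.2)).2 x).
  by move=> x xI; rewrite !Gconv2E /pairing mul0r add0r mulrDr mulrCA.
rewrite (Lint_ext _ _ E) LintD; last first.
- by apply: bmeasM => //; apply: Gconv_bmeas => //; split => //; exact: Um.2.
- by apply: bmeasZ; exact: bG.
rewrite LintZ; last exact: bG.
rewrite /pairing; congr (_ + _).
have F := Lint_fubini (Gneum t) h mu.2 (kernel_sup t / Num.sqrt t) (measurable_Gneum t t0)
  (fun x y xI yI => Gneum_norm_le t x y t0 xI yI) bh bm.
have -> : Lint I (fun x => h x * (Gconv t (0, mu.2)).2 x) =
  Lint I (fun x => h x * Lint I (fun y => Gneum t x y * mu.2 y)).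
  by apply: Lint_ext => x _; rewrite Gconv2E /pairing mul0r add0r.
by rewrite F; apply: Lint_ext => y _; rewrite mulrC.
Qed.

Lemma Fm_Gconv t mu r : in_U mu -> 0 < t -> r \in `[0, 1] ->
  Fm (Gconv t mu) r = pairing mu (Gtail t r).
Proof.
move=> Um t0 rI; rewrite Fm_pairing//; last exact: in_U_Gconv.
by rewrite pairing_Gconv//; exact: bmeas_tail.
Qed.

Lemma Gtail0 t y : 0 < t -> Gtail t 0 y = 1.
Proof.
move=> t0; rewrite -(Gneum_massl t y t0); apply: Lint_ext => x.
by rewrite in01 /tail_ind => /andP[-> _]; rewrite mul1r.
Qed.

Lemma Gconv_mass t mu : in_U mu -> 0 < t -> Fm (Gconv t mu) 0 = Fm mu 0.
Proof.
move=> Um t0; rewrite Fm_Gconv ?mem0I// -[RHS]mul1r -pairing_cst//.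
by apply: pairing_ext => y _; exact: Gtail0.
Qed.

Lemma Gconv_Gconv s t mu r : in_U mu -> 0 < s -> 0 < t -> r \in `[0, 1] ->
  (Gconv s (Gconv t mu)).2 r = (Gconv (s + t) mu).2 r.
Proof.
move=> Um s0 t0 rI; rewrite [LHS]Gconv2E pairing_Gconv//; last exact: bmeas_Gneum.
by rewrite Gconv2E; apply: pairing_ext => y yI; exact: Gneum_CK.
Qed.

Lemma Fm_ext mu nu r : in_U mu -> in_U nu -> r \in `[0, 1] -> mu.1 = nu.1 ->
  (forall x, x \in `[0, 1] -> mu.2 x = nu.2 x) -> Fm mu r = Fm nu r.
Proof.
move=> Um Un rI e1 e2; rewrite !Fm_pairing// /pairing e1; congr (_ + _).
by apply: Lint_ext => x xI; rewrite e2.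
Qed.

Lemma Fm_Gconv_Gconv s t mu r : in_U mu -> 0 < s -> 0 < t -> r \in `[0, 1] ->
  Fm (Gconv s (Gconv t mu)) r = Fm (Gconv (s + t) mu) r.
Proof.
move=> Um s0 t0 rI; apply: Fm_ext => //.
- by do 2 apply: in_U_Gconv => //.
- by apply: in_U_Gconv => //; exact: addr_gt0.
- by move=> x xI; exact: Gconv_Gconv.
Qed.

(** The slack lets the same monotonicity lemmas carry both the order of the barriers ([k = 0]) and
    the gap between them ([k = j * d]). *)
Definition Fle k mu nu := forall r, r \in `[0, 1] -> Fm mu r <= Fm nu r + k.

Lemma Fle_refl mu : Fle 0 mu mu.
Proof. by move=> r _; rewrite addr0. Qed.

Lemma Fle_trans k k' mu1 mu2 mu3 : Fle k mu1 mu2 -> Fle k' mu2 mu3 -> Fle (k + k') mu1 mu3.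
Proof. by move=> h1 h2 r rI; have := h1 r rI; have := h2 r rI; lra. Qed.

Lemma Fle0_trans mu1 mu2 mu3 : Fle 0 mu1 mu2 -> Fle 0 mu2 mu3 -> Fle 0 mu1 mu3.
Proof. by move=> h1 h2; have := Fle_trans _ _ _ _ _ h1 h2; rewrite addr0. Qed.

Lemma Fle_weak k k' mu nu : k <= k' -> Fle k mu nu -> Fle k' mu nu.
Proof. by move=> kk h r rI; apply: le_trans (h r rI) _; rewrite lerD2l. Qed.

(** The mass is recorded because comparing two flows uses equal masses; both the flow and the cut
    preserve it. *)
Definition valid M mu := in_U mu /\ Fm mu 0 = M.

Lemma valid_Gconv M t mu : 0 < t -> valid M mu -> valid M (Gconv t mu).
Proof. by move=> t0 [Um mM]; split; [exact: in_U_Gconv|rewrite Gconv_mass]. Qed.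

Lemma Fle_Gconv M k t mu nu : 0 < t -> 0 <= k -> valid M mu -> valid M nu ->
  Fle k mu nu -> Fle k (Gconv t mu) (Gconv t nu).
Proof.
move=> t0 k0 [Um mM] [Un nM] le r rI; rewrite !Fm_Gconv//.
have mass : Fm mu 0 = Fm nu 0 by rewrite mM nM.
apply: (pairing_mono mu nu _ _ _ Um Un k0 (kernel_lip_ge0 _ _ t0 t0) mass le).
- exact: bmeas_Gtail.
- by move=> x _; rewrite (Gtail_ge0 _ _ _ t0) (Gtail_le1 _ _ _ t0).
- by move=> x y xI yI; exact: Gtail_mono.
- by move=> x y xI yI; exact: Gtail_lip.
Qed.

Lemma Fle_Gconv_Gconv s t mu : in_U mu -> 0 < s -> 0 < t ->
  Fle 0 (Gconv (s + t) mu) (Gconv s (Gconv t mu)) /\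
  Fle 0 (Gconv s (Gconv t mu)) (Gconv (s + t) mu).
Proof.
by move=> Um s0 t0; split => r rI; rewrite Fm_Gconv_Gconv ?addr0.
Qed.

(** The bound [B] on the density turns the mean convergence of [Gtail] into convergence of tails,
    uniformly in [r]. An atom at 0 would break the uniformity near [r = 0]. *)
Lemma Gconv_near_id e : 0 < e -> exists2 d, 0 < d & forall t mu B, 0 < t -> t <= d ->
  in_U mu -> mu.1 = 0 -> 0 <= B -> (forall x, x \in `[0, 1] -> mu.2 x <= B) ->
  forall r, r \in `[0, 1] -> `|Fm (Gconv t mu) r - Fm mu r| <= B * e.
Proof.
move=> e0; have [d d0 hd] := Gtail_limit e e0; exists d => // t mu B t0 td Um m0 B0 hB r rI.
have bm := in_U_bmeas _ Um; have bG := bmeas_Gtail t r t0; have bt := bmeas_tail r.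
have bD : bmeas (fun y => Gtail t r y - tail_ind r y) by exact: bmeasB.
rewrite Fm_Gconv// Fm_pairing// -pairingB// /pairing m0 mul0r add0r.
apply: le_trans (Lint_norm _ _) _; first exact: bmeasM.
apply: (@le_trans _ _ (Lint I (fun y => B * `|Gtail t r y - tail_ind r y|))).
  apply: Lint_le; [by apply: bmeas_norm; exact: bmeasM|by apply: bmeasZ; exact: bmeas_norm|].
  move=> y yI; rewrite normrM mulrC ler_wpM2r// ger0_norm ?hB//; exact: in_U_ge0.
by rewrite LintZ; [apply: ler_wpM2l => //; exact: hd|exact: bmeas_norm].
Qed.

(** * Tail integrals of a density and the cutting point [Rdelta] *)

Lemma Lint_tail_ind r : r \in `[0, 1] -> Lint I (tail_ind r) = 1 - r.
Proof.
rewrite in01 => /andP[r0 r1].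
have -> : Lint I (tail_ind r) = Lint (`[r, 1] : set R) (fun=> 1).
  by rewrite Lint_tail//; apply: Lint_ext => x _; rewrite mulr1.
rewrite /Lint Rintegral_cst//.
rewrite mul1r -[X in fine X]/(@lebesgue_measure R _) lebesgue_measure_itv/= lte_fin; move: r1; rewrite le_eqVlt => /predU1P[->|r1].
  by rewrite ltxx subrr.
by rewrite r1.
Qed.

Definition tail_integral (f : R -> R) r : R := Lint I (fun x => tail_ind r x * f x).

Lemma FmE mu r : r \in `[0, 1] -> Fm mu r = (if r == 0 then mu.1 else 0) + tail_integral mu.2 r.
Proof. by rewrite in01 => /andP[r0 _]; rewrite /Fm Lint_tail. Qed.

Lemma bmeas_tail_integral f r : bmeas f -> bmeas (fun x => tail_ind r x * f x).
Proof. by move=> bf; apply: bmeasM => //; exact: bmeas_tail. Qed.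

Lemma tail_integral_mono f r r' : bmeas f -> (forall x, x \in `[0, 1] -> 0 <= f x) ->
  r <= r' -> tail_integral f r' <= tail_integral f r.
Proof.
move=> bf f0 rr; apply: Lint_le; [exact: bmeas_tail_integral|exact: bmeas_tail_integral|] => x xI.
apply: ler_wpM2r; first exact: f0.
rewrite /tail_ind; case: (leP r' x) => h; last by rewrite ler0n.
by rewrite (le_trans rr h).
Qed.

Lemma tail_integral_lip f B r r' : bmeas f -> 0 <= B -> (forall x, x \in `[0, 1] -> `|f x| <= B) ->
  r \in `[0, 1] -> r' \in `[0, 1] -> `|tail_integral f r - tail_integral f r'| <= B * `|r - r'|.
Proof.
move=> bf B0 fB; wlog rr : r r' / r <= r'.
  move=> W rI rI'; have [rr|rr] := leP r r'; first exact: W.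
  by rewrite distrC (distrC r); apply: W => //; exact: ltW.
move=> rI rI'; rewrite /tail_integral -LintB; [|exact: bmeas_tail_integral|exact: bmeas_tail_integral].
apply: le_trans (Lint_norm _ _) _; first by apply: bmeasB; exact: bmeas_tail_integral.
apply: (@le_trans _ _ (Lint I (fun x => B * (tail_ind r x - tail_ind r' x)))).
  apply: Lint_le.
  - by apply: bmeas_norm; apply: bmeasB; exact: bmeas_tail_integral.
  - by apply: bmeasZ; apply: bmeasB; exact: bmeas_tail.
  move=> x xI; rewrite -mulrBl normrM mulrC.
  have i0 : 0 <= tail_ind r x - tail_ind r' x.
    rewrite subr_ge0 /tail_ind; case: (leP r' x) => h; last by rewrite ler0n.
    by rewrite (le_trans rr h).
  by rewrite [`|tail_ind r x - _|]ger0_norm// ler_wpM2r// fB.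
rewrite LintZ; last by apply: bmeasB; exact: bmeas_tail.
rewrite LintB ?Lint_tail_ind//; [|exact: bmeas_tail|exact: bmeas_tail].
apply: ler_wpM2l => //; rewrite distrC; apply: le_trans (ler_norm _); lra.
Qed.

Lemma tail_integral1 f : tail_integral f 1 = 0.
Proof.
by rewrite /tail_integral -Lint_tail// /Lint set_itv1 Rintegral_set1.
Qed.

(** The tail integral runs continuously from above [j * d] down to 0, so the level is attained, and
    continuity puts the infimum in the level set. The atom does not interfere: at [r = 0] the
    density alone already exceeds the level. *)
Lemma Rdelta_spec j d mu : in_U mu -> 0 < j * d -> j * d < tail_integral mu.2 0 ->
  [/\ 0 < Rdelta j d mu, Rdelta j d mu \in `[0, 1] & tail_integral mu.2 (Rdelta j d mu) = j * d].
Proof.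
move=> Um a0 aT; set a := j * d in a0 aT *; have bm := in_U_bmeas _ Um.
have [_ [_ [B hB]]] := Um.2.
have B0 : 0 <= B by apply: le_trans (hB 0 mem0I); apply: in_U_ge0 => //; exact: mem0I.
have fB x : x \in `[0, 1] -> `|mu.2 x| <= B.
  by move=> xI; rewrite ger0_norm ?hB//; exact: in_U_ge0.
pose S := [set r | r \in `[0, 1] /\ Fm mu r = a].
have lip := tail_integral_lip mu.2 B _ _ bm B0 fB.
have ST r : S r -> tail_integral mu.2 r = a.
  move=> [rI]; rewrite FmE//; case: eqP => [->|_]; last by rewrite add0r.
  by move=> E; have c0 := Um.1; lra.
have cT : {within `[0, 1], continuous (tail_integral mu.2)}.
  exact: (lipschitz_within_continuous _ B).
have [c cI Tc] : exists2 c, c \in `[0, 1] & tail_integral mu.2 c = a.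
  apply: IVT => //; rewrite tail_integral1.
  by rewrite ge_min le_max (ltW a0) (ltW aT) orbT.
have Sc : S c.
  split => //; rewrite FmE//; case: eqP => [c0|_]; last by rewrite add0r.
  by rewrite c0 in Tc; lra.
have lb : has_lbound S by exists 0 => r [+ _]; rewrite in01 => /andP[].
have hS : has_inf S by split => //; exists c.
rewrite /Rdelta -/a -/S.
have iI : inf S \in `[0, 1].
  rewrite in01 lb_le_inf//=; last by move=> r [+ _]; rewrite in01 => /andP[].
    by apply: le_trans (ge_inf lb Sc) _; move: cI; rewrite in01 => /andP[].
  by exists c.
have Ti : tail_integral mu.2 (inf S) = a.
  apply/eqP; rewrite -subr_eq0 -normr_le0; apply/ler_addgt0Pr => e e0; rewrite add0r.
  have B1 : 0 < B + 1 by rewrite ltr_wpDl.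
  have [r Sr ri] := inf_adherent (divr_gt0 e0 B1) hS.
  rewrite -(ST r Sr); apply: le_trans (lip _ _ iI Sr.1) _.
  rewrite distrC ger0_norm; last by rewrite subr_ge0; exact: ge_inf.
  apply: (@le_trans _ _ (B * (e / (B + 1)))); first by apply: ler_wpM2l => //; lra.
  by rewrite mulrCA ler_piMr ?(ltW e0)// ler_pdivrMr// mul1r lerDl.
split => //; rewrite lt_neqAle; move: (iI); rewrite in01 => /andP[-> _]; rewrite andbT.
by apply/eqP => i0; rewrite -i0 in Ti; lra.
Qed.

End Evolution.

(** * The cut and the elementary steps *)

Section Cut.
Context {R : realType}.
Local Notation I := (@I01 R).
Implicit Types (mu nu : meas R) (f h : R -> R) (a b e k s t r x y M L j d : R).

(** Selects what the cut removes. [Kdelta] keeps the point [Rdelta] itself, hence the strict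
    inequality; the integral does not see the difference. *)
Definition strict_ind r x : R := (r < x)%R%:R.

Lemma bmeas_strict r : bmeas (strict_ind r).
Proof.
have -> : strict_ind r = \1_(`]r, +oo[%classic).
  by apply/funext => x; rewrite /strict_ind indicE mem_setE in_itv/= andbT.
by apply: bmeas_indic; exact: measurable_itv.
Qed.

Lemma Lint_strict f r : bmeas f -> r \in `[0, 1] ->
  Lint I (fun x => strict_ind r x * f x) = tail_integral f r.
Proof.
move=> bf; rewrite in01 => /andP[r0 r1]; rewrite /tail_integral -Lint_tail//.
have fI := bmeas_integrable _ bf.
rewrite /Lint -(Rintegral_itv_obnd_cbnd); last first.
  apply: integrableS fI; [exact: measurable_I01|exact: measurable_itv|].
  by move=> x; rewrite /I01/= !in_itv/= => /andP[h1 ->]; rewrite (le_trans r0 (ltW h1)).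
rewrite [LHS]Rintegral_mkcond [RHS]Rintegral_mkcond; congr (Rintegral _ _ _).
apply/funext => x; rewrite /patch /strict_ind !mem_setE !in_itv/=.
case: (ltP r x) => rx /=; last by rewrite mul0r; case: ifP.
by rewrite mul1r (ltW (le_lt_trans r0 rx)).
Qed.

(** The states on which the cut acts by the max formula. A flow leads into them from any [valid]
    state, while a cut creates an atom; so upper iterates, which end with a flow, stay [valid0], and
    lower ones are only [valid]. *)
Definition valid0 M mu := valid M mu /\ mu.1 = 0.

Lemma valid0_tail_integral M mu : valid0 M mu -> tail_integral mu.2 0 = M.
Proof. by move=> [[Um mM] m0]; rewrite -mM FmE ?mem0I// eqxx m0 add0r. Qed.

Lemma Kdelta2E j d mu x : (Kdelta j d mu).2 x = mu.2 x - strict_ind (Rdelta j d mu) x * mu.2 x.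
Proof.
rewrite /Kdelta/= /strict_ind ltNge; case: (x <= _); first by rewrite mul0r subr0.
by rewrite mul1r subrr.
Qed.

Lemma bmeas_Kdelta j d mu : in_U mu -> bmeas (Kdelta j d mu).2.
Proof.
move=> /in_U_bmeas bm; apply: (bmeas_ext (fun x => mu.2 x - strict_ind (Rdelta j d mu) x * mu.2 x)).
  by move=> x _; rewrite Kdelta2E.
by apply: bmeasB => //; apply: bmeasM => //; exact: bmeas_strict.
Qed.

Lemma in_U_Kdelta j d mu : 0 <= j * d -> in_U mu -> in_U (Kdelta j d mu).
Proof.
move=> a0 Um; split; first by rewrite addr_ge0//; exact: Um.1.
apply: bmeas_Linf_pos; first exact: bmeas_Kdelta.
by move=> x xI; rewrite /Kdelta/=; case: ifP => // _; exact: in_U_ge0.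
Qed.

Lemma pairing_Kdelta j d mu h : in_U mu -> bmeas h ->
  pairing (Kdelta j d mu) h = pairing mu h + j * d * h 0
    - Lint I (fun x => h x * (strict_ind (Rdelta j d mu) x * mu.2 x)).
Proof.
move=> Um bh; have bm := in_U_bmeas _ Um.
have bs : bmeas (fun x => strict_ind (Rdelta j d mu) x * mu.2 x).
  by apply: bmeasM => //; exact: bmeas_strict.
rewrite /pairing.
have -> : Lint I (fun x => h x * (Kdelta j d mu).2 x) =
  Lint I (fun x => h x * mu.2 x) - Lint I (fun x => h x * (strict_ind (Rdelta j d mu) x * mu.2 x)).
  rewrite -LintB; [|exact: bmeasM|exact: bmeasM].
  by apply: Lint_ext => x _; rewrite Kdelta2E mulrBr.
by rewrite /Kdelta/= mulrDl; ring.
Qed.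

Lemma tail_integral_Kdelta M j d mu r : valid0 M mu -> 0 < j * d -> j * d < M -> r \in `[0, 1] ->
  tail_integral (Kdelta j d mu).2 r = Num.max (tail_integral mu.2 r - j * d) 0.
Proof.
move=> vm a0 aM rI; have Um := vm.1.1; have bm := in_U_bmeas _ Um.
have aT : j * d < tail_integral mu.2 0 by rewrite (valid0_tail_integral _ _ vm).
have [R0 RI TR] := Rdelta_spec j d mu Um a0 aT.
have f0 x : x \in `[0, 1] -> 0 <= mu.2 x by move=> xI; exact: in_U_ge0.
have E : forall x, x \in `[0, 1] -> tail_ind r x * (Kdelta j d mu).2 x =
   tail_ind r x * mu.2 x - tail_ind r x * (strict_ind (Rdelta j d mu) x * mu.2 x).
  by move=> x _; rewrite Kdelta2E mulrBr.
have bs : bmeas (fun x => strict_ind (Rdelta j d mu) x * mu.2 x).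
  by apply: bmeasM => //; exact: bmeas_strict.
rewrite /tail_integral (Lint_ext _ _ E) LintB; [|exact: bmeas_tail_integral|exact: bmeas_tail_integral].
rewrite -/(tail_integral mu.2 r).
have [rR|Rr] := leP r (Rdelta j d mu).
  have -> : Lint I (fun x => tail_ind r x * (strict_ind (Rdelta j d mu) x * mu.2 x)) = j * d.
    rewrite -TR -Lint_strict//; apply: Lint_ext => x _.
    rewrite /strict_ind /tail_ind; case: (ltP (Rdelta j d mu) x) => h; last by rewrite !mul0r mulr0.
    by rewrite (le_trans rR (ltW h)) mul1r.
  by apply/esym/max_idPl; rewrite subr_ge0 -TR; exact: tail_integral_mono.
have -> : Lint I (fun x => tail_ind r x * (strict_ind (Rdelta j d mu) x * mu.2 x)) = tail_integral mu.2 r.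
  apply: Lint_ext => x _; rewrite /strict_ind /tail_ind; case: (leP r x) => h; last by rewrite !mul0r.
  by rewrite (lt_le_trans Rr h) !mul1r.
rewrite subrr; apply/esym/max_idPr; rewrite subr_le0 -TR; apply: tail_integral_mono => //; exact: ltW.
Qed.

Lemma Fm_Kdelta M j d mu r : valid0 M mu -> 0 < j * d -> j * d < M -> r \in `[0, 1] -> r != 0 ->
  Fm (Kdelta j d mu) r = Num.max (Fm mu r - j * d) 0.
Proof.
move=> vm a0 aM rI r0; rewrite !FmE// (negbTE r0) !add0r.
exact: tail_integral_Kdelta vm a0 aM rI.
Qed.

Lemma Kdelta_mass M j d mu : valid0 M mu -> 0 < j * d -> j * d < M -> Fm (Kdelta j d mu) 0 = M.
Proof.
move=> vm a0 aM; rewrite FmE ?mem0I// eqxx (tail_integral_Kdelta M)// ?mem0I// (valid0_tail_integral _ _ vm).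
rewrite /= vm.2 addr0; have /max_idPl -> : 0 <= M - j * d by rewrite subr_ge0 ltW.
by rewrite addrC subrK.
Qed.

Local Opaque Gconv Kdelta Fm.

Lemma valid_Kdelta M j d mu : valid0 M mu -> 0 < j * d -> j * d < M -> valid M (Kdelta j d mu).
Proof.
move=> vm a0 aM; split; last exact: Kdelta_mass.
by apply: in_U_Kdelta; [exact: ltW|exact: vm.1.1].
Qed.

Lemma valid0_Gconv M t mu : 0 < t -> valid M mu -> valid0 M (Gconv t mu).
Proof. by move=> t0 vm; split => //; exact: valid_Gconv. Qed.

(** At [r = 0] the reinserted atom makes the max formula fail, but there both sides equal the total
    mass. *)
Lemma Fle_cases k mu nu : 0 <= k -> Fm mu 0 = Fm nu 0 ->
  (forall r, r \in `[0, 1] -> r != 0 -> Fm mu r <= Fm nu r + k) -> Fle k mu nu.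
Proof.
move=> k0 mass h r rI; have [->|r0] := eqVneq r 0; last exact: h.
by rewrite mass lerDl.
Qed.

Lemma Fle_Kdelta M k j d mu nu : 0 <= k -> 0 < j * d -> j * d < M ->
  valid0 M mu -> valid0 M nu -> Fle k mu nu -> Fle k (Kdelta j d mu) (Kdelta j d nu).
Proof.
move=> k0 a0 aM vm vn le; apply: Fle_cases => //; first by rewrite !(Kdelta_mass M).
move=> r rI r0; rewrite !(Fm_Kdelta M)//; have := le r rI.
by rewrite /Num.max; case: ifP => h1; case: ifP => h2; move: h1 h2; rewrite ?ltNge; lra.
Qed.

Lemma Fle_Kdelta_id M j d mu : 0 < j * d -> j * d < M -> valid0 M mu ->
  Fle 0 (Kdelta j d mu) mu /\ Fle (j * d) mu (Kdelta j d mu).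
Proof.
move=> a0 aM vm; have mass : Fm (Kdelta j d mu) 0 = Fm mu 0.
  by rewrite (Kdelta_mass M)//; case: vm => -[_ ->].
split; apply: Fle_cases => //; [|exact: ltW|].
  move=> r rI r0; rewrite addr0 (Fm_Kdelta M)// ge_max Fm_ge0//; last exact: vm.1.1.
  by rewrite andbT lerBlDr lerDl ltW.
by move=> r rI r0; rewrite (Fm_Kdelta M)// -lerBlDr le_max lexx.
Qed.

Lemma Fle_Kdelta_split M j s t mu : 0 < j -> 0 < s -> 0 < t -> j * (s + t) < M -> valid0 M mu ->
  Fle (j * s) (Kdelta j t mu) (Kdelta j (s + t) mu).
Proof.
move=> j0 s0 t0 stM vm.
have a1 : 0 < j * t by rewrite mulr_gt0.
have a2 : 0 < j * s by rewrite mulr_gt0.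
have E : j * (s + t) = j * s + j * t by rewrite mulrDr.
have tM : j * t < M by lra.
have st0 : 0 < j * (s + t) by lra.
apply: Fle_cases; [exact: ltW|by rewrite !(Kdelta_mass M)|].
move=> r rI r0; rewrite !(Fm_Kdelta M)// E.
by rewrite /Num.max; case: ifP => h1; case: ifP => h2; move: h1 h2; rewrite ?ltNge; lra.
Qed.

(** * One step of the barriers: [stepP] for the upper one, [stepQ] for the lower one *)

Definition stepP j d mu := Gconv d (Kdelta j d mu).
Definition stepQ j d mu := Kdelta j d (Gconv d mu).

Lemma valid0_stepP M j d mu : 0 < j -> 0 < d -> j * d < M -> valid0 M mu -> valid0 M (stepP j d mu).
Proof. by move=> j0 d0 dM vm; apply: valid0_Gconv => //; apply: valid_Kdelta => //; exact: mulr_gt0. Qed.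

Lemma valid_stepQ M j d mu : 0 < j -> 0 < d -> j * d < M -> valid M mu -> valid M (stepQ j d mu).
Proof.
by move=> j0 d0 dM vm; apply: valid_Kdelta; [exact: valid0_Gconv|exact: mulr_gt0|].
Qed.

Lemma Fle_stepP M k j d mu nu : 0 < j -> 0 < d -> j * d < M -> 0 <= k ->
  valid0 M mu -> valid0 M nu -> Fle k mu nu -> Fle k (stepP j d mu) (stepP j d nu).
Proof.
move=> j0 d0 dM k0 vm vn le; have a0 : 0 < j * d by exact: mulr_gt0.
apply: (Fle_Gconv M) => //; [exact: valid_Kdelta|exact: valid_Kdelta|].
exact: (Fle_Kdelta M).
Qed.

Lemma Fle_stepQ M k j d mu nu : 0 < j -> 0 < d -> j * d < M -> 0 <= k ->
  valid M mu -> valid M nu -> Fle k mu nu -> Fle k (stepQ j d mu) (stepQ j d nu).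
Proof.
move=> j0 d0 dM k0 vm vn le; have a0 : 0 < j * d by exact: mulr_gt0.
apply: (Fle_Kdelta M) => //; [exact: valid0_Gconv|exact: valid0_Gconv|].
exact: (Fle_Gconv M).
Qed.

(** Cutting before the flow lowers tails by at most [j * d], and the flow does not enlarge this
    deficit; cutting after the flow subtracts the full [j * d], as far as positivity allows. *)
Lemma Fle_stepQ_stepP M j d mu : 0 < j -> 0 < d -> j * d < M -> valid0 M mu ->
  Fle 0 (stepQ j d mu) (stepP j d mu).
Proof.
move=> j0 d0 dM vm; have a0 : 0 < j * d by exact: mulr_gt0.
have vG : valid0 M (Gconv d mu) by apply: valid0_Gconv => //; exact: vm.1.
have vK : valid M (Kdelta j d mu) by exact: valid_Kdelta.
have vP := valid0_stepP M j d mu j0 d0 dM vm.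
apply: Fle_cases; [exact: lexx|by rewrite (Kdelta_mass M _ _ _ vG a0 dM) vP.1.2|].
move=> r rI r0; rewrite addr0 (Fm_Kdelta M)// ge_max Fm_ge0 ?andbT//; last exact: vP.1.1.
rewrite lerBlDr; apply: (Fle_Gconv M) => //; [exact: ltW|exact: vm.1|].
by have [] := Fle_Kdelta_id M j d mu a0 dM vm.
Qed.

(** The intermediate cut costs at most [j * t], a deficit not enlarged by the second flow, and the
    last cut [j * s]; a single cut takes the whole [j * (s + t)] at the end. *)
Lemma Fle_stepQ_split M j s t mu : 0 < j -> 0 < s -> 0 < t -> j * (s + t) < M -> valid M mu ->
  Fle 0 (stepQ j (s + t) mu) (stepQ j s (stepQ j t mu)).
Proof.
move=> j0 s0 t0 stM vm; have st0 : 0 < s + t by exact: addr_gt0.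
have a1 : 0 < j * s by exact: mulr_gt0.
have a2 : 0 < j * t by exact: mulr_gt0.
have E : j * (s + t) = j * s + j * t by rewrite mulrDr.
have sM : j * s < M by lra.
have tM : j * t < M by lra.
have aE : 0 < j * (s + t) by lra.
have vGt : valid0 M (Gconv t mu) by exact: valid0_Gconv.
have vGst : valid0 M (Gconv (s + t) mu) by exact: valid0_Gconv.
have vQt := valid_stepQ M j t mu j0 t0 tM vm.
have vQ := valid_stepQ M j s _ j0 s0 sM vQt.
have vGQ : valid0 M (Gconv s (stepQ j t mu)) by exact: valid0_Gconv.
apply: Fle_cases; [exact: lexx|by rewrite vQ.2 (valid_stepQ M j _ mu j0 st0 stM vm).2|].
move=> r rI r0; rewrite addr0 (Fm_Kdelta M)// ge_max Fm_ge0 ?andbT//; last exact: vQ.1.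
rewrite (Fm_Kdelta M)// le_max; apply/orP; left.
have [h1 _] := Fle_Gconv_Gconv s t mu vm.1 s0 t0.
have h2 : Fle (j * t) (Gconv s (Gconv t mu)) (Gconv s (stepQ j t mu)).
  apply: (Fle_Gconv M) => //; [exact: ltW|exact: vGt.1|].
  by have [] := Fle_Kdelta_id M j t _ a2 tM vGt.
have h := Fle_trans _ _ _ _ _ h1 h2 r rI; rewrite add0r in h.
by rewrite E lerBlDr addrA subrK.
Qed.

(** Both sides end with the flow for time [s], so it is enough to compare before it. There the early
    cut by [j * (s + t)] is below the cut by [j * t] by at most [j * s], which the second cut takes
    back. *)
Lemma Fle_stepP_split M j s t mu : 0 < j -> 0 < s -> 0 < t -> j * (s + t) < M -> valid0 M mu ->
  Fle 0 (stepP j s (stepP j t mu)) (stepP j (s + t) mu).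
Proof.
move=> j0 s0 t0 stM vm; have st0 : 0 < s + t by exact: addr_gt0.
have a1 : 0 < j * s by exact: mulr_gt0.
have a2 : 0 < j * t by exact: mulr_gt0.
have E : j * (s + t) = j * s + j * t by rewrite mulrDr.
have sM : j * s < M by lra.
have tM : j * t < M by lra.
have aE : 0 < j * (s + t) by lra.
have vPt := valid0_stepP M j t mu j0 t0 tM vm.
have vKt : valid M (Kdelta j t mu) by exact: valid_Kdelta.
have vW : valid M (Kdelta j (s + t) mu) by exact: valid_Kdelta.
have vGW : valid0 M (Gconv t (Kdelta j (s + t) mu)) by exact: valid0_Gconv.
have [_ h1] := Fle_Gconv_Gconv s t (Kdelta j (s + t) mu) vW.1 s0 t0.
apply: Fle0_trans h1; apply: (Fle_Gconv M) => //; [exact: valid_Kdelta|exact: vGW.1|].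
apply: Fle_cases; [exact: lexx|by rewrite (Kdelta_mass M _ _ _ vPt a1 sM) vGW.1.2|].
move=> r rI r0; rewrite addr0 (Fm_Kdelta M)// ge_max Fm_ge0 ?andbT//; last exact: vGW.1.1.
rewrite lerBlDr; apply: (Fle_Gconv M) => //; first exact: ltW.
exact: (Fle_Kdelta_split M).
Qed.

End Cut.

(** * Comparison of the barriers *)

Section Barriers.
Context {R : realType}.
Local Notation I := (@I01 R).
Implicit Types (mu nu : meas R) (f h u : R -> R) (a b e k s t r x y M L j d T : R).

Local Opaque Gconv Kdelta Fm stepP stepQ.

Lemma valid0_iterP M j d mu n : 0 < j -> 0 < d -> j * d < M -> valid0 M mu ->
  valid0 M (iter n (stepP j d) mu).
Proof. by move=> j0 d0 dM vm; elim: n => [//|n IH]; rewrite iterS; exact: valid0_stepP. Qed.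

Lemma valid_iterQ M j d mu n : 0 < j -> 0 < d -> j * d < M -> valid M mu ->
  valid M (iter n (stepQ j d) mu).
Proof. by move=> j0 d0 dM vm; elim: n => [//|n IH]; rewrite iterS; exact: valid_stepQ. Qed.

Lemma Fle_iterQ M k j d mu nu n : 0 < j -> 0 < d -> j * d < M -> 0 <= k ->
  valid M mu -> valid M nu -> Fle k mu nu ->
  Fle k (iter n (stepQ j d) mu) (iter n (stepQ j d) nu).
Proof.
move=> j0 d0 dM k0 vm vn le; elim: n => [//|n IH]; rewrite !iterS.
by apply: (Fle_stepQ M) => //; exact: valid_iterQ.
Qed.

Lemma Fle_iterQ_iterP M j d mu n : 0 < j -> 0 < d -> j * d < M -> valid0 M mu ->
  Fle 0 (iter n (stepQ j d) mu) (iter n (stepP j d) mu).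
Proof.
move=> j0 d0 dM vm; elim: n => [|n IH]; first exact: Fle_refl.
have vP := valid0_iterP M j d mu n j0 d0 dM vm.
have vQ := valid_iterQ M j d mu n j0 d0 dM vm.1.
rewrite !iterS; apply: Fle0_trans (Fle_stepQ_stepP M _ _ _ j0 d0 dM vP).
exact: (Fle_stepQ M _ _ _ _ _ j0 d0 dM (lexx 0) vQ vP.1 IH).
Qed.

Lemma Kdelta_iterP j d mu n :
  Kdelta j d (iter n (stepP j d) mu) = iter n (stepQ j d) (Kdelta j d mu).
Proof. by elim: n => [//|n IH]; rewrite !iterS -IH. Qed.

(** One extra cut of the upper iterate costs [j * d] and turns it into the lower iteration started
    from the cut datum, which lies below the one started from [mu]. Hence no factor [n]. *)
Lemma Fle_iterP_iterQ M j d mu n : 0 < j -> 0 < d -> j * d < M -> valid0 M mu ->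
  Fle (j * d) (iter n (stepP j d) mu) (iter n (stepQ j d) mu).
Proof.
move=> j0 d0 dM vm; have a0 : 0 < j * d by exact: mulr_gt0.
have vP := valid0_iterP M j d mu n j0 d0 dM vm.
have [_ h1] := Fle_Kdelta_id M j d _ a0 dM vP; rewrite Kdelta_iterP in h1.
have [h2 _] := Fle_Kdelta_id M j d _ a0 dM vm.
have vK := valid_Kdelta M j d mu vm a0 dM.
have h3 := Fle_iterQ M 0 j d _ _ n j0 d0 dM (lexx 0) vK vm.1 h2.
by have := Fle_trans _ _ _ _ _ h1 h3; rewrite addr0.
Qed.

Lemma lt_mulS j d (m : nat) M : 0 < j -> 0 < d -> j * (m.+1%:R * d) < M ->
  j * d < M /\ ((0 < m)%N -> j * (m%:R * d) < M).
Proof.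
move=> j0 d0 mM; split.
  apply: le_lt_trans mM; apply: ler_wpM2l; first exact: ltW.
  by rewrite ler_peMl ?(ltW d0)// ler1n.
move=> _; apply: le_lt_trans mM; apply: ler_wpM2l; first exact: ltW.
by apply: ler_wpM2r; [exact: ltW|rewrite ler_nat].
Qed.

Lemma Fle_stepQ_iter M j d mu m : 0 < j -> 0 < d -> j * (m.+1%:R * d) < M -> valid M mu ->
  Fle 0 (stepQ j (m.+1%:R * d) mu) (iter m.+1 (stepQ j d) mu).
Proof.
move=> j0 d0; elim: m => [|m IH] mM vm; first by rewrite mul1r; exact: Fle_refl.
have [dM mM'] := lt_mulS _ _ _ _ j0 d0 mM; have {}mM' := mM' (ltn0Sn _).
have m0 : 0 < m.+1%:R * d by rewrite mulr_gt0.
have E : m.+2%:R * d = d + m.+1%:R * d by rewrite -(natr1 m.+1) mulrDl mul1r addrC.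
rewrite E in mM *; rewrite iterS.
apply: Fle0_trans (Fle_stepQ_split M j d (m.+1%:R * d) mu j0 d0 m0 mM vm) _.
apply: (Fle_stepQ M) => //.
- exact: valid_stepQ.
- exact: valid_iterQ.
- exact: IH.
Qed.

Lemma Fle_iter_stepP M j d mu m : 0 < j -> 0 < d -> j * (m.+1%:R * d) < M -> valid0 M mu ->
  Fle 0 (iter m.+1 (stepP j d) mu) (stepP j (m.+1%:R * d) mu).
Proof.
move=> j0 d0; elim: m => [|m IH] mM vm; first by rewrite mul1r; exact: Fle_refl.
have [dM mM'] := lt_mulS _ _ _ _ j0 d0 mM; have {}mM' := mM' (ltn0Sn _).
have m0 : 0 < m.+1%:R * d by rewrite mulr_gt0.
have E : m.+2%:R * d = d + m.+1%:R * d by rewrite -(natr1 m.+1) mulrDl mul1r addrC.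
rewrite E in mM *; rewrite iterS.
apply: Fle0_trans (Fle_stepP_split M j d (m.+1%:R * d) mu j0 d0 m0 mM vm).
apply: (Fle_stepP M) => //.
- exact: valid0_iterP.
- exact: valid0_stepP.
- exact: IH.
Qed.

Lemma Fle_iterQ_refine M j d mu m n : 0 < j -> 0 < d -> j * (m.+1%:R * d) < M -> valid M mu ->
  Fle 0 (iter n (stepQ j (m.+1%:R * d)) mu) (iter (n * m.+1) (stepQ j d) mu).
Proof.
move=> j0 d0 mM vm; have [dM _] := lt_mulS _ _ _ _ j0 d0 mM.
have m0 : 0 < m.+1%:R * d by rewrite mulr_gt0.
elim: n => [|n IH]; first by rewrite mul0n /=; exact: Fle_refl.
rewrite iterS mulSn iterD.
have v1 := valid_iterQ M j _ mu n j0 m0 mM vm.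
have v2 := valid_iterQ M j d mu (n * m.+1) j0 d0 dM vm.
apply: Fle0_trans (Fle_stepQ_iter M j d _ m j0 d0 mM v2).
exact: (Fle_stepQ M).
Qed.

Lemma Fle_iterP_refine M j d mu m n : 0 < j -> 0 < d -> j * (m.+1%:R * d) < M -> valid0 M mu ->
  Fle 0 (iter (n * m.+1) (stepP j d) mu) (iter n (stepP j (m.+1%:R * d)) mu).
Proof.
move=> j0 d0 mM vm; have [dM _] := lt_mulS _ _ _ _ j0 d0 mM.
have m0 : 0 < m.+1%:R * d by rewrite mulr_gt0.
elim: n => [|n IH]; first by rewrite mul0n /=; exact: Fle_refl.
rewrite iterS mulSn iterD.
have v1 := valid0_iterP M j _ mu n j0 m0 mM vm.
have v2 := valid0_iterP M j d mu (n * m.+1) j0 d0 dM vm.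
apply: Fle0_trans (Fle_iter_stepP M j d _ m j0 d0 mM v2) _.
exact: (Fle_stepP M).
Qed.

(** The cut moves mass [j * d] to 0. The contributions of the added atom and of the removed piece
    both lie between 0 and [j * d] times the supremum of the kernel, hence so does the modulus of
    their difference. *)
Lemma Gconv_Kdelta_dist M j d T s mu r : 0 < j -> 0 < d -> j * d < M -> valid0 M mu ->
  0 < s -> s <= T -> r \in `[0, 1] ->
  `|(Gconv s (Kdelta j d mu)).2 r - (Gconv s mu).2 r| <= j * d * (kernel_sup T / Num.sqrt s).
Proof.
move=> j0 d0 dM vm s0 sT rI; have Um := vm.1.1; have bm := in_U_bmeas _ Um.
have a0 : 0 < j * d by exact: mulr_gt0.
have aT : j * d < tail_integral mu.2 0 by rewrite (valid0_tail_integral _ _ vm).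
have [R0 RI TR] := Rdelta_spec j d mu Um a0 aT.
have bG := bmeas_Gneum s r s0.
rewrite !Gconv2E pairing_Kdelta//.
set S := kernel_sup T / Num.sqrt s; set Z := Lint _ _.
have -> : pairing mu (Gneum s r) + j * d * Gneum s r 0 - Z - pairing mu (Gneum s r) = j * d * Gneum s r 0 - Z.
  by move: (pairing _ _) (_ * Gneum s r 0) => A B; ring.
have G1 : 0 <= j * d * Gneum s r 0 <= j * d * S.
  rewrite mulr_ge0 ?Gneum_ge0 ?(ltW a0)//= ler_wpM2l ?(ltW a0)//.
  by apply: Gneum_le => //; exact: mem0I.
have bs : bmeas (fun x => strict_ind (Rdelta j d mu) x * mu.2 x).
  by apply: bmeasM => //; exact: bmeas_strict.
have p0 x : x \in `[0, 1] -> 0 <= strict_ind (Rdelta j d mu) x * mu.2 x.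
  by move=> xI; rewrite mulr_ge0 ?ler0n//; exact: in_U_ge0.
have Z1 : 0 <= Z <= j * d * S.
  apply/andP; split; first by apply: Lint_ge0 => x xI; rewrite mulr_ge0 ?Gneum_ge0// p0.
  rewrite -TR -Lint_strict// -LintZr//; apply: Lint_le; [exact: bmeasM|apply: bmeasM => //; exact: bmeas_cst|].
  move=> x xI; rewrite mulrC; apply: ler_wpM2l; first exact: p0.
  exact: Gneum_le.
move: G1 Z1 => /andP[g0 g1] /andP[z0 z1].
by rewrite ler_norml; apply/andP; split; move: g0 g1 z0 z1; move: (j * d * Gneum s r 0) (j * d * S) => A B; lra.
Qed.

(** One term of the Riemann sum for the integral of [1 / sqrt s], in a form that telescopes. *)
Lemma sqrt_step (x d : R) : 0 <= x -> 0 < d -> d / Num.sqrt (x + d) <= 2 * (Num.sqrt (x + d) - Num.sqrt x).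
Proof.
move=> x0 d0; have xd : 0 < x + d by rewrite ltr_wpDl.
have s0 : 0 < Num.sqrt (x + d) by rewrite sqrtr_gt0.
rewrite ler_pdivrMr//.
have e1 := sqr_sqrtr x0; have e2 := sqr_sqrtr (ltW xd).
have le : Num.sqrt x <= Num.sqrt (x + d) by rewrite ler_wsqrtr// lerDl ltW.
have := sqrtr_ge0 x; move: e1 e2 le s0; move: (Num.sqrt x) (Num.sqrt (x + d)) => A B; nra.
Qed.

Lemma iterP_Gconv_dist M j d T m : 0 < j -> 0 < d -> j * d < M -> m.+1%:R * d <= T ->
  forall mu r, valid0 M mu -> r \in `[0, 1] ->
  `|(iter m.+1 (stepP j d) mu).2 r - (Gconv (m.+1%:R * d) mu).2 r| <=
  2 * (j * kernel_sup T * Num.sqrt (m.+1%:R * d)).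
Proof.
move=> j0 d0 dM; have dge x : 0 < x -> (m.+1%:R * d <= T) -> True by [].
elim: m {dge} => [|m IH] mT mu r vm rI.
  rewrite /= !mul1r in mT *; have T0 : 0 < T by exact: lt_le_trans mT.
  have h := Gconv_Kdelta_dist M j d T d mu r j0 d0 dM vm d0 mT rI.
  apply: le_trans h _; have sd : 0 < Num.sqrt d by rewrite sqrtr_gt0.
  have E : d / Num.sqrt d = Num.sqrt d.
    by rewrite -{1}(sqr_sqrtr (ltW d0)) expr2 mulfK// gt_eqF.
  have -> : j * d * (kernel_sup T / Num.sqrt d) = j * kernel_sup T * (d / Num.sqrt d) by ring.
  rewrite E mulr_natl mulr2n lerDl mulr_ge0 ?sqrtr_ge0// mulr_ge0 ?(ltW j0)//.
  exact: kernel_sup_ge0.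
have E : m.+2%:R * d = m.+1%:R * d + d by rewrite -(natr1 m.+1) mulrDl mul1r.
have m0 : 0 < m.+1%:R * d by rewrite mulr_gt0.
rewrite E in mT *; have T0 : 0 < T by apply: lt_le_trans mT; exact: addr_gt0.
have mT' : m.+1%:R * d <= T by apply: le_trans mT; rewrite lerDl ltW.
have vP := valid0_stepP M j d mu j0 d0 dM vm.
have a0 : 0 < j * d by exact: mulr_gt0.
have vK := valid_Kdelta M j d mu vm a0 dM.
(* The earliest step is peeled off, since its cut is smoothed during all the remaining time; the
   induction therefore runs over all initial states. *)
rewrite iterSr.
have h1 := IH mT' (stepP j d mu) r vP rI.
have e2 : (Gconv (m.+1%:R * d) (stepP j d mu)).2 r = (Gconv (m.+1%:R * d + d) (Kdelta j d mu)).2 r.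
  by apply: Gconv_Gconv => //; exact: vK.1.
have h2 := Gconv_Kdelta_dist M j d T (m.+1%:R * d + d) mu r j0 d0 dM vm (addr_gt0 m0 d0) mT rI.
rewrite e2 in h1.
have sq := sqrt_step (m.+1%:R * d) d (ltW m0) d0.
have jk : 0 <= j * kernel_sup T by rewrite mulr_ge0 ?(ltW j0)// kernel_sup_ge0.
have h3 := ler_wpM2l jk sq.
apply: le_trans (ler_distD ((Gconv (m.+1%:R * d + d) (Kdelta j d mu)).2 r) _ _) _.
apply: le_trans (lerD h1 h2) _.
have -> : j * d * (kernel_sup T / Num.sqrt (m.+1%:R * d + d)) =
  j * kernel_sup T * (d / Num.sqrt (m.+1%:R * d + d)) by ring.
move: h3; move: (j * kernel_sup T) (Num.sqrt (m.+1%:R * d)) (Num.sqrt (m.+1%:R * d + d)) (d / _) => A B C D; lra.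
Qed.

Lemma valid0_u u : Linf_pos u -> valid0 (Fd u 0) (0, u).
Proof.
move=> hu; split => //; split; first by split.
Local Transparent Fm.
by rewrite /Fm eqxx add0r.
Qed.

End Barriers.

(** * The limit of the dyadic upper barriers *)

Section Limit.
Context {R : realType}.
Local Notation I := (@I01 R).
Implicit Types (mu nu : meas R) (f g u : R -> R) (a b e h k s t r x y M L j d T : R).

Lemma tail_integral_window f h e x r : bmeas f -> 0 <= h -> 0 <= e -> x \in `[0, 1] -> x + h \in `[0, 1] ->
  (forall y, y \in `[0, 1] -> x <= y -> y < x + h -> `|f y - f r| <= e) ->
  `|tail_integral f x - tail_integral f (x + h) - h * f r| <= e * h.
Proof.
move=> bf h0 e0 xI xhI osc.
pose w y := tail_ind x y - tail_ind (x + h) y.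
have bw : bmeas w by apply: bmeasB; exact: bmeas_tail.
have wE y : w y = ((x <= y) && (y < x + h))%R%:R.
  rewrite /w /tail_ind ltNge; case: (leP x y) => h1; case: (leP (x + h) y) => h2 /=; rewrite ?subrr ?subr0//.
  have h3 : x <= x + h by rewrite lerDl.
  by have := lt_le_trans h1 (le_trans h3 h2); rewrite ltxx.
have iw : Lint I w = h by rewrite LintB ?Lint_tail_ind//; [ring|exact: bmeas_tail|exact: bmeas_tail].
have -> : tail_integral f x - tail_integral f (x + h) - h * f r = Lint I (fun y => w y * (f y - f r)).
  have -> : h * f r = Lint I (fun y => w y * f r) by rewrite LintZr// iw.
  rewrite /tail_integral -LintB; [|exact: bmeas_tail_integral|exact: bmeas_tail_integral].
  rewrite -LintB; last first.
  - by apply: bmeasM => //; exact: bmeas_cst.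
  - by apply: bmeasB; exact: bmeas_tail_integral.
  by apply: Lint_ext => y _; rewrite /w; ring.
have bd : bmeas (fun y => f y - f r) by apply: bmeasB => //; exact: bmeas_cst.
apply: le_trans (Lint_norm _ _) _; first exact: bmeasM.
rewrite -iw -LintZ//; apply: Lint_le; [by apply: bmeas_norm; exact: bmeasM|exact: bmeasZ|].
move=> y yI; rewrite normrM wE; case: (boolP (_ && _)) => [/andP[h1 h2]|_] /=.
  by rewrite normr1 mul1r mulr1; exact: osc.
by rewrite normr0 mul0r mulr0.
Qed.

(* Both densities are compared with their averages over an interval of length [h] containing [r]. *)
Lemma density_close f g h e k : bmeas f -> bmeas g -> 0 < h -> h <= 1 / 2 -> 0 <= e ->
  (forall x y, x \in `[0, 1] -> y \in `[0, 1] -> `|x - y| <= h -> `|f x - f y| <= e) ->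
  (forall x y, x \in `[0, 1] -> y \in `[0, 1] -> `|x - y| <= h -> `|g x - g y| <= e) ->
  (forall x, x \in `[0, 1] -> `|tail_integral f x - tail_integral g x| <= k) ->
  forall r, r \in `[0, 1] -> `|f r - g r| <= 2 * e + 2 * k / h.
Proof.
move=> bf bg h0 h1 e0 of_ og T r rI.
move: (rI); rewrite in01 => /andP[r0 r1].
have [x [xI xhI xr rx]] : exists x, [/\ x \in `[0, 1], x + h \in `[0, 1], x <= r & r <= x + h].
  have [rh|rh] := leP (r + h) 1.
    by exists r; split => //; rewrite ?in01; lra.
  by exists (1 - h); split; rewrite ?in01; try (apply/andP; split); lra.
have wf y : y \in `[0, 1] -> x <= y -> y < x + h -> `|f y - f r| <= e.
  by move=> yI xy yx; apply: of_ => //; rewrite ler_norml; apply/andP; split; lra.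
have wg y : y \in `[0, 1] -> x <= y -> y < x + h -> `|g y - g r| <= e.
  by move=> yI xy yx; apply: og => //; rewrite ler_norml; apply/andP; split; lra.
have a1 := tail_integral_window f h e x r bf (ltW h0) e0 xI xhI wf.
have a2 := tail_integral_window g h e x r bg (ltW h0) e0 xI xhI wg.
have a3 := T x xI; have a4 := T (x + h) xhI.
rewrite -(ler_pM2l h0) -[X in X * `|_|](gtr0_norm h0) -normrM mulrBr.
have -> : h * (2 * e + 2 * k / h) = 2 * (e * h) + 2 * k by field; rewrite gt_eqF.
move: a1 a2 a3 a4; move: (tail_integral f x) (tail_integral g x) (tail_integral f (x + h)) (tail_integral g (x + h)) (h * f r) (h * g r) (e * h).
move=> A B C D F G E.
by rewrite !ler_norml => /andP[? ?] /andP[? ?] /andP[? ?] /andP[? ?]; apply/andP; split; lra.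
Qed.

Local Opaque Gconv Kdelta Fm stepP stepQ.

Definition dyad t (n : nat) : R := t / (2 ^ n)%N%:R.

Lemma dyad_gt0 t n : 0 < t -> 0 < dyad t n.
Proof. by move=> t0; rewrite divr_gt0// ltr0n expn_gt0. Qed.

Lemma dyadD t n m : (2 ^ m)%N%:R * dyad t (n + m) = dyad t n.
Proof.
rewrite /dyad expnD natrM; have : (2 ^ n)%N%:R != 0 :> R by rewrite pnatr_eq0 -lt0n expn_gt0.
have : (2 ^ m)%N%:R != 0 :> R by rewrite pnatr_eq0 -lt0n expn_gt0.
by move: ((2 ^ n)%N%:R) ((2 ^ m)%N%:R) => A B B0 A0; field; rewrite A0 B0.
Qed.

Lemma dyad_small b e : 0 <= b -> 0 < e -> exists N, forall n t, (N <= n)%N -> t <= b -> dyad t n < e.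
Proof.
move=> b0 e0; have be : 0 <= b / e by rewrite divr_ge0// ltW.
exists (Num.bound (b / e)) => n t Nn tb; rewrite /dyad ltr_pdivrMr ?ltr0n ?expn_gt0//.
apply: le_lt_trans tb _; rewrite mulrC -ltr_pdivrMr//.
apply: lt_trans (archi_boundP be) _; rewrite ltr_nat.
by apply: leq_ltn_trans Nn _; exact: ltn_expl.
Qed.

Definition dyadic_barrier j u n t : meas R := iter (2 ^ n) (stepP j (dyad t n)) (0, u).

Lemma dyadic_barrier_valid0 j u n t : 0 < j -> Linf_pos u -> 0 < t -> j * dyad t n < Fd u 0 ->
  valid0 (Fd u 0) (dyadic_barrier j u n t).
Proof. by move=> j0 hu t0 dM; apply: valid0_iterP => //; [exact: dyad_gt0|exact: valid0_u]. Qed.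

Lemma exp2S n : exists m, (2 ^ n)%N = m.+1.
Proof. by exists (2 ^ n).-1; rewrite prednK// expn_gt0. Qed.

(** The second half is the chain coarse upper, coarse lower, fine lower, fine upper: only the first
    link has a cost, the gap at the coarse mesh. *)
Lemma iterP_refine M j t mu (n m : nat) : 0 < j -> 0 < t -> j * (t / n.+1%:R) < M -> valid0 M mu ->
  Fle 0 (iter (n.+1 * m.+1) (stepP j (t / (n.+1 * m.+1)%:R)) mu) (iter n.+1 (stepP j (t / n.+1%:R)) mu) /\
  Fle (j * (t / n.+1%:R)) (iter n.+1 (stepP j (t / n.+1%:R)) mu)
    (iter (n.+1 * m.+1) (stepP j (t / (n.+1 * m.+1)%:R)) mu).
Proof.
move=> j0 t0 tM vm.
have n0 : 0 < n.+1%:R :> R by rewrite ltr0n.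
have m0 : 0 < m.+1%:R :> R by rewrite ltr0n.
set d := t / (n.+1 * m.+1)%:R; have d0 : 0 < d by rewrite divr_gt0// ltr0n muln_gt0.
have E : t / n.+1%:R = m.+1%:R * d.
  rewrite /d natrM; move: (n.+1%:R) (m.+1%:R) n0 m0 => A B A0 B0.
  by field; rewrite !gt_eqF.
rewrite E in tM *; have D0 : 0 < m.+1%:R * d by exact: mulr_gt0.
have [dM _] := lt_mulS _ _ _ _ j0 d0 tM.
split; first exact: (Fle_iterP_refine M).
have h1 := Fle_iterP_iterQ M j _ mu n.+1 j0 D0 tM vm.
have h2 := Fle_iterQ_refine M j d mu m n.+1 j0 d0 tM vm.1.
have h3 := Fle_iterQ_iterP M j d mu (n.+1 * m.+1) j0 d0 dM vm.
have := Fle_trans _ _ _ _ _ h1 (Fle0_trans _ _ _ h2 h3).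
by rewrite addr0.
Qed.

Lemma dyadic_barrier_refine j u n m t : 0 < j -> Linf_pos u -> 0 < t -> j * dyad t n < Fd u 0 ->
  Fle 0 (dyadic_barrier j u (n + m) t) (dyadic_barrier j u n t) /\ Fle (j * dyad t n) (dyadic_barrier j u n t) (dyadic_barrier j u (n + m) t).
Proof.
move=> j0 hu t0 tM; rewrite /dyadic_barrier /dyad expnD in tM *.
have [n' En] := exp2S n; have [m' Em] := exp2S m; rewrite En Em in tM *.
by apply: (iterP_refine (Fd u 0)) => //; exact: valid0_u.
Qed.

Lemma dyadic_barrier_close j u n m N t r : 0 < j -> Linf_pos u -> 0 < t -> j * dyad t N < Fd u 0 ->
  (N <= n)%N -> (N <= m)%N -> r \in `[0, 1] ->
  `|Fm (dyadic_barrier j u n t) r - Fm (dyadic_barrier j u m t) r| <= j * dyad t N.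
Proof.
move=> j0 hu t0 tM Nn Nm rI.
have [h1 h2] := dyadic_barrier_refine j u N (n - N) t j0 hu t0 tM.
have [h3 h4] := dyadic_barrier_refine j u N (m - N) t j0 hu t0 tM.
rewrite !subnKC// in h1 h2 h3 h4.
have := h1 r rI; have := h2 r rI; have := h3 r rI; have := h4 r rI.
move: (Fm _ r) (Fm (dyadic_barrier j u n t) r) (Fm (dyadic_barrier j u m t) r) => A B C ? ? ? ?.
by rewrite ler_norml; apply/andP; split; lra.
Qed.

(** Over a last stretch [t / 2 ^ q], with [q] independent of [n] and [t], the barrier stays close to
    a pure flow, which is Lipschitz whatever its initial state of mass [M] because the stretch lasts
    at least [a / 2 ^ q]. *)
Lemma dyadic_barrier_equicontinuous j u a b e : 0 < j -> Linf_pos u -> 0 < Fd u 0 -> 0 < a -> a <= b -> 0 < e ->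
  exists h N, [/\ 0 < h, h <= 1 / 2,
    (forall n t, (N <= n)%N -> a <= t -> t <= b -> j * dyad t n < Fd u 0) &
    forall n t r r', (N <= n)%N -> a <= t -> t <= b -> r \in `[0, 1] -> r' \in `[0, 1] ->
      `|r - r'| <= h -> `|(dyadic_barrier j u n t).2 r - (dyadic_barrier j u n t).2 r'| <= e].
Proof.
move=> j0 hu M0 a0 ab e0; have b0 : 0 < b by exact: lt_le_trans ab.
set M := Fd u 0 in M0 *; have vu : valid0 M (0, u) by exact: valid0_u.
have kS0 := kernel_sup_ge0 b b0.
(* Each of the two points compared is within [2 * (j * kernel_sup b * sqrt h)] of the pure flow, [h]
   being the length of the last stretch; both together may use [e / 2]. *)
pose C := 4 * (j * kernel_sup b) + 1; have C0 : 0 < C by rewrite ltr_wpDl// mulr_ge0// mulr_ge0// (ltW j0).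
have q0 : 0 < (e / 2 / C) ^+ 2 by rewrite exprn_gt0// divr_gt0// divr_gt0.
have [q hq] := dyad_small b _ (ltW b0) q0.
have [N hN] := dyad_small b _ (ltW b0) (divr_gt0 M0 j0).
have a'0 : 0 < dyad a q by exact: dyad_gt0.
pose L := kernel_lip (dyad a q) b * M + 1.
have L0 : 0 < L by rewrite ltr_wpDl// mulr_ge0 ?(ltW M0)// kernel_lip_ge0.
have small n t : (q + N <= n)%N -> a <= t -> t <= b -> j * dyad t n < M.
  move=> qn at' tb; rewrite mulrC -ltr_pdivlMr//; apply: hN => //.
  exact: leq_trans (leq_addl _ _) qn.
exists (Num.min (1 / 2) (e / 2 / L)), (q + N)%N; split => //.
- by rewrite lt_min divr_gt0//= divr_gt0// divr_gt0.
- by rewrite ge_min lexx.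
move=> n t r r' qn at' tb rI rI'; rewrite le_min => /andP[_ rr].
have t0 : 0 < t by exact: lt_le_trans at'.
have dM := small n t qn at' tb; have d0 := dyad_gt0 t n t0.
have qn' : (q <= n)%N by exact: leq_trans (leq_addr _ _) qn.
have [m Em] := exp2S (n - q).
(* The barrier at time [t - t / 2 ^ q], when [2 ^ (n - q)] steps remain. *)
pose w : meas R := iter (2 ^ n - m.+1) (stepP j (dyad t n)) (0, u).
have vw : valid0 M w by exact: valid0_iterP.
have VE : dyadic_barrier j u n t = iter m.+1 (stepP j (dyad t n)) w.
  by rewrite /dyadic_barrier /w -iterD -Em subnKC// leq_pexp2l// leq_subr.
have eta : m.+1%:R * dyad t n = dyad t q by rewrite -Em -{2}(subnKC qn') dyadD.
have etab : dyad t q <= b.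
  apply: le_trans tb; rewrite /dyad ler_pdivrMr ?ltr0n ?expn_gt0// ler_peMr ?(ltW t0)//.
  by rewrite ler1n expn_gt0.
have aeta : dyad a q <= dyad t q by rewrite /dyad ler_wpM2r ?invr_ge0.
have D := iterP_Gconv_dist M j (dyad t n) b m j0 d0 dM; rewrite eta in D.
have D1 := D etab w r vw rI; have D2 := D etab w r' vw rI'; rewrite -VE in D1 D2.
have D3 := Gconv_lip (dyad t q) b (dyad a q) w r r' vw.1.1 a'0 aeta etab rI rI'.
rewrite vw.1.2 in D3.
have sq : Num.sqrt (dyad t q) <= e / 2 / C.
  rewrite -[leRHS]ger0_norm; last by rewrite !divr_ge0// ltW.
  by rewrite -sqrtr_sqr ler_wsqrtr// ltW// hq.
have E1 : 4 * (j * kernel_sup b * Num.sqrt (dyad t q)) <= e / 2.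
  apply: (@le_trans _ _ (C * Num.sqrt (dyad t q))); last by rewrite mulrC -ler_pdivlMr.
  by rewrite mulrA ler_wpM2r ?sqrtr_ge0// /C lerDl.
have E2 : kernel_lip (dyad a q) b * M * `|r - r'| <= e / 2.
  apply: (@le_trans _ _ (L * `|r - r'|)); last by rewrite mulrC -ler_pdivlMr.
  by rewrite ler_wpM2r// /L lerDl.
move: D1 D2 D3 E1 E2; move: ((dyadic_barrier j u n t).2 r) ((dyadic_barrier j u n t).2 r') ((Gconv _ w).2 r) ((Gconv _ w).2 r').
move: (j * kernel_sup b * _) (kernel_lip _ _ * M * _) => X Y A B G H.
by rewrite !ler_norml => /andP[? ?] /andP[? ?] /andP[? ?] ? ?; apply/andP; split; lra.
Qed.

Lemma valid0_Fm_tail_integral M mu r : valid0 M mu -> r \in `[0, 1] -> Fm mu r = tail_integral mu.2 r.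
Proof. by move=> vm rI; rewrite FmE// vm.2; case: ifP; rewrite add0r. Qed.

Lemma dyadic_barrier_cauchy j u a b e : 0 < j -> Linf_pos u -> 0 < Fd u 0 -> 0 < a -> a <= b -> 0 < e ->
  exists N, forall n m t r, (N <= n)%N -> (N <= m)%N -> a <= t -> t <= b -> r \in `[0, 1] ->
    `|(dyadic_barrier j u n t).2 r - (dyadic_barrier j u m t).2 r| <= e.
Proof.
move=> j0 hu M0 a0 ab e0; have b0 : 0 < b by exact: lt_le_trans ab.
have e4 : 0 < e / 4 by rewrite divr_gt0.
have [h [N [h0 h1 small equi]]] := dyadic_barrier_equicontinuous j u a b _ j0 hu M0 a0 ab e4.
(* The tails must agree to within [e / 4 * h]: averaging over a length [h] divides by [h], leaving
   [e / 2], and the two oscillations add another [e / 2]. *)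
have k0 : 0 < e / 4 * h / j by rewrite !mulr_gt0 ?invr_gt0.
have [N' hN'] := dyad_small b _ (ltW b0) k0.
exists (N + N')%N => n m t r Nn Nm at' tb rI.
have t0 : 0 < t by exact: lt_le_trans at'.
have [Nn1 Nm1] : (N <= n)%N /\ (N <= m)%N by split; [exact: leq_trans (leq_addr _ _) Nn|exact: leq_trans (leq_addr _ _) Nm].
have vn := dyadic_barrier_valid0 j u n t j0 hu t0 (small n t Nn1 at' tb).
have vm := dyadic_barrier_valid0 j u m t j0 hu t0 (small m t Nm1 at' tb).
have T x : x \in `[0, 1] -> `|tail_integral (dyadic_barrier j u n t).2 x - tail_integral (dyadic_barrier j u m t).2 x| <= e / 4 * h.
  move=> xI; rewrite -(valid0_Fm_tail_integral _ _ _ vn xI) -(valid0_Fm_tail_integral _ _ _ vm xI).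
  apply: le_trans (dyadic_barrier_close j u n m (N + N') t x j0 hu t0 _ Nn Nm xI) _.
    by apply: small => //; exact: leq_addr.
  by rewrite mulrC -ler_pdivlMr// ltW// hN'// leq_addl.
have := density_close _ _ h (e / 4) _ (in_U_bmeas _ vn.1.1) (in_U_bmeas _ vm.1.1) h0 h1 (ltW e4)
  (fun x y xI yI => equi n t x y Nn1 at' tb xI yI)
  (fun x y xI yI => equi m t x y Nm1 at' tb xI yI) T r rI.
have -> : 2 * (e / 4) + 2 * (e / 4 * h) / h = e by field; rewrite gt_eqF.
by [].
Qed.

(** A pointwise limit rather than a class of densities, since continuity is claimed for the function
    itself. *)
Definition Ulim j u r t : R := limn (fun n => (dyadic_barrier j u n t).2 r).

Lemma dyadic_barrier_cvg j u t r : 0 < j -> Linf_pos u -> 0 < Fd u 0 -> 0 < t -> r \in `[0, 1] ->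
  (dyadic_barrier j u n t).2 r @[n --> \oo] --> Ulim j u r t.
Proof.
move=> j0 hu M0 t0 rI.
suff : cvgn (fun n => (dyadic_barrier j u n t).2 r : R^o) by [].
apply/cauchy_cvgP/cauchy_exP => e e0.
have e2 : 0 < e / 2 by rewrite divr_gt0.
have [N hN] := dyadic_barrier_cauchy j u t t _ j0 hu M0 t0 (lexx _) e2.
exists ((dyadic_barrier j u N t).2 r); exists N => // n /= Nn.
by rewrite /ball/=; apply: le_lt_trans (hN _ _ _ _ (leqnn N) Nn (lexx t) (lexx t) rI) _; lra.
Qed.

Lemma Ulim_unif j u a b e : 0 < j -> Linf_pos u -> 0 < Fd u 0 -> 0 < a -> a <= b -> 0 < e ->
  exists N, forall n t r, (N <= n)%N -> a <= t -> t <= b -> r \in `[0, 1] ->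
    `|(dyadic_barrier j u n t).2 r - Ulim j u r t| <= e.
Proof.
move=> j0 hu M0 a0 ab e0; have [N hN] := dyadic_barrier_cauchy j u a b e j0 hu M0 a0 ab e0.
exists N => n t r Nn at' tb rI; have t0 : 0 < t by exact: lt_le_trans at'.
have cv := dyadic_barrier_cvg j u t r j0 hu M0 t0 rI.
have cv2 : `|(dyadic_barrier j u n t).2 r - (dyadic_barrier j u m t).2 r| @[m --> \oo] --> `|(dyadic_barrier j u n t).2 r - Ulim j u r t|.
  by apply: cvg_norm; apply: cvgB => //; exact: cvg_cst.
rewrite -(cvg_lim _ cv2)//; apply: limr_le; first exact: cvgP cv2.
by exists N => // m /= Nm; exact: hN.
Qed.

Lemma Ulim_equicontinuous j u a b e : 0 < j -> Linf_pos u -> 0 < Fd u 0 -> 0 < a -> a <= b -> 0 < e ->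
  exists h, [/\ 0 < h, h <= 1 / 2 &
    forall t r r', a <= t -> t <= b -> r \in `[0, 1] -> r' \in `[0, 1] ->
      `|r - r'| <= h -> `|Ulim j u r t - Ulim j u r' t| <= e].
Proof.
move=> j0 hu M0 a0 ab e0; have e3 : 0 < e / 3 by rewrite divr_gt0.
have [h [N [h0 h1 small equi]]] := dyadic_barrier_equicontinuous j u a b _ j0 hu M0 a0 ab e3.
have [N' hN'] := Ulim_unif j u a b _ j0 hu M0 a0 ab e3.
exists h; split => // t r r' at' tb rI rI' rr.
have d1 := hN' (N + N')%N t r (leq_addl _ _) at' tb rI.
have d2 := hN' (N + N')%N t r' (leq_addl _ _) at' tb rI'.
have d3 := equi (N + N')%N t r r' (leq_addr _ _) at' tb rI rI' rr.
move: d1 d2 d3; move: ((dyadic_barrier j u _ t).2 r) ((dyadic_barrier j u _ t).2 r') (Ulim j u r t) (Ulim j u r' t) => A B C D.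
by rewrite !ler_norml => /andP[? ?] /andP[? ?] /andP[? ?]; apply/andP; split; lra.
Qed.

Lemma Ulim_within_continuous j u t : 0 < j -> Linf_pos u -> 0 < Fd u 0 -> 0 < t ->
  {within I, continuous (Ulim j u ^~ t)}.
Proof.
move=> j0 hu M0 t0; apply/subspace_continuousP => x Ix; apply/cvgrPdist_le => e e0.
have [h [h0 _ hh]] := Ulim_equicontinuous j u t t e j0 hu M0 t0 (lexx _) e0.
rewrite near_withinE; apply: (filterS _ (nbhsx_ballx x _ h0)) => y xy Iy.
by apply: hh => //; exact: ltW.
Qed.

Lemma Ulim_in_U j u t : 0 < j -> Linf_pos u -> 0 < Fd u 0 -> 0 < t -> in_U (0, Ulim j u ^~ t).
Proof.
move=> j0 hu M0 t0; split => //; apply: bmeas_Linf_pos.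
  by apply: bmeas_within_continuous; exact: Ulim_within_continuous.
move=> x xI /=; have cv := dyadic_barrier_cvg j u t x j0 hu M0 t0 xI.
rewrite -(cvg_lim _ cv)//; apply: limr_ge; first exact: cvgP cv.
have [h [N [_ _ small _]]] := dyadic_barrier_equicontinuous j u t t 1 j0 hu M0 t0 (lexx _) ltr01.
exists N => // n /= Nn; have vn := dyadic_barrier_valid0 j u n t j0 hu t0 (small n t Nn (lexx _) (lexx _)).
exact: in_U_ge0 vn.1.1 xI.
Qed.

Lemma tail_integral_close f g k r : bmeas f -> bmeas g -> (forall x, x \in `[0, 1] -> `|f x - g x| <= k) ->
  `|tail_integral f r - tail_integral g r| <= k.
Proof.
move=> bf bg fg; rewrite /tail_integral -LintB; [|exact: bmeas_tail_integral|exact: bmeas_tail_integral].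
apply: Lint_norm_le; first by apply: bmeasB; exact: bmeas_tail_integral.
move=> x xI; rewrite -mulrBr normrM ger0_norm ?tail_ind_ge0//.
by apply: le_trans (ler_wpM2r (normr_ge0 _) (tail_ind_le1 _ _)) _; rewrite mul1r fg.
Qed.

Lemma Fle_dyadic_barrier_Ulim j u n t : 0 < j -> Linf_pos u -> 0 < Fd u 0 -> 0 < t -> j * dyad t n < Fd u 0 ->
  Fle 0 (0, Ulim j u ^~ t) (dyadic_barrier j u n t) /\ Fle (j * dyad t n) (dyadic_barrier j u n t) (0, Ulim j u ^~ t).
Proof.
move=> j0 hu M0 t0 nM; have UU := Ulim_in_U j u t j0 hu M0 t0.
have close e : 0 < e -> exists m, forall r, r \in `[0, 1] ->
    `|Fm (dyadic_barrier j u (n + m) t) r - Fm (0, Ulim j u ^~ t) r| <= e.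
  move=> e0; have [N hN] := Ulim_unif j u t t e j0 hu M0 t0 (lexx _) e0.
  have [h [N' [_ _ small _]]] := dyadic_barrier_equicontinuous j u t t 1 j0 hu M0 t0 (lexx _) ltr01.
  exists (N + N')%N => r rI.
  have l1 : (N' <= n + (N + N'))%N by rewrite addnA leq_addl.
  have l2 : (N <= n + (N + N'))%N by rewrite addnCA leq_addr.
  have vn := dyadic_barrier_valid0 j u _ t j0 hu t0 (small _ t l1 (lexx _) (lexx _)).
  rewrite (valid0_Fm_tail_integral _ _ _ vn rI) (FmE (0, _))//= if_same add0r.
  apply: tail_integral_close; [exact: in_U_bmeas vn.1.1|exact: in_U_bmeas UU|].
  by move=> x xI; exact: hN.
split => r rI; apply/ler_addgt0Pr => e e0; have [m hm] := close e e0;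
  have [h1 h2] := dyadic_barrier_refine j u n m t j0 hu t0 nM;
  have := hm r rI; have := h1 r rI; have := h2 r rI;
  move: (Fm (dyadic_barrier j u n t) r) (Fm (dyadic_barrier j u (n + m) t) r) (Fm (0, _) r) (j * dyad t n) => A B C D;
  rewrite ler_norml => ? ? /andP[? ?]; lra.
Qed.

Lemma Fle_limit mu nu : (forall e, 0 < e -> Fle e mu nu) -> Fle 0 mu nu.
Proof. by move=> h r rI; rewrite addr0; apply/ler_addgt0Pr => e e0; exact: h. Qed.

Lemma Fle_meas_le mu nu : Fle 0 mu nu -> meas_le mu nu.
Proof. by move=> h r rI; have := h r rI; rewrite addr0. Qed.

(** The chain below is [S^-] at mesh [d], then both barriers at the common refinement, the dyadic
    barrier, and the limit; above, the limit, the dyadic barrier, [S^+] at the refinement and at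
    [d]. The only loss is [j * dyad t n], which is arbitrarily small. *)
Lemma Ulim_barriers j u d (k : nat) : 0 < j -> Linf_pos u -> 0 < d -> j * d < Fd u 0 ->
  Fle 0 (Sminus j d u k.+1) (0, Ulim j u ^~ (k.+1%:R * d)) /\
  Fle 0 (0, Ulim j u ^~ (k.+1%:R * d)) (Splus j d u k.+1).
Proof.
move=> j0 hu d0 dM; have a0 : 0 < j * d by exact: mulr_gt0.
have M0 : 0 < Fd u 0 by exact: lt_trans dM.
set M := Fd u 0 in dM M0 *; have vu : valid0 M (0, u) by exact: valid0_u.
set t := k.+1%:R * d; have t0 : 0 < t by rewrite mulr_gt0.
rewrite -/(iter k.+1 (stepQ j d) (0, u)) -/(iter k.+1 (stepP j d) (0, u)).
have kd : t / k.+1%:R = d by rewrite /t mulrC mulKf// pnatr_eq0.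
suff W e : 0 < e -> Fle e (iter k.+1 (stepQ j d) (0, u)) (0, Ulim j u ^~ t) /\
    Fle e (0, Ulim j u ^~ t) (iter k.+1 (stepP j d) (0, u)).
  by split; apply: Fle_limit => e e0; have [] := W e e0.
move=> e0.
have b0 : 0 < Num.min M e / j by rewrite divr_gt0// lt_min M0.
have [n hn] := dyad_small t _ (ltW t0) b0.
have {}hn := hn n t (leqnn n) (lexx t); rewrite ltr_pdivlMr// mulrC lt_min in hn.
have /andP[nM ne] := hn; have [n' En] := exp2S n.
(* The common refinement of the mesh [d = t / (k + 1)] and of the dyadic mesh [t / 2 ^ n]. *)
pose fd := t / (k.+1 * n'.+1)%:R; have fd0 : 0 < fd by rewrite divr_gt0// ltr0n muln_gt0.
have kdM : j * (t / k.+1%:R) < M by rewrite kd.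
have [f1 _] := iterP_refine M j t (0, u) k n' j0 t0 kdM vu; rewrite kd -/fd in f1.
have nM' : j * (t / n'.+1%:R) < M by rewrite -En.
have dE : t / n'.+1%:R = dyad t n by rewrite /dyad En.
have VE : iter n'.+1 (stepP j (dyad t n)) (0, u) = dyadic_barrier j u n t by rewrite /dyadic_barrier En.
have [q3 f2] := iterP_refine M j t (0, u) n' k j0 t0 nM' vu.
rewrite (mulnC n'.+1) -/fd dE VE in q3 f2.
have [g1 g2] := Fle_dyadic_barrier_Ulim j u n t j0 hu M0 t0 nM.
have E : n'.+1%:R * fd = d.
  rewrite -kd /fd natrM; have : k.+1%:R != 0 :> R by rewrite pnatr_eq0.
  have : n'.+1%:R != 0 :> R by rewrite pnatr_eq0.
  by move: (n'.+1%:R) (k.+1%:R) => A B A0 B0; field; rewrite A0 B0.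
have fdM : j * fd < M by rewrite -E in dM; have [] := lt_mulS _ _ _ _ j0 fd0 dM.
have q1 : Fle 0 (iter k.+1 (stepQ j d) (0, u)) (iter (k.+1 * n'.+1) (stepQ j fd) (0, u)).
  rewrite -{1}E; apply: (Fle_iterQ_refine M) => //; [by rewrite E|exact: vu.1].
have q2 := Fle_iterQ_iterP M j fd (0, u) (k.+1 * n'.+1) j0 fd0 fdM vu.
split.
  have := Fle_trans _ _ _ _ _ (Fle0_trans _ _ _ (Fle0_trans _ _ _ q1 q2) q3) g2.
  by rewrite add0r; apply: Fle_weak; exact: ltW.
have := Fle_trans _ _ _ _ _ (Fle_trans _ _ _ _ _ g1 f2) f1.
by rewrite add0r addr0; apply: Fle_weak; exact: ltW.
Qed.

End Limit.

(** * Continuity in time *)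

Section Regularity.
Context {R : realType}.
Local Notation I := (@I01 R).
Implicit Types (mu nu : meas R) (f g u : R -> R) (a b e k s t r x y M L j d T : R).
Local Opaque Gconv Kdelta Fm stepQ.

(** Fixes the number of steps and lets the mesh follow [t], the form in which two times can be
    compared. *)
Lemma Ulim_stepP j u t (l : nat) : 0 < j -> Linf_pos u -> 0 < t -> j * (t / l.+1%:R) < Fd u 0 ->
  Fle 0 (0, Ulim j u ^~ t) (iter l.+1 (stepP j (t / l.+1%:R)) (0, u)) /\
  Fle (j * (t / l.+1%:R)) (iter l.+1 (stepP j (t / l.+1%:R)) (0, u)) (0, Ulim j u ^~ t).
Proof.
move=> j0 hu t0 dM; have d0 : 0 < t / l.+1%:R by rewrite divr_gt0.
have [h1 h2] := Ulim_barriers j u _ l j0 hu d0 dM.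
have E : l.+1%:R * (t / l.+1%:R) = t by rewrite mulrC divfK// pnatr_eq0.
rewrite E in h1 h2; split; first exact: h2.
have h3 := Fle_iterP_iterQ (Fd u 0) j _ (0, u) l.+1 j0 d0 dM (valid0_u _ hu).
by have := Fle_trans _ _ _ _ _ h3 h1; rewrite addr0.
Qed.

Lemma Fle_norm k mu nu : (forall r, r \in `[0, 1] -> `|Fm mu r - Fm nu r| <= k) -> Fle k mu nu.
Proof. by move=> h r /h; move: (Fm mu r) (Fm nu r) => A B; rewrite ler_norml => /andP[? ?]; lra. Qed.

Lemma norm_Fle k mu nu r : Fle k mu nu -> Fle k nu mu -> r \in `[0, 1] ->
  `|Fm mu r - Fm nu r| <= k.
Proof.
move=> h1 h2 rI; move: (h1 r rI) (h2 r rI); move: (Fm mu r) (Fm nu r) => A B ? ?.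
by rewrite ler_norml; apply/andP; split; lra.
Qed.

Lemma Fm_density f r : r \in `[0, 1] -> Fm (0, f) r = tail_integral f r.
Proof. by move=> rI; rewrite FmE//= if_same add0r. Qed.

Lemma norm_Fle_tail_integral f g k r : Fle k (0, f) (0, g) -> Fle k (0, g) (0, f) -> r \in `[0, 1] ->
  `|tail_integral f r - tail_integral g r| <= k.
Proof. by move=> h1 h2 rI; rewrite -(Fm_density f _ rI) -(Fm_density g _ rI); exact: norm_Fle. Qed.

(** The two flows coincide up to the earlier time, at least [a], when the density is already bounded
    by [B]; what remains is the short-time estimate. *)
Lemma Gconv_time M a T e : 0 <= M -> 0 < a -> a <= T -> 0 < e ->
  exists2 h, 0 < h & forall d d' mu, a <= d -> d <= T -> a <= d' -> d' <= T -> `|d - d'| <= h ->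
    valid M mu -> forall r, r \in `[0, 1] -> `|Fm (Gconv d mu) r - Fm (Gconv d' mu) r| <= e.
Proof.
move=> M0 a0 aT e0; have T0 : 0 < T by exact: lt_le_trans aT.
pose B := kernel_sup T / Num.sqrt a * M + 1.
have kT := kernel_sup_ge0 T T0.
have B0 : 0 < B by rewrite ltr_wpDl// mulr_ge0// divr_ge0// sqrtr_ge0.
have CB d : a <= d -> kernel_sup T / Num.sqrt d * M <= B.
  move=> ad; have d0 : 0 < d by exact: lt_le_trans ad.
  apply: (@le_trans _ _ (kernel_sup T / Num.sqrt a * M)); last by rewrite lerDl.
  by rewrite ler_wpM2r// ler_wpM2l// lef_pV2 ?posrE ?sqrtr_gt0//; exact: ler_wsqrtr.
have BE : B * (e / B) = e by rewrite mulrC divfK// gt_eqF.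
clearbody B.
have [h h0 hh] := Gconv_near_id (e / B) (divr_gt0 e0 B0); exists h => //.
suff W d d' mu r : a <= d -> d < d' -> d' <= T -> d' - d <= h -> valid M mu -> r \in `[0, 1] ->
    `|Fm (Gconv d mu) r - Fm (Gconv d' mu) r| <= e.
  move=> d d' mu ad dT ad' d'T dd vm r rI; have [dd'|dd'|->] := ltgtP d d'.
  - by apply: W => //; rewrite distrC in dd; exact: le_trans (ler_norm _) dd.
  - by rewrite distrC; apply: W => //; exact: le_trans (ler_norm _) dd.
  - by rewrite subrr normr0 ltW.
move=> ad dd' d'T dd vm rI.
have d0 : 0 < d by exact: lt_le_trans ad.
have s0 : 0 < d' - d by rewrite subr_gt0.
have dT : d <= T by apply: le_trans d'T; exact: ltW.
have H := Fm_Gconv_Gconv (d' - d) d mu r vm.1 s0 d0 rI.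
have SE : d' - d + d = d' by exact: subrK.
rewrite SE in H.
have [v1 v2] := valid0_Gconv M d mu d0 vm.
suff bd : forall x, x \in `[0, 1] -> (Gconv d mu).2 x <= B.
  have aux (X Y Z : R) : X = Y -> `|X - Z| <= B * (e / B) -> `|Z - Y| <= e.
    by rewrite BE => <-; rewrite distrC.
  exact: (aux _ _ _ H (hh (d' - d) (Gconv d mu) B s0 dd v1.1 v2 (ltW B0) bd r rI)).
move=> x xI.
 apply: le_trans (ler_norm _) _.
apply: le_trans (Gconv_le d T mu x vm.1 d0 dT xI) _.
by rewrite vm.2; exact: CB.
Qed.

Lemma Fle_Kdelta_time M k j d d' mu nu : 0 < j -> 0 < d -> j * d < M -> 0 < d' -> j * d' < M ->
  0 <= k -> valid0 M mu -> valid0 M nu -> Fle k mu nu ->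
  Fle (k + j * `|d - d'|) (Kdelta j d mu) (Kdelta j d' nu).
Proof.
move=> j0 d0 dM d'0 d'M k0 vm vn mn.
have a0 : 0 < j * d by exact: mulr_gt0.
have a0' : 0 < j * d' by exact: mulr_gt0.
have kk : 0 <= k + j * `|d - d'| by rewrite addr_ge0// mulr_ge0// ltW.
apply: Fle_cases => //.
  by rewrite (Kdelta_mass M)// (Kdelta_mass M).
move=> r rI r0; rewrite (Fm_Kdelta M)// (Fm_Kdelta M)//.
have h1 : j * d' - j * d <= j * `|d - d'|.
  by rewrite -mulrBr ler_wpM2l ?(ltW j0)// distrC ler_norm.
have := mn r rI; move: h1 kk; move: (Fm mu r) (Fm nu r) (j * d) (j * d') (j * `|_|) => A B C D E h1 kk h2.
rewrite ge_max; apply/andP; split.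
  by apply: le_trans (_ : B - D + (k + E) <= _); [lra|rewrite lerD2r le_max lexx].
by rewrite addr_ge0// le_max lexx orbT.
Qed.

(** Changing the step length costs [j * |d - d'|] at the cut and a continuity error at the flow,
    while inherited errors are not amplified. The budget is [e / 2] inherited and [e / 4] for each
    new error. *)
Lemma iterP_time M j a T n : 0 < j -> 0 < a -> a <= T -> j * T < M -> forall e, 0 < e ->
  exists2 h, 0 < h & forall d d' mu, a <= d -> d <= T -> a <= d' -> d' <= T -> `|d - d'| <= h ->
    valid0 M mu -> Fle e (iter n (stepP j d) mu) (iter n (stepP j d') mu).
Proof.
move=> j0 a0 aT TM; have T0 : 0 < T by exact: lt_le_trans aT.
have M0 : 0 <= M by apply: ltW; apply: le_lt_trans TM; rewrite mulr_ge0 ?ltW.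
have lt d : d <= T -> j * d < M by move=> dT; apply: le_lt_trans TM; rewrite ler_wpM2l ?(ltW j0).
have gt d : a <= d -> 0 < d by exact: lt_le_trans.
elim: n => [|n IH] e e0.
  by exists 1 => // d d' mu *; apply: Fle_weak (ltW e0) _; exact: Fle_refl.
have e2 : 0 < e / 2 by rewrite divr_gt0.
have e4 : 0 < e / 4 by rewrite divr_gt0.
have [h1 h10 hh1] := IH _ e2.
have [h2 h20 hh2] := Gconv_time M a T _ M0 a0 aT e4.
exists (Num.min (e / 4 / j) (Num.min h1 h2)).
  by rewrite lt_min divr_gt0//= lt_min h10.
move=> d d' mu ad dT ad' d'T; rewrite !le_min => /and3P[dj dh1 dh2] vm.
have d0 := gt d ad; have d'0 := gt d' ad'; have dM := lt d dT; have d'M := lt d' d'T.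
have vP := valid0_iterP M j d mu n j0 d0 dM vm.
have vP' := valid0_iterP M j d' mu n j0 d'0 d'M vm.
have F1 := Fle_Kdelta_time M (e / 2) j d d' _ _ j0 d0 dM d'0 d'M (ltW e2) vP vP'
  (hh1 d d' mu ad dT ad' d'T dh1 vm).
have vK : valid M (Kdelta j d (iter n (stepP j d) mu)) by apply: valid_Kdelta => //; exact: mulr_gt0.
have vK' : valid M (Kdelta j d' (iter n (stepP j d') mu)) by apply: valid_Kdelta => //; exact: mulr_gt0.
have k0 : 0 <= e / 2 + j * `|d - d'| by rewrite addr_ge0 ?(ltW e2)// mulr_ge0// ltW.
have F2 := Fle_Gconv M _ d _ _ d0 k0 vK vK' F1.
have F3 := Fle_norm _ _ _ (hh2 d d' _ ad dT ad' d'T dh2 vK').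
rewrite !iterS /stepP.
apply: (Fle_weak _ _ _ _ _ (Fle_trans _ _ _ _ _ F2 F3)).
have : j * `|d - d'| <= e / 4 by rewrite mulrC -ler_pdivlMr.
by move: (j * `|_|) => A; lra.
Qed.

Lemma Ulim_time j u a b e : 0 < j -> Linf_pos u -> 0 < Fd u 0 -> 0 < a -> a <= b -> 0 < e ->
  exists2 h, 0 < h & forall t t', a <= t -> t <= b -> a <= t' -> t' <= b -> `|t - t'| <= h ->
    Fle e (0, Ulim j u ^~ t) (0, Ulim j u ^~ t').
Proof.
move=> j0 hu M0 a0 ab e0; have b0 : 0 < b by exact: lt_le_trans ab.
(* The first entry makes the mesh admissible for the barriers, the second keeps the barrier error
   below [e / 2]; the other half pays for the change of step length. *)
pose m := Num.min (Fd u 0) (e / 2); have m0 : 0 < m by rewrite lt_min M0 divr_gt0.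
pose l := Num.bound (j * b / m).
have jb : 0 <= j * b / m by rewrite divr_ge0 ?(ltW m0)// mulr_ge0// ltW.
have l0 : 0 < l.+1%:R :> R by rewrite ltr0n.
have lm : j * (b / l.+1%:R) < m.
  rewrite mulrA ltr_pdivrMr// (mulrC m) -ltr_pdivrMr//.
  by apply: lt_trans (archi_boundP jb) _; rewrite ltr_nat.
move: (lm); rewrite lt_min => /andP[lM le2].
have al : 0 < a / l.+1%:R by rewrite divr_gt0.
have abl t t' : t <= t' -> t / l.+1%:R <= t' / l.+1%:R by move=> h; rewrite ler_wpM2r// invr_ge0.
have e2 : 0 < e / 2 by rewrite divr_gt0.
have [h h0 hh] := iterP_time (Fd u 0) j _ _ l.+1 j0 al (abl _ _ ab) lM _ e2.
exists h => // t t' at_ tb at' t'b tt.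
have t0 : 0 < t by exact: lt_le_trans at_.
have t'0 : 0 < t' by exact: lt_le_trans at'.
have lt s : s <= b -> j * (s / l.+1%:R) < m.
  by move=> sb; apply: le_lt_trans lm; rewrite ler_wpM2l ?(ltW j0)// abl.
have ltM s : s <= b -> j * (s / l.+1%:R) < Fd u 0 by move=> /lt; rewrite lt_min => /andP[].
have [U1 _] := Ulim_stepP j u t l j0 hu t0 (ltM _ tb).
have [_ U2] := Ulim_stepP j u t' l j0 hu t'0 (ltM _ t'b).
have tt' : `|t / l.+1%:R - t' / l.+1%:R| <= h.
  rewrite -mulrBl normrM (ger0_norm (_ : 0 <= l.+1%:R^-1)) ?invr_ge0//.
  by rewrite ler_pdivrMr//; apply: le_trans tt _; rewrite ler_peMr ?(ltW h0)// ler1n.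
have U3 := hh _ _ (0, u) (abl _ _ at_) (abl _ _ tb) (abl _ _ at') (abl _ _ t'b) tt' (valid0_u _ hu).
have := Fle_trans _ _ _ _ _ (Fle_trans _ _ _ _ _ U1 U3) U2; apply: Fle_weak.
have := lt _ t'b; rewrite lt_min => /andP[_].
by move: (j * _) => A; lra.
Qed.

Lemma Ulim_uniformly_continuous j u a b e : 0 < j -> Linf_pos u -> 0 < Fd u 0 -> 0 < a -> a <= b ->
  0 < e -> exists2 h, 0 < h & forall t t' r r', a <= t -> t <= b -> a <= t' -> t' <= b ->
    r \in `[0, 1] -> r' \in `[0, 1] -> `|t - t'| <= h -> `|r - r'| <= h ->
    `|Ulim j u r t - Ulim j u r' t'| <= e.
Proof.
move=> j0 hu M0 a0 ab e0; have e5 : 0 < e / 5 by rewrite divr_gt0.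
have [h [h0 h1 hh]] := Ulim_equicontinuous j u a b _ j0 hu M0 a0 ab e5.
have k0 : 0 < e / 5 * h by exact: mulr_gt0.
have [q q0 hq] := Ulim_time j u a b _ j0 hu M0 a0 ab k0.
exists (Num.min h q); first by rewrite lt_min h0.
move=> t t' r r' at_ tb at' t'b rI rI'; rewrite !le_min => /andP[_ tq] /andP[rh _].
have t0 : 0 < t by exact: lt_le_trans at_.
have t'0 : 0 < t' by exact: lt_le_trans at'.
have Ut := Ulim_in_U j u t j0 hu M0 t0; have Ut' := Ulim_in_U j u t' j0 hu M0 t'0.
have T x : x \in `[0, 1] -> `|tail_integral (Ulim j u ^~ t) x - tail_integral (Ulim j u ^~ t') x| <= e / 5 * h.
  have tq' : `|t' - t| <= q by rewrite distrC.
  move=> xI; exact: (norm_Fle_tail_integral _ _ _ _ (hq t t' at_ tb at' t'b tq) (hq t' t at' t'b at_ tb tq') xI).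
have D1 := density_close _ _ h (e / 5) _ (in_U_bmeas _ Ut) (in_U_bmeas _ Ut') h0 h1 (ltW e5)
  (fun x y xI yI => hh t x y at_ tb xI yI) (fun x y xI yI => hh t' x y at' t'b xI yI) T r rI.
have D2 := hh t' r r' at' t'b rI rI' rh.
have E : 2 * (e / 5) + 2 * (e / 5 * h) / h = 4 * (e / 5) by field; rewrite gt_eqF.
rewrite E /= in D1; move: D1 D2; move: (Ulim j u r t) (Ulim j u r t') (Ulim j u r' t') => A B C.
by rewrite !ler_norml => /andP[? ?] /andP[? ?]; apply/andP; split; lra.
Qed.

Lemma Ulim_continuous j u (Kc : set (R * R)) : 0 < j -> Linf_pos u -> 0 < Fd u 0 ->
  Kc `<=` [set p | p.1 \in `[0, 1] /\ 0 < p.2] ->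
  {within Kc, continuous (fun p : R * R => Ulim j u p.1 p.2)}.
Proof.
move=> j0 hu M0 sub; apply/subspace_continuousP => p Kp; apply/cvgrPdist_le => e e0.
have [p1 p2] := sub p Kp.
(* Uniform continuity is available on time slabs away from 0; the one from [p.2 / 2] to [2 * p.2]
   contains a neighbourhood of [p]. *)
have a0 : 0 < p.2 / 2 by rewrite divr_gt0.
have ab : p.2 / 2 <= 2 * p.2 by lra.
have [h h0 hh] := Ulim_uniformly_continuous j u _ _ e j0 hu M0 a0 ab e0.
have m0 : 0 < Num.min h (p.2 / 2) by rewrite lt_min h0.
rewrite near_withinE; apply: (filterS _ (nbhsx_ballx p _ m0)) => q [q1 q2] Kq.
have [qI _] := sub q Kq.
move: q1 q2; rewrite /ball/= !lt_min => /andP[q1 _] /andP[q2]; rewrite ltr_norml => /andP[q3 q4].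
by apply: hh => //; try exact: ltW; lra.
Qed.

(** A single step of length [t] suffices: it is within [j * t] of the limit function and within
    [j * t] of the pure flow, which is close to the bounded datum. *)
Lemma Ulim_small_time j u e : 0 < j -> Linf_pos u -> 0 < Fd u 0 -> 0 < e ->
  exists2 d, 0 < d & forall t r, 0 < t -> t <= d -> r \in `[0, 1] ->
    `|Fm (0, Ulim j u ^~ t) r - Fm (0, u) r| <= e.
Proof.
move=> j0 hu M0 e0; have [_ [_ [B hB]]] := hu.
pose C := `|B| + 1; have C0 : 0 < C by rewrite ltr_wpDl.
have uC x : x \in `[0, 1] -> u x <= C.
  by move=> xI; have := hB x xI; have := ler_norm B; rewrite /C; lra.
clearbody C.
have e2 : 0 < e / 2 / C by rewrite divr_gt0// divr_gt0.
have [d d0 hd] := Gconv_near_id _ e2.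
pose m := Num.min (Fd u 0 / 2) (e / 4); have m0 : 0 < m by rewrite lt_min !divr_gt0.
exists (Num.min d (m / j)); first by rewrite lt_min d0 divr_gt0.
move=> t r t0; rewrite le_min => /andP[td tj] rI.
have {}tj : j * t <= m by rewrite mulrC -ler_pdivlMr.
move: tj; rewrite le_min => /andP[tM te].
have vu := valid0_u u hu.
have tM' : j * t < Fd u 0 by lra.
have jt0 : 0 < j * t by exact: mulr_gt0.
have t1 : t / 1%:R = t by rewrite divr1.
have := Ulim_stepP j u t 0 j0 hu t0; rewrite t1 => /(_ tM') [U1 U2].
have [K1 K2] := Fle_Kdelta_id _ j t _ jt0 tM' vu.
have vK := valid_Kdelta _ j t _ vu jt0 tM'.
have G1 := Fle_Gconv _ _ t _ _ t0 (lexx 0) vK vu.1 K1.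
have G2 := Fle_Gconv _ _ t _ _ t0 (ltW jt0) vu.1 vK K2.
have N : `|Fm (Gconv t (0, u)) r - Fm (0, u) r| <= e / 2.
  have <- : C * (e / 2 / C) = e / 2 by rewrite mulrC divfK// gt_eqF.
  exact: (hd t (0, u) C t0 td vu.1.1 vu.2 (ltW C0) uC r rI).
move: N (U1 r rI) (U2 r rI) (G1 r rI) (G2 r rI); rewrite /= /stepP.
move: (Fm (0, Ulim j u ^~ t) r) (Fm (Gconv t (Kdelta j t _)) r) (Fm (Gconv t (0, u)) r) (Fm (0, u) r).
move: te; move: (j * t) => J te A X G D; rewrite !ler_norml => /andP[? ?] ? ? ? ?.
by apply/andP; split; lra.
Qed.

End Regularity.

(** * Weak convergence and uniqueness *)

Section Conclusion.
Context {R : realType}.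
Local Notation I := (@I01 R).
Local Notation mu := (@lebesgue_measure R).
Implicit Types (f g u : R -> R) (a b e k s t r x y M L j d T : R).

Lemma Fm_Lint f r : Fm (0, f) r = Lint (`[r, 1] : set R) f.
Proof. by rewrite /Fm/= if_same add0r. Qed.

Local Opaque Gconv Kdelta Fm stepP stepQ.

Lemma within_uniformly_continuous f e : {within I, continuous f} -> 0 < e ->
  exists2 h, 0 < h & forall x y, x \in `[0, 1] -> y \in `[0, 1] -> `|x - y| <= h -> `|f x - f y| <= e.
Proof.
move=> /subspace_continuousP cf e0.
have e2 : 0 < e / 2 by rewrite divr_gt0.
have := @segment_compact R 0 1; rewrite compact_near_coveringP => cover.
have := cover R (at_right (0 : R)) (fun h x => forall y, y \in `[0, 1] -> x \in `[0, 1] -> `|x - y| <= h ->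
  `|f x - f y| <= e) _.
case.
  move=> x xI; have /cvgrPdist_le /(_ _ e2) := cf x xI.
  rewrite near_withinE => /nbhs_ballP[p /= p0 hp].
  have p2 : 0 < p / 2 by rewrite divr_gt0.
  exists (ball x (p / 2), [set h | h < p / 2]) => /=.
    by split; [exact: nbhsx_ballx|exact: nbhs_right_lt].
  move=> [x' h] /= [xx' hp2] y yI x'I xy.
  rewrite /ball/= in xx'.
  have b1 : ball x p x' by rewrite /ball/=; apply: lt_trans xx' _; lra.
  have b2 : ball x p y.
    rewrite /ball/=; move: xx' xy; rewrite !ltr_norml !ler_norml => /andP[? ?] /andP[? ?].
    by apply/andP; split; lra.
  have a1 : `|f x - f x'| <= e / 2 := hp x' b1 x'I.
  have a2 : `|f x - f y| <= e / 2 := hp y b2 yI.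
  move: a1 a2; move: (f x) (f x') (f y) => A B C.
  by rewrite !ler_norml => /andP[? ?] /andP[? ?]; apply/andP; split; lra.
move=> h /= h0 hh; exists (h / 2); first by rewrite divr_gt0.
move=> x y xI yI xy; apply: (hh (h / 2)) => //.
- by rewrite /ball/= sub0r normrN gtr0_norm; lra.
- by lra.
Qed.

(** The test function is no longer monotone, so its variation along the grid appears as a
    constant. *)
Lemma pairing_step_dist mu1 mu2 f (N : nat) k : in_U mu1 -> in_U mu2 -> (0 < N)%N ->
  (forall r, r \in `[0, 1] -> `|Fm mu1 r - Fm mu2 r| <= k) ->
  `|pairing mu1 (step f N N) - pairing mu2 (step f N N)| <=
    (`|f 0| + \sum_(i < N) `|f (i.+1%:R / N%:R) - f (i%:R / N%:R)|) * k.
Proof.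
move=> U1 U2 N0 hk; rewrite !pairing_step// opprD addrACA -mulrBr -sumrB mulrDl.
apply: le_trans (ler_normD _ _) _; apply: lerD.
  by rewrite normrM ler_wpM2l// hk// mem0I.
rewrite mulr_suml; apply: le_trans (ler_norm_sum _ _ _) _; apply: ler_sum => i _.
by rewrite -mulrBr normrM ler_wpM2l// hk// frac01// ltnW.
Qed.

Lemma pairing_density f g : pairing (0, g) f = Lint I (fun x => f x * g x).
Proof. by rewrite /pairing/= mul0r add0r. Qed.

Lemma Ulim_weak j u f : 0 < j -> Linf_pos u -> 0 < Fd u 0 -> {within `[0, 1], continuous f} ->
  (fun t => Lint I (fun r => f r * Ulim j u r t)) @ at_right (0 : R) --> Lint I (fun r => f r * u r).
Proof.
move=> j0 hu M0 cf; set M := Fd u 0 in M0 *.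
have bf : bmeas f by exact: bmeas_within_continuous.
apply/cvgrPdist_le => e e0.
have e1 : 0 < e / (6 * M) by rewrite divr_gt0// mulr_gt0.
have [h h0 hh] := within_uniformly_continuous f _ cf e1.
have h1 : 0 <= h^-1 by rewrite invr_ge0 ltW.
pose N := (Num.bound h^-1).+1.
have Nh : N%:R^-1 <= h.
  rewrite invf_ple ?posrE//; apply: ltW; apply: lt_trans (archi_boundP h1) _.
  by rewrite ltr_nat.
have osc x y : x \in `[0, 1] -> y \in `[0, 1] -> `|x - y| <= N%:R^-1 -> `|f x - f y| <= e / (6 * M).
  by move=> xI yI xy; apply: hh => //; exact: le_trans Nh.
have N0 : (0 < N)%N by [].
clearbody N.
pose C := `|f 0| + \sum_(i < N) `|f (i.+1%:R / N%:R) - f (i%:R / N%:R)|.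
have C0 : 0 <= C by rewrite addr_ge0// sumr_ge0.
(* [C] depends on the partition, so the closeness of tails is chosen only after the latter. The
   bound [k <= M] keeps the mass at time [t] below [2 * M]; the errors are then [e / 6], [e / 3] and
   [e / 2]. *)
pose k := Num.min M (e / 2 / (C + 1)).
have C1 : 0 < C + 1 by rewrite ltr_wpDl.
have k0 : 0 < k by rewrite lt_min M0 divr_gt0// divr_gt0.
have kM : k <= M by rewrite ge_min lexx.
have kC : C * k <= e / 2.
  apply: (@le_trans _ _ ((C + 1) * k)); first by rewrite ler_wpM2r ?(ltW k0)// lerDl.
  by rewrite mulrC -ler_pdivlMr// ge_min lexx orbT.
have [d d0 hd] := Ulim_small_time j u k j0 hu M0 k0.
near=> t.
have t0 : 0 < t by near: t; exact: nbhs_right_gt.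
have td : t <= d by near: t; exact: nbhs_right_le.
have Ut := Ulim_in_U j u t j0 hu M0 t0; have vu := valid0_u u hu.
have hk r : r \in `[0, 1] -> `|Fm (0, u) r - Fm (0, Ulim j u ^~ t) r| <= k.
  by move=> rI; rewrite distrC; exact: hd.
rewrite -(pairing_density f u) -(pairing_density f (Ulim j u ^~ t)).
have S0 := pairing_step_dist (0, u) (0, Ulim j u ^~ t) f N k vu.1.1 Ut N0 hk.
have S1 := pairing_step_approx (0, u) f N _ vu.1.1 bf N0 (ltW e1) osc.
have S2 := pairing_step_approx (0, Ulim j u ^~ t) f N _ Ut bf N0 (ltW e1) osc.
have F0 : Fm (0, u) 0 = M by exact: vu.1.2.
have := hk 0 mem0I.
rewrite -/C in S0; rewrite F0 in S1 *.
move: kC S0 S1 S2; move: (Fm (0, Ulim j u ^~ t) 0) (pairing (0, u) f) (pairing (0, u) (step f N N))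
  (pairing (0, Ulim j u ^~ t) f) (pairing (0, Ulim j u ^~ t) (step f N N)) (C * k) => FU A1 A2 A3 A4 D.
have E : e / (6 * M) * M = e / 6 by field; rewrite gt_eqF.
rewrite E => kC S0 S1 S2; rewrite ler_norml => /andP[FU1 _].
have {FU1}FU1 : FU <= 2 * M by lra.
have {FU1}E2 : e / (6 * M) * FU <= e / 3.
  apply: le_trans (_ : e / (6 * M) * (2 * M) <= _); first by rewrite ler_wpM2l// ltW.
  by rewrite mulrCA E; lra.
move: S0 S1 S2; rewrite !ler_norml => /andP[? ?] /andP[? ?] /andP[? ?].
by apply/andP; split; lra.
Unshelve. all: by end_near. Qed.

(** Extended by zero, [W] has an identically vanishing primitive, whose derivative is [W] almost
    everywhere. *)
Lemma tail_integrals_eq0 (W : R -> R) : mu.-integrable I (EFin \o W) ->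
  (forall r, r \in `[0, 1] -> Lint (`[r, 1] : set R) W = 0) ->
  {ae mu, forall r, r \in `[0, 1] -> W r = 0}.
Proof.
move=> iW tail0.
have tot : Rintegral mu I W = 0 by exact: (tail0 0 mem0I).
have iWI : mu.-integrable setT (EFin \o (W \_ I)).
  by rewrite -restrict_EFin -integrable_mkcond//; exact: measurable_I01.
have locW := integrable_locally measurable_I01 iW.
(* [FTC1] only gives the derivative to the right of its left bound, hence the [-1]. *)
have iy (y : R) : mu.-integrable [set` Interval (BLeft (-1 : R)) (BRight y)] (EFin \o (W \_ I)).
  by apply: integrableS iWI.
have F0 : (fun y => Rintegral mu [set` Interval (BLeft (-1 : R)) (BRight y)] (W \_ I)) = cst 0.
  apply/funext => y; rewrite -Rintegral_mkcondr/=.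
  have [y0|y0] := ltP y 0.
    rewrite (_ : _ `&` _ = set0) ?Rintegral_set0//; apply/seteqP; split => // x [].
    rewrite /I01/= !in_itv/= => /andP[_ xy] /andP[x0 _].
    by have := le_lt_trans (le_trans x0 xy) y0; rewrite ltxx.
  have [y1|y1] := ltP 1 y.
    rewrite (_ : _ `&` _ = I)//; apply/seteqP; split => [x []//|x xI]; split => //.
    move: xI; rewrite /I01/= !in_itv/= => /andP[x0 x1].
    by rewrite (le_trans _ x0) ?lerN10//= (le_trans x1 (ltW y1)).
  have yI : y \in `[0, 1] by rewrite in01 y0.
  rewrite (_ : _ `&` _ = [set` Interval (BLeft (0 : R)) (BRight y)]); last first.
    apply/seteqP; split => [x []|x].
      by rewrite /I01/= !in_itv/= => /andP[_ xy] /andP[-> _].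
    rewrite /I01/= !in_itv/= => /andP[x0 xy].
    by split; rewrite ?x0 ?(le_trans _ x0) ?lerN10//= (le_trans xy y1).
  have := @Rintegral_itvB R W (BLeft 0) (BRight 1) y iW.
  rewrite !bnd_simp => /(_ y0 y1).
  rewrite Rintegral_itv_obnd_cbnd; last first.
    by apply: integrableS iW => //; [exact: measurable_I01|apply: subset_itvr; rewrite bnd_simp].
  have := tail0 y yI; rewrite /Lint => ->.
  by rewrite -/(@I01 R) tot sub0r => /eqP; rewrite oppr_eq0 => /eqP.
have := @FTC1 R (W \_ I) (BLeft (-1 : R)) iy locW.
apply: filterS; first exact: (ae_filter_ringOfSetsType mu).
move=> r /= H rI; have r0 : ((-1)%:E < r%:E)%E.
  by move: rI; rewrite in01 lte_fin => /andP[r0 _]; apply: lt_le_trans r0; rewrite ltrN10.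
by have [_] := H r0; rewrite F0 derive1_cst patchE mem_set.
Qed.

(** Every mesh [t / (l + 1)] passes through [t], so each function is below [S^+], hence below [S^-]
    plus the gap, hence below the other function plus the gap, with [l] as large as desired. *)
Lemma separates_Fm_unique j u V V' t : 0 < j -> 0 < Fd u 0 -> Linf_pos u -> 0 < t ->
  separates j u V -> separates j u V' ->
  forall r, r \in `[0, 1] -> Fm (0, V ^~ t) r = Fm (0, V' ^~ t) r.
Proof.
move=> j0 M0 hu t0 sV sV'.
suff W V1 V2 e r : separates j u V1 -> separates j u V2 -> 0 < e -> r \in `[0, 1] ->
    Fm (0, V1 ^~ t) r <= Fm (0, V2 ^~ t) r + e.
  move=> r rI; apply/eqP; rewrite eq_le.
  by apply/andP; split; apply/ler_addgt0Pr => e e0; exact: W.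
move=> s1 s2 e0 rI.
pose m := Num.min (Fd u 0) e; have m0 : 0 < m by rewrite lt_min M0.
pose l := Num.bound (j * t / m).
have jt : 0 <= j * t / m by rewrite divr_ge0 ?(ltW m0)// mulr_ge0// ltW.
have l0 : 0 < l.+1%:R :> R by rewrite ltr0n.
have lm : j * (t / l.+1%:R) < m.
  rewrite mulrA ltr_pdivrMr// (mulrC m) -ltr_pdivrMr//.
  by apply: lt_trans (archi_boundP jt) _; rewrite ltr_nat.
move: lm; rewrite lt_min => /andP[lM le].
have d0 : 0 < t / l.+1%:R by rewrite divr_gt0.
have E : l.+1%:R * (t / l.+1%:R) = t by rewrite mulrC divfK// pnatr_eq0.
have [_ h1] := s1 _ d0 lM l; have [h2 _] := s2 _ d0 lM l; rewrite E in h1 h2.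
have h3 := Fle_iterP_iterQ (Fd u 0) j _ (0, u) l.+1 j0 d0 lM (valid0_u _ hu).
have a1 := h1 r rI; have a2 := h2 r rI; have a3 := h3 r rI.
apply: le_trans a1 _; apply: le_trans a3 _; apply: lerD; first exact: a2.
exact: ltW.
Qed.

Lemma separates_ae_unique j u V U t : 0 < j -> 0 < Fd u 0 -> Linf_pos u -> 0 < t ->
  mu.-integrable I (fun r => (V r t)%:E) -> mu.-integrable I (fun r => (U r t)%:E) ->
  separates j u V -> separates j u U ->
  {ae mu, forall r, r \in `[0, 1] -> V r t = U r t}.
Proof.
move=> j0 M0 hu t0 iV iU sV sU.
have FF := separates_Fm_unique j u V U t j0 M0 hu t0 sV sU.
have iW : mu.-integrable I (EFin \o (fun r => V r t - U r t)).
  rewrite (_ : _ \o _ = (fun r => (V r t)%:E - (U r t)%:E)%E); last by apply/funext => r; rewrite /= EFinB.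
  by apply: integrableB => //; exact: measurable_itv.
have /(tail_integrals_eq0 _ iW) : forall r, r \in `[0, 1] ->
    Lint (`[r, 1] : set R) (fun r => V r t - U r t) = 0.
  move=> r rI; have sub : [set` `[r, 1]] `<=` I.
    by move: rI; rewrite in01 => /andP[r0 _]; apply: subset_itvr; rewrite bnd_simp.
  rewrite /Lint RintegralB//; last 2 first.
  - by apply: integrableS iV => //; exact: measurable_itv.
  - by apply: integrableS iU => //; exact: measurable_itv.
  have := FF r rI; rewrite !Fm_Lint /Lint => ->.
  by rewrite subrr.
apply: filterS; first exact: (ae_filter_ringOfSetsType mu).
by move=> r h rI; apply/eqP; rewrite -subr_eq0; apply/eqP; exact: h.
Qed.

Lemma Ulim_separates j u : 0 < j -> Linf_pos u -> separates j u (Ulim j u).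
Proof.
move=> j0 hu d d0 dM k; have [h1 h2] := Ulim_barriers j u d k j0 hu d0 dM.
by split; exact: Fle_meas_le.
Qed.

End Conclusion.

Theorem mainTheorem3 (R : realType) (j : R) (u : R -> R) :
  0 < j -> Linf_pos u -> 0 < Fd u 0 ->
  exists U : R -> R -> R,
    [/\ separates j u U,
        (* continuity on compact subsets of [0,1] x (0, oo) *)
        (forall Kc : set (R * R), compact Kc ->
           Kc `<=` [set p | p.1 \in `[0, 1] /\ 0 < p.2] ->
           {within Kc, continuous (fun p : R * R => U p.1 p.2)}),
        (* weak convergence of U(.,t) dr to u dr as t -> 0+ *)
        (forall f : R -> R, {within `[0, 1], continuous f} ->
           (fun t => Lint (@I01 R) (fun r => f r * U r t)) @ at_right (0 : R)
             --> Lint (@I01 R) (fun r => f r * u r)) &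
        (* uniqueness (up to Lebesgue-null sets in r, for each t > 0) *)
        (forall V : R -> R -> R,
           (forall t, 0 < t ->
              (@lebesgue_measure R).-integrable (@I01 R) (fun r => (V r t)%:E)) ->
           separates j u V ->
           forall t, 0 < t ->
             {ae @lebesgue_measure R, forall r, r \in `[0, 1] -> V r t = U r t})].
Proof.
move=> j0 hu M0; exists (Ulim j u); split.
- exact: Ulim_separates.
- by move=> Kc _; exact: Ulim_continuous.
- by move=> f; exact: Ulim_weak.
- move=> V iV sV t t0; apply: (separates_ae_unique j u) => //; first exact: iV.
    exact: (bmeas_integrable _ (in_U_bmeas _ (Ulim_in_U j u t j0 hu M0 t0))).
  exact: Ulim_separates.
Qed.
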